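(* There is an absolute constant $c>6$ (used in the definition of $\ell_s$) such that the following holds. Let $K\subseteq\mathbb R^p$ be a centrally symmetric, sign-invariant and permutation-invariant convex body, and let $\beta\in K$. Let $Y=X\beta+\xi$, where the rows $X_1,\dots,X_N$ of $X\in\mathbb R^{N\times p}$ are independent, mean-zero, $L$-sub-Gaussian random vectors with covariance $\Sigma=\mathbb E X_iX_i^\top$ satisfying $\lambda_- I_p\preceq\Sigma\preceq\lambda_+ I_p$ for some $0<\lambda_-\le\lambda_+<\infty$, and $\xi=(\xi_1,\dots,\xi_N)$ has independent, mean-zero, sub-Gaussian entries with $\|\xi_i\|_{\psi_2}\le\sigma$, and is independent of $X$. Let $$(\widehat s,\widehat\beta)\in\operatorname*{argmin}_{1\le s\le p,\ \nu\in K^{(s)}}\left\{\frac1N\|Y-X\nu\|_2^2+\lambda\operatorname{pen}(s)\right\}.$$ There exist constants $\lambda_0>0$ and $C>0$ depending only on $L,\lambda_-,\lambda_+$ such that, if $\lambda\ge\lambda_0$, then $$\mathbb E\|\widehat\beta-\beta\|_2^2\le C\inf_{1\le t\le p}\ \inf_{x\in K^{(t)}}\left\{\|x-\beta\|_2^2+(\lambda+1)\operatorname{pen}(t)\right\}.$$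
   Context: A convex body is a compact convex set with nonempty interior. $K$ is sign-invariant and permutation-invariant if $(\varepsilon_1x_{\pi(1)},\dots,\varepsilon_px_{\pi(p)})\in K$ for all $x\in K$, all signs $\varepsilon_j\in\{-1,1\}$ and all permutations $\pi$ of $\{1,\dots,p\}$. For $1\le s\le p$, $K^{(s)}=\operatorname{conv}\{v\in K:\|v\|_0\le s\}$, where $\|v\|_0$ is the number of nonzero entries of $v$. The Gaussian width of $T\subseteq\mathbb R^p$ is $w(T)=\mathbb E\sup_{v\in T}\langle g,v\rangle$ with $g\sim N(0,I_p)$. Put $w_s=w(K^{(s)})$, $\ell_s=c\log(e+s)$, and $$\operatorname{pen}(s)=\sigma\left(\frac{w_s\sqrt{\ell_s}}{\sqrt N}+\frac{w_s\ell_s}{N}\right)+\frac{w_s^2\ell_s}{N}.$$ For a real random variable $Z$, $\|Z\|_{\psi_2}=\inf\{a>0:\mathbb E\exp(Z^2/a^2)\le e\}$. A mean-zero random vector $X_i$ in $\mathbb R^p$ is $L$-sub-Gaussian if $\mathbb E\exp(\delta\langle v,X_i\rangle)\le\exp(\delta^2L^2/2)$ for all $\delta\in\mathbb R$ and all unit vectors $v\in\mathbb R^p$. *)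

(* Defs.v *)
From HB Require Import structures.
From mathcomp Require Import all_boot all_order all_algebra all_fingroup.
From mathcomp Require Import all_classical all_reals all_analysis.

Set Implicit Arguments.
Unset Strict Implicit.
Unset Printing Implicit Defensive.

Import Order.TTheory GRing.Theory Num.Theory.
Import numFieldNormedType.Exports.

Local Open Scope classical_set_scope.
Local Open Scope ring_scope.

Section euclidean.
Context {R : realType}.

Definition sqnorm2 (p : nat) (v : 'cV[R]_p) : R := \sum_(j < p) (v j 0) ^+ 2.

Definition norm0 (p : nat) (v : 'cV[R]_p) : nat := #|[pred j | v j 0 != 0]|.

(* A <= B for symmetric matrices: B - A is positive semidefinite *)
Definition loewner_le (p : nat) (A B : 'M[R]_p) : Prop :=
  forall v : 'cV[R]_p, 0 <= (v^T *m (B - A) *m v) 0 0.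

Definition convex_body (p : nat) (K : set 'cV[R]_p) : Prop :=
  [/\ compact K, convex_set K & K° !=set0].

Definition centrally_symmetric (p : nat) (K : set 'cV[R]_p) : Prop :=
  forall x, K x -> K (- x).

Definition sign_perm_invariant (p : nat) (K : set 'cV[R]_p) : Prop :=
  forall (x : 'cV[R]_p) (eps : 'I_p -> bool) (pi : 'S_p), K x ->
    K (\col_j ((-1) ^+ eps j * x (pi j) 0)).

Definition convex_hull (p : nat) (A : set 'cV[R]_p) : set 'cV[R]_p :=
  smallest (fun C => convex_set C) A.

Definition sparse_hull (p : nat) (K : set 'cV[R]_p) (s : nat) : set 'cV[R]_p :=
  convex_hull [set v | K v /\ (norm0 v <= s)%N].

End euclidean.

Definition argmin {R : realType} (U : Type) (D : set U) (f : U -> R) : set U :=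
  [set u | D u /\ forall v, D v -> f u <= f v].

Section gaussian.
Context {R : realType}.

(* [normal_prob] lives on [measurableTypeR R], an alias of R *)
Local Notation RT := (measurableTypeR R).

Definition tuple_consp (n : nat) (x : RT * n.-tuple RT) : n.+1.-tuple RT :=
  [the n.+1.-tuple RT of x.1 :: x.2].

Lemma measurable_tuple_consp (n : nat) :
  measurable_fun [set: RT * n.-tuple RT] (@tuple_consp n).
Proof. exact: measurable_cons. Qed.

HB.instance Definition _ (n : nat) :=
  isMeasurableFun.Build _ _ _ _ (@tuple_consp n) (@measurable_tuple_consp n).

(* N(0, I_n), as the n-fold product of the standard normal law *)
Fixpoint std_gaussian (n : nat) : probability (n.-tuple RT) R :=
  match n with
  | 0 => \d_[tuple]
  | n'.+1 => distribution (normal_prob 0 1 \x std_gaussian n')%E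
               (@tuple_consp n')
  end.

Lemma std_gaussian_box (n : nat) (A : 'I_n -> set RT) :
  (forall j, measurable (A j)) ->
  measurable [set g : n.-tuple RT | forall j, A j (tnth g j)] /\
  std_gaussian n [set g : n.-tuple RT | forall j, A j (tnth g j)] =
    (\prod_(j < n) normal_prob 0 1 (A j))%E.
Proof.
elim: n A => [|n IH] A mA.
  have -> : [set g : 0.-tuple RT | forall j, A j (tnth g j)] = setT.
    by apply/seteqP; split=> // g _ [].
  by split; [exact: measurableT|rewrite big_ord0 /= diracT].
have [mB EB] := IH (fun j => A (lift ord0 j)) (fun j => mA _).
split.
  have -> : [set g : n.+1.-tuple RT | forall j, A j (tnth g j)] =
     \bigcap_(j in [set: 'I_n.+1]) ((fun g => tnth g j) @^-1` A j).
    by apply/seteqP; split=> g /= h j; [move=> _; exact: h|exact: (h j I)].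
  apply: fin_bigcap_measurable => // j _; rewrite -[X in measurable X]setTI.
  exact: (@measurable_tnth _ RT n.+1 j).
rewrite /= /distribution /pushforward big_ord_recl.
have -> : (@tuple_consp n) @^-1` [set g | forall j, A j (tnth g j)] =
   A ord0 `*` [set g : n.-tuple RT | forall j, A (lift ord0 j) (tnth g j)].
  apply/seteqP; split=> [[x g]/= h|[x g] /= [h0 h] j].
    split; first by have := h ord0; rewrite tnth0.
    by move=> j; have := h (lift ord0 j); rewrite tnthS.
  by case: (unliftP ord0 j) => [k ->|->]; rewrite ?tnthS ?tnth0.
by rewrite product_measure1E// -EB.
Qed.

Definition gaussian_width (p : nat) (T : set 'cV[R]_p) : \bar R :=
  (\int[std_gaussian p]_g
     ereal_sup [set (\sum_(j < p) (tnth g j : R) * v j 0)%R%:E | v in T])%E.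

End gaussian.

Section penalty.
Context {R : realType}.

Definition log_factor (c : R) (s : nat) : R := c * ln (expR 1 + s%:R).

(* [gaussian_width] is finite on nonempty bounded sets, so [fine] loses
   nothing when K is a convex body containing 0 *)
Definition pen (c sigma : R) (N p : nat) (K : set 'cV[R]_p) (s : nat) : R :=
  let w := fine (gaussian_width (sparse_hull K s)) in
  let l := log_factor c s in
  sigma * (w * Num.sqrt l / Num.sqrt N%:R + w * l / N%:R) + w ^+ 2 * l / N%:R.

End penalty.

Section random.
Context {d : measure_display} {T : measurableType d} {R : realType}.
Variable P : probability T R.

Definition random_matrix (m n : nat) (M : T -> 'M[R]_(m, n)) : Prop :=
  forall i j, measurable_fun [set: T] (fun w => M w i j).

(* sigma-algebra generated by (the entries of) M *)
Definition sigma_matrix (m n : nat) (M : T -> 'M[R]_(m, n)) : set (set T) :=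
  <<s \bigcup_(ij in [set: 'I_m * 'I_n])
        preimage_set_system [set: T] (fun w => M w ij.1 ij.2) measurable >>.

Definition mutually_independent (I : finType) (F : I -> set (set T)) : Prop :=
  forall (J : {set I}) (E : I -> set T),
    (forall i, i \in J -> F i (E i)) ->
    P (\bigcap_(i in [set` J]) E i) = (\prod_(i in J) P (E i))%E.

Definition independent_systems (F G : set (set T)) : Prop :=
  forall A B, F A -> G B -> P (A `&` B) = (P A * P B)%E.

(* 'E_P[f] is the difference of the integrals of the positive and negative
   parts, and +oo - +oo = -oo, so a finite value forces f to be integrable *)
Definition mean_zero (m n : nat) (M : T -> 'M[R]_(m, n)) : Prop :=
  forall i j, ('E_P[fun w => M w i j] = 0)%E.

Definition sub_gaussian (L : R) (p : nat) (Z : T -> 'rV[R]_p) : Prop :=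
  forall (delta : R) (v : 'cV[R]_p), sqnorm2 v = 1 ->
    ('E_P[fun w => expR (delta * (Z w *m v) 0 0)%R]
       <= (expR (delta ^+ 2 * L ^+ 2 / 2))%:E)%E.

Definition has_second_moment (p : nat) (Z : T -> 'rV[R]_p) (Sigma : 'M[R]_p) :
    Prop :=
  forall j k, ('E_P[fun w => ((Z w)^T *m Z w) j k] = (Sigma j k)%:E)%E.

(* equal to +oo when Z is not sub-Gaussian *)
Definition psi2_norm (Z : T -> R) : \bar R :=
  ereal_inf [set a%:E | a in [set a : R | 0 < a /\
    ('E_P[fun w => expR ((Z w) ^+ 2 / a ^+ 2)%R] <= (expR 1)%:E)%E]].

End random.

(* Main.v *)
(** A permuted and signed copy of an s-sparse u in K can place its entries, one
    per block of floor(p/s) coordinates, at the largest Gaussian of the block;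
    hence |u|_1 sqrt(1 + ln(p/s)) <= const w_s, and, since
    1 + ln p <= (1 + ln(p/s)) l_s, all of K^(s) lies in the l1 ball of radius
    const w_s sqrt(l_s) / sqrt(1 + ln p).  This reduces the theorem to l1 geometry
    and no chaining is needed.
    - Design: off an event of probability O(1/N^2), Maurey's empirical method and
      a union bound over the (2p)^m sums of m signed basis vectors give
      |Xv|_2^2 / N >= c |v|_2^2 - C |v|_1^2 (1 + ln p) / N for all v.
    - Noise: conditionally on xi, the coordinates of X^T xi are sub-Gaussian with
      parameter L |xi|_2, and |xi|_2^2 has exponential moments; the excess over
      lambda pen(s), uniformly in s, has mean O(pen(1)).
    - On the exceptional event |v|_2^2 <= |v|_oo |v|_1, which the penalty absorbs
      because its probability is O(1/N^2). *)

Require Import Defs.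
From mathcomp Require Import all_boot all_order all_algebra all_fingroup.
From mathcomp Require Import all_classical all_reals all_analysis.
From mathcomp Require Import measurable_realfun.
From mathcomp Require Import ring lra zify.

Import Order.TTheory GRing.Theory Num.Theory.
Import numFieldNormedType.Exports.
Import HBNNSimple.

Local Open Scope classical_set_scope.
Local Open Scope ring_scope.

(** * Independence and integrals *)

(** The loss is measured from a competitor x in K^(t) rather than from beta: beta need not be
    sparse, whereas betahat - x is a difference of points of two sparse hulls, so its l1 norm is
    controlled by w_shat and w_t. Since shat is random, pen(shat) has to be bounded as well; taking
    lambda above the noise constant by 1 leaves one full copy of pen(shat) on the left of the basic
    inequality. The noise bound has to hold for all s with a single remainder. No union over s is
    taken: as long as |xi|_2 is moderate relative to l_s, the l1 radius of K^(s) is used; beyond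
    that, s <= exp(l_s) is itself small compared with an exponential of |xi|_2^2, and the crude l1
    bound that is linear in s suffices. The switch between the two regimes produces the factor 1 +
    sqrt(l_s / N), that is, the second term of pen(s). The error is bounded pointwise by one
    measurable function of X and xi that involves neither shat nor betahat, and only this function
    is integrated. *)

(** The integral of a nonnegative function is a supremum over the simple functions below it, so
    monotonicity needs no measurability. This allows comparing the suprema inside Gaussian
    widths. *)
Lemma ge0_le_integral_nm {d} {T : measurableType d} {R : realType}
    (mu : measure T R) (f g : T -> \bar R) :
  (forall x, 0 <= f x)%E -> (forall x, f x <= g x)%E ->
  (\int[mu]_x f x <= \int[mu]_x g x)%E.
Proof.
move=> f0 fg.
have g0 x : (0 <= g x)%E by exact: le_trans (fg x).
rewrite !ge0_integralTE//; apply: ereal_sup_le => _ [h /= hf <-].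
by exists h => //= x; exact: le_trans (fg x).
Qed.

Section indep.
Context {d} {T : measurableType d} {R : realType} (P : probability T R).

(** Simple functions [phi n] of a real variable are composed with f, so that the level sets of the
    approximants are preimages of Borel sets under f, to which the hypothesis applies. Finiteness of
    the integral of h lets the product on the right pass to the limit. *)
Lemma integral_mul_indep (h f : T -> R) :
  measurable_fun setT h -> measurable_fun setT f ->
  (forall w, 0 <= h w) -> (forall w, 0 <= f w) ->
  (\int[P]_w (h w)%:E < +oo)%E ->
  (forall B, measurable B ->
    (\int[P]_w (h w * \1_(f @^-1` B) w)%:E =
       \int[P]_w (h w)%:E * P (f @^-1` B))%E) ->
  (\int[P]_w (h w * f w)%:E = \int[P]_w (h w)%:E * \int[P]_w (f w)%:E)%E.
Proof.
move=> mh mf h0 f0 hoo H.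
(* The approximated function has to be nonnegative on all of R; the absolute value agrees with the
   identity on the range of f. *)
have mabs : measurable_fun [set: R] (fun x : R => (`|x|)%:E : \bar R).
  by apply/measurable_EFinP; exact: normr_measurable.
pose phi := nnsfun_approx measurableT mabs.
have phicvg x : 0 <= x -> (phi n x)%:E @[n --> \oo] --> x%:E.
  move=> x0; have := cvg_nnsfun_approx measurableT mabs (fun _ _ => normr_ge0 _) (I : setT x).
  by rewrite /= ger0_norm.
have phind x : {homo (fun n => phi n x) : n m / (n <= m)%N >-> n <= m}.
  by move=> n m nm; have /lefP := nd_nnsfun_approx measurableT mabs nm; apply.
have phi0 n x : 0 <= phi n x by [].
have mphi n : measurable_fun setT (phi n \o f) by apply: measurableT_comp.
have step n : (\int[P]_w (h w * phi n (f w))%:E =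
    \int[P]_w (h w)%:E * \int[P]_w (phi n (f w))%:E)%E.
  have mpre y : measurable (f @^-1` (phi n @^-1` [set y])).
    by rewrite -[X in measurable X]setTI; apply: mf => //.
  have e1 w : (phi n (f w))%:E =
     (\sum_(y \in range (phi n)) (y * \1_(f @^-1` (phi n @^-1` [set y])) w)%:E)%E.
    rewrite fsumEFin//; congr EFin.
    rewrite {1}(fimfunE (phi n) (f w)); apply: eq_fsbigr => y _.
    by [].
  under [X in _ = (_ * X)%E]eq_integral do rewrite e1.
  rewrite ge0_integral_fsum//; last 2 first.
  - move=> y; apply/measurable_EFinP; apply: measurable_funM => //.
  (* Nonnegativity is asked for every real y, not only for values of [phi n]; for y < 0 the level
     set is empty. *)
  - move=> y w _; rewrite lee_fin; case: (ltP y 0) => [y0|y0].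
      rewrite indicE memNset ?mulr0// => /= e; have := phi0 n (f w); rewrite e; lra.
    by rewrite mulr_ge0.
  have e2 w : (h w * phi n (f w))%:E =
     (\sum_(y \in range (phi n)) (h w * (y * \1_(f @^-1` (phi n @^-1` [set y])) w))%:E)%E.
    rewrite EFinM e1 ge0_mule_fsumr//.
    move=> y; rewrite lee_fin; case: (ltP y 0) => [y0|y0].
      rewrite indicE memNset ?mulr0// => /= e; have := phi0 n (f w); rewrite e; lra.
    by rewrite mulr_ge0.
  under eq_integral do rewrite e2.
  rewrite ge0_integral_fsum//; last 2 first.
  - move=> y; apply/measurable_EFinP; apply: measurable_funM => //.
    by apply: measurable_funM => //.
  - move=> y w _; rewrite lee_fin; apply: mulr_ge0 => //; case: (ltP y 0) => [y0|y0].
      rewrite indicE memNset ?mulr0// => /= e; have := phi0 n (f w); rewrite e; lra.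
    by rewrite mulr_ge0.
  rewrite ge0_mule_fsumr//; last first.
    move=> y; apply: integral_ge0 => w _; rewrite lee_fin; case: (ltP y 0) => [y0|y0].
      rewrite indicE memNset ?mulr0// => /= e; have := phi0 n (f w); rewrite e; lra.
    by rewrite mulr_ge0.
  apply: eq_fsbigr => y; rewrite inE => -[x _ <-].
  under eq_integral do rewrite mulrCA EFinM.
  rewrite ge0_integralZl_EFin//; last 2 first.
  - by move=> w _; rewrite lee_fin mulr_ge0.
  - by apply/measurable_EFinP; apply: measurable_funM => //.
  under [X in (_ = _ * X)%E]eq_integral do rewrite EFinM.
  rewrite ge0_integralZl_EFin//; last first.
    by apply/measurable_EFinP.
  by rewrite H// integral_indic// setIT muleCA.
have lim1 : (\int[P]_w (phi n (f w))%:E)%E @[n --> \oo] --> (\int[P]_w (f w)%:E)%E.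
  have -> : (\int[P]_w (f w)%:E = \int[P]_w (limn (fun n => (phi n (f w))%:E)))%E.
    by apply: eq_integral => w _; apply/esym/cvg_lim => //; exact: phicvg.
  apply: cvg_monotone_convergence => //.
  - by move=> n; apply/measurable_EFinP; exact: mphi.
  - by move=> n w _; rewrite lee_fin phi0.
  - by move=> w _ n m nm; rewrite lee_fin phind.
have lim2 : (\int[P]_w (h w * phi n (f w))%:E)%E @[n --> \oo] --> (\int[P]_w (h w * f w)%:E)%E.
  have -> : (\int[P]_w (h w * f w)%:E = \int[P]_w (limn (fun n => (h w * phi n (f w))%:E)))%E.
    apply: eq_integral => w _; apply/esym/cvg_lim => //.
    under eq_fun do rewrite EFinM. rewrite EFinM.
    by apply: cvgeZl => //; exact: phicvg.
  apply: cvg_monotone_convergence => //.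
  - by move=> n; apply/measurable_EFinP; apply: measurable_funM => //; exact: mphi.
  - by move=> n w _; rewrite lee_fin mulr_ge0.
  - by move=> w _ n m nm; rewrite lee_fin ler_wpM2l// phind.
have ih0 : (0 <= \int[P]_w (h w)%:E)%E by apply: integral_ge0 => w _; rewrite lee_fin.
suff lim3 : (\int[P]_w (h w * phi n (f w))%:E)%E @[n --> \oo] -->
    (\int[P]_w (h w)%:E * \int[P]_w (f w)%:E)%E.
  exact: (cvg_unique _ lim2 lim3).
under eq_fun do rewrite step.
case: (\int[P]_w (h w)%:E)%E ih0 hoo => [r| |]// _ _.
by apply: cvgeZl.
Qed.

(** Independence is the case in which every factor is an indicator. The auxiliary statement H has
    functions at the indices in s and indicators elsewhere, and the induction turns one indicator at
    a time into a function. *)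
Lemma integral_prod_indep (I : finType) (F : I -> set (set T))
    (f : I -> T -> R) :
  mutually_independent P F ->
  (forall i, F i setT) -> (forall i A, F i A -> measurable A) ->
  (forall i w, 0 <= f i w) ->
  (forall i B, measurable B -> F i (f i @^-1` B)) ->
  (forall i, (\int[P]_w (f i w)%:E < +oo)%E) ->
  (\int[P]_w (\prod_i f i w)%:E = \prod_i \int[P]_w (f i w)%:E)%E.
Proof.
move=> ind FT Fm f0 mf foo.
have mf' i : measurable_fun setT (f i).
  by move=> _ B mB; rewrite setTI; apply: Fm; exact: mf.
suff H (s : seq I) (E : I -> set T) : uniq s -> (forall i, F i (E i)) ->
    (\int[P]_w (\prod_i (if i \in s then f i w else \1_(E i) w))%:E =
     \prod_i (if i \in s then \int[P]_w (f i w)%:E else P (E i)))%E.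
  transitivity (\int[P]_w (\prod_i (if i \in enum I then f i w else \1_setT w))%:E)%E.
    by apply: eq_integral => w _; congr EFin; apply: eq_bigr => i _; rewrite mem_enum.
  rewrite (H (enum I) (fun=> setT) (enum_uniq _) FT).
  by apply: eq_bigr => i _; rewrite mem_enum.
elim: s E => [|i0 s IH] E.
  move=> _ FE; rewrite [RHS](eq_bigr (fun i => P (E i)))//.
  have -> : (\prod_i P (E i) = \prod_(i in [set: I]%SET) P (E i))%E.
    by apply: eq_bigl => i; rewrite inE.
  rewrite -(ind [set: I]%SET E (fun i _ => FE i)).
  have -> : \bigcap_(i in [set` [set: I]%SET]) E i = \bigcap_i E i.
    by apply/seteqP; split => w h i _; apply: h => //=; rewrite inE.
  have mcap : measurable (\bigcap_i E i).
    by apply: fin_bigcap_measurable => // i _; exact: (Fm i).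
  rewrite -[X in _ = P X]setIT -integral_indic//.
  apply: eq_integral => w _; congr EFin.
  rewrite (eq_bigr (fun i => \1_(E i) w))// [RHS]indicE; case: (asboolP ((\bigcap_i E i) w)) => h.
    rewrite mem_set// big1// => i _; rewrite indicE mem_set//; exact: h.
  rewrite memNset//; move/existsNP: h => [i /not_implyP [_ nE]].
  by rewrite (bigD1 i)//= indicE memNset// mul0r.
move=> /= /andP[i0s us] FE.
pose h w := \prod_(i | i != i0) (if i \in s then f i w else \1_(E i) w).
have h0 w : 0 <= h w by apply: prodr_ge0 => i _; case: ifP.
have mh : measurable_fun setT h.
  rewrite /h; under eq_fun do rewrite -big_filter.
  apply: (@measurable_prod _ _ R setT I _ (fun i w => if i \in s then f i w else \1_(E i) w)) => i _ /=.
  by case: (i \in s) => //; by apply: measurable_indic; exact: (Fm i).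
(* The induction hypothesis holds for every family E, so the event at i0 may be any A in [F i0], in
   particular a preimage under [f i0]; this is the hypothesis of [integral_mul_indep] on h, the
   product of the other factors. *)
have key A : F i0 A -> (\int[P]_w (h w * \1_A w)%:E =
   (\prod_(i | i != i0) (if i \in s then \int[P]_w (f i w)%:E else P (E i))) * P A)%E.
  move=> FA; pose E' i := if i == i0 then A else E i.
  have FE' i : F i (E' i) by rewrite /E'; case: eqP => // ->.
  have := IH E' us FE'; rewrite (bigD1 i0)//= (negbTE i0s) {2}/E' eqxx muleC => IHE.
  transitivity ((\prod_(i | i != i0) (if i \in s then \int[P]_w (f i w)%:E else P (E' i))) * P A)%E.
    rewrite -IHE; apply: eq_integral => w _; congr EFin.
    rewrite (bigD1 i0)//= (negbTE i0s) {1}/E' eqxx mulrC.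
    by congr (_ * _); apply: eq_bigr => i /negbTE ii0; rewrite /E' ii0.
  by congr (_ * _)%E; apply: eq_bigr => i /negbTE ii0; rewrite /E' ii0.
have hE : (\int[P]_w (h w)%:E = \prod_(i | i != i0) (if i \in s then \int[P]_w (f i w)%:E else P (E i)))%E.
  have := key setT (FT i0); rewrite probability_setT mule1 => <-.
  by apply: eq_integral => w _; rewrite indicE in_setT mulr1.
have hoo : (\int[P]_w (h w)%:E < +oo)%E.
  rewrite hE.
  apply: (@proj2 (0 <= \prod_(i | i != i0) (if i \in s then \int[P]_w (f i w)%:E else P (E i))))%E.
  elim/big_ind : _ => //; first by rewrite ltry.
    move=> x y [x0 xoo] [y0 yoo]; split; first exact: mule_ge0.
    by apply: lte_mul_pinfty => //; rewrite ge0_fin_numE.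
  move=> i _; case: ifP => // _; last first.
    by split => //; rewrite (le_lt_trans (probability_le1 _ _)) ?ltry//; exact: (Fm i).
  by split => //; apply: integral_ge0 => w _; rewrite lee_fin.
under eq_integral do rewrite (bigD1 i0)//= inE eqxx/= mulrC.
rewrite [RHS](bigD1 i0)//= inE eqxx/= muleC.
transitivity (\int[P]_w (h w * f i0 w)%:E)%E.
  apply: eq_integral => w _; congr (_ * _)%:E; apply: eq_bigr => i /negbTE ii0.
  by rewrite inE ii0.
rewrite integral_mul_indep//; last by move=> B mB; rewrite key// ?hE//; exact: mf.
rewrite hE; congr (_ * _)%E; apply: eq_bigr => i /negbTE ii0.
by rewrite inE ii0.
Qed.

(** Factorization on rectangles identifies the joint law with the product of the two laws, and
    Tonelli's theorem integrates phi with psi frozen. This is how conditioning on the noise is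
    expressed. *)
Lemma integral_pair_indep {d1 d2} {S1 : measurableType d1}
    {S2 : measurableType d2} (phi : T -> S1) (psi : T -> S2)
    (f : S1 * S2 -> \bar R) :
  measurable_fun setT phi -> measurable_fun setT psi ->
  (forall A B, measurable A -> measurable B ->
    P (phi @^-1` A `&` psi @^-1` B) = (P (phi @^-1` A) * P (psi @^-1` B))%E) ->
  measurable_fun setT f -> (forall z, 0 <= f z)%E ->
  (\int[P]_w f (phi w, psi w) = \int[P]_w' \int[P]_w f (phi w, psi w'))%E.
Proof.
move=> mphi mpsi ind mf f0.
pose X : {mfun T >-> S1} := mfun_Sub (mem_set mphi).
pose Y : {mfun T >-> S2} := mfun_Sub (mem_set mpsi).
have mZ : measurable_fun setT (fun w => (phi w, psi w)) by apply/measurable_fun_pairP.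
pose Z : {mfun T >-> (S1 * S2)%type} := mfun_Sub (mem_set mZ).
transitivity (\int[distribution P Z]_z f z)%E.
  by rewrite ge0_integral_distribution.
transitivity (\int[(distribution P X \x distribution P Y)%E]_z f z)%E.
  apply: eq_measure_integral => A mA _; apply/esym.
  by apply: product_measure_unique => // B C mB mC; exact: ind.
rewrite fubini_tonelli2// /fubini_G.
rewrite ge0_integral_distribution//=; last 2 first.
- exact: measurable_fun_fubini_tonelli_G.
- by move=> y; exact: integral_ge0.
apply: eq_integral => w' _ /=.
rewrite ge0_integral_distribution//=.
by apply: measurableT_comp => //; exact: pair2_measurable.
Qed.

End indep.

Section sigma_matrix.
Context {d} {T : measurableType d} {R : realType} {m n : nat}.
Variable M : T -> 'M[R]_(m, n).

(** T with the sigma-algebra generated by the entries of M alone, so that measurability with respect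
    to [sigma_matrix M] becomes an instance of [measurable_fun]. *)
Definition sigma_matrix_type := g_sigma_algebraType
  (\bigcup_(ij in [set: 'I_m * 'I_n])
     preimage_set_system [set: T] (fun w => M w ij.1 ij.2) measurable).

Lemma sigma_matrix_preimage {d'} {S : measurableType d'}
    (g : sigma_matrix_type -> S) (B : set S) :
  measurable_fun setT g -> measurable B -> sigma_matrix M (g @^-1` B).
Proof. by move=> mg mB; have := mg measurableT B mB; rewrite setTI. Qed.

Lemma measurable_entry_sigma i j :
  measurable_fun setT (fun w : sigma_matrix_type => M w i j).
Proof.
move=> _ B mB; apply: sub_sigma_algebra; exists (i, j) => //=.
by exists B.
Qed.

Lemma sigma_matrixT : sigma_matrix M setT.
Proof. exact: (@measurableT _ sigma_matrix_type). Qed.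

Lemma sigma_matrix_measurable A :
  random_matrix M -> sigma_matrix M A -> measurable A.
Proof.
move=> mM; apply: smallest_sub; first exact: sigma_algebra_measurable.
move=> B [[i j] _ [C mC <-]]; exact: mM.
Qed.

End sigma_matrix.

Section integral_real.
Context {d} {T : measurableType d} {R : realType} (P : probability T R).
Implicit Types f g : T -> R.

Lemma ge0_integralD_EFin f g : measurable_fun setT f -> measurable_fun setT g ->
  (forall w, 0 <= f w) -> (forall w, 0 <= g w) ->
  (\int[P]_w (f w + g w)%:E = \int[P]_w (f w)%:E + \int[P]_w (g w)%:E)%E.
Proof.
move=> mf mg f0 g0; rewrite -ge0_integralD//; try exact/measurable_EFinP.
- by move=> w _; rewrite lee_fin.
- by move=> w _; rewrite lee_fin.
Qed.

Lemma ge0_integralZ_EFin k f : measurable_fun setT f -> (forall w, 0 <= f w) ->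
  0 <= k -> (\int[P]_w (k * f w)%:E = k%:E * \int[P]_w (f w)%:E)%E.
Proof.
move=> mf f0 k0; rewrite -ge0_integralZl_EFin//; last exact/measurable_EFinP.
by move=> w _; rewrite lee_fin.
Qed.

Lemma ge0_integral_sum_EFin (I : Type) (s : seq I) (f : I -> T -> R) :
  (forall i, measurable_fun setT (f i)) -> (forall i w, 0 <= f i w) ->
  (\int[P]_w (\sum_(i <- s) f i w)%:E = \sum_(i <- s) \int[P]_w (f i w)%:E)%E.
Proof.
move=> mf f0; under eq_integral do rewrite -sumEFin.
rewrite ge0_integral_sum// => i; first exact/measurable_EFinP.
by move=> w _; rewrite lee_fin.
Qed.

Lemma integral_cst_EFin (k : R) : (\int[P]_w k%:E = k%:E)%E.
Proof. by transitivity (k%:E * P setT)%E; [exact: integral_cst|rewrite probability_setT mule1]. Qed.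

Lemma ge0_markov f (c : R) : measurable_fun setT f -> (forall w, 0 <= f w) ->
  (P [set w | (c <= f w)%R] * c%:E <= \int[P]_w (f w)%:E)%E.
Proof.
move=> mf f0; have mA : measurable [set w | c <= f w].
  rewrite -[X in measurable X]setTI.
  have -> : [set w | c <= f w] = f @^-1` `[c, +oo[%classic.
    by apply/seteqP; split => w /=; rewrite in_itv/= andbT.
  exact: mf.
have [c0|c0] := leP c 0.
  apply: (@le_trans _ _ 0%E); first by rewrite mule_ge0_le0.
  by apply: integral_ge0 => w _; rewrite lee_fin.
rewrite muleC -[X in (_ * P X)%E]setIT -integral_indic//.
rewrite -ge0_integralZl_EFin//; last 2 first.
- by apply/measurable_EFinP.
- exact: ltW.
apply: ge0_le_integral_nm => w; first by rewrite mule_ge0// ltW.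
rewrite -EFinM lee_fin indicE; case: (boolP (w \in _)) => h; rewrite ?mulr1 ?mulr0//.
by rewrite inE in h.
Qed.

End integral_real.

(** * Exponential moments of squares of sub-Gaussian variables *)

Section subgaussian_variable.
Context {R : realType}.

Lemma expR_half_ge : 3 / 2 <= expR (1 / 2) :> R.
Proof. have := expR_ge1Dx (1/2 : R); lra. Qed.

Lemma expR_ge_sq2 (y : R) : 0 <= y -> y ^+ 2 / 2 <= expR y.
Proof.
move=> y0; have := expR_ge1Dxn 1 y0; rewrite !factS fact0 !muln1; lra.
Qed.

(** Because (1 + y)(1 - y + y^2) = 1 + y^3 >= 1 and 1 + y <= exp y. *)
Lemma expRN_le (y : R) : 0 <= y -> expR (- y) <= 1 - y + y ^+ 2.
Proof.
move=> y0; have h := expR_ge1Dx y.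
rewrite expRN -(@ler_pM2l _ (expR y)) ?expR_gt0// mulfV ?gt_eqF ?expR_gt0//.
set e := expR y in h *.
have q : 0 <= 1 - y + y ^+ 2 by nra.
have h1 : 0 <= (e - (1 + y)) * (1 - y + y ^+ 2) by rewrite mulr_ge0// subr_ge0.
have h2 : 0 <= y ^+ 3 by rewrite exprn_ge0.
nra.
Qed.

(* The term k = floor(|z| / 2) alone dominates the left-hand side. *)
Lemma expR_sq_le_series (z : R) :
  ((expR (z ^+ 2 / 4))%:E <= \sum_(0 <= k <oo)
    (expR 1 * (expR (k%:R * z) + expR (- k%:R * z)) * expR (- k%:R ^+ 2))%:E)%E.
Proof.
pose u (k : nat) : \bar R := (expR 1 * (expR (k%:R * z) + expR (- k%:R * z)) * expR (- k%:R ^+ 2))%:E.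
change (((expR (z ^+ 2 / 4))%:E <= \sum_(0 <= k <oo) u k)%E).
have u0 k : (0 <= u k)%E by rewrite /u lee_fin !mulr_ge0 ?addr_ge0 ?expR_ge0.
pose k := Num.truncn (`|z| / 2).
have /andP[k1 k2] : k%:R <= `|z| / 2 < k.+1%:R.
  by apply: Num.Theory.truncn_itv; rewrite divr_ge0.
apply: (@le_trans _ _ (\sum_(0 <= i < k.+1) u i)%E); last first.
  by apply: nneseries_lim_ge => // i _ _.
rewrite big_nat_recr//=; apply: (@le_trans _ _ (u k)); last first.
  by rewrite leeDr// sume_ge0.
rewrite /u lee_fin.
have h : expR (k%:R * `|z|) <= expR (k%:R * z) + expR (- k%:R * z).
  have [z0|z0] := leP 0 z.
    by rewrite ger0_norm// lerDl expR_ge0.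
  by rewrite ltr0_norm// mulrN mulNr lerDr expR_ge0.
apply: (@le_trans _ _ (expR 1 * expR (k%:R * `|z|) * expR (- k%:R ^+ 2))).
  (* The exponents compare because (|z| / 2 - k)^2 <= 1. *)
  rewrite -!expRD ler_expR -(real_normK (num_real z)).
  have k3 : `|z| / 2 < k%:R + 1 by rewrite natr1.
  set a := `|z| in k1 k3 *; set b := k%:R : R in k1 k3 *; nra.
by rewrite ler_wpM2r ?expR_ge0// ler_wpM2l ?expR_ge0.
Qed.

Lemma nneseries_geometric_le (c : R) : 0 <= c ->
  (\sum_(0 <= k <oo) (c * (2 / 3) ^+ k)%:E <= (3 * c)%:E)%E.
Proof.
move=> c0; have h0 (k : nat) : (0 <= (c * (2 / 3) ^+ k)%:E)%E.
  by rewrite lee_fin mulr_ge0// exprn_ge0//; lra.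
apply: lime_le; first by apply: is_cvg_nneseries.
apply: nearW => n; rewrite sumEFin lee_fin.
have -> : \sum_(0 <= k < n) (c * (2 / 3) ^+ k) = 3 * c * (1 - (2 / 3) ^+ n).
  elim: n => [|n IH]; first by rewrite big_nil expr0; lra.
  by rewrite big_nat_recr//= IH exprS; lra.
rewrite ler_piMr ?mulr_ge0// lerBlDl lerDr exprn_ge0//; lra.
Qed.

Context {d} {T : measurableType d} (P : probability T R).

(** The series of [expR_sq_le_series] is integrated term by term for z = Z / L: the exponential
    moments at k and -k cost exp(k^2 / 2) each against the weight exp(-k^2). What remains, 2e
    exp(-k^2 / 2) <= 2e (2/3)^k, has geometric sum 6e. *)
Lemma subgaussian_sq (Z : T -> R) (L : R) : measurable_fun setT Z -> 0 < L ->
  (forall t, \int[P]_w (expR (t * Z w))%:E <= (expR (t ^+ 2 * L ^+ 2 / 2))%:E)%E ->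
  (\int[P]_w (expR (Z w ^+ 2 / (4 * L ^+ 2)))%:E <= (6 * expR 1)%:E)%E.
Proof.
move=> mZ L0 H.
pose u (k : nat) w := expR 1 * (expR (k%:R * (Z w / L)) + expR (- k%:R * (Z w / L))) * expR (- k%:R ^+ 2).
have u0 k w : 0 <= u k w by rewrite !mulr_ge0 ?addr_ge0 ?expR_ge0.
have me (c : R) : measurable_fun setT (fun w => expR (c * (Z w / L))).
  apply: measurableT_comp => //; apply: measurable_funM => //.
  by apply: measurable_funM.
have mu k : measurable_fun setT (u k).
  by apply: measurable_funM => //; apply: measurable_funM => //; apply: measurable_funD.
apply: (@le_trans _ _ (\int[P]_w \sum_(0 <= k <oo) (u k w)%:E)%E).
  apply: ge0_le_integral_nm => w; first by rewrite lee_fin expR_ge0.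
  have -> : Z w ^+ 2 / (4 * L ^+ 2) = (Z w / L) ^+ 2 / 4 by field; rewrite gt_eqF.
  exact: expR_sq_le_series.
rewrite integral_nneseries//; last 2 first.
- by move=> k; apply/measurable_EFinP.
- by move=> k w _; rewrite lee_fin.
apply: (@le_trans _ _ (\sum_(0 <= k <oo) (2 * expR 1 * (2 / 3) ^+ k)%:E)%E); last first.
  apply: (le_trans (nneseries_geometric_le (2 * expR 1) _)); first by rewrite mulr_ge0// expR_ge0.
  by rewrite lee_fin; lra.
apply: lee_nneseries => k; first by move=> *; apply: integral_ge0 => w _; rewrite lee_fin.
move=> _; rewrite /u.
have Hc (c : R) : (\int[P]_w (expR (c * (Z w / L)))%:E <= (expR (c ^+ 2 / 2))%:E)%E.
  have := H (c / L); have -> : (c / L) ^+ 2 * L ^+ 2 / 2 = c ^+ 2 / 2 by field; rewrite gt_eqF.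
  apply: le_trans; apply: ge0_le_integral_nm => w; first by rewrite lee_fin expR_ge0.
  by rewrite lee_fin ler_expR mulrA mulrAC.
have -> : (\int[P]_w (expR 1 * (expR (k%:R * (Z w / L)) + expR (- k%:R * (Z w / L))) * expR (- k%:R ^+ 2))%:E =
  \int[P]_w (expR 1 * expR (- k%:R ^+ 2) * (expR (k%:R * (Z w / L)) + expR (- k%:R * (Z w / L))))%:E)%E.
  by apply: eq_integral => w _; rewrite mulrAC.
rewrite ge0_integralZ_EFin; [|exact: measurable_funD|by move=> w; rewrite addr_ge0 ?expR_ge0|by rewrite mulr_ge0 ?expR_ge0].
rewrite ge0_integralD_EFin//; try by move=> w; rewrite expR_ge0.
apply: (@le_trans _ _ ((expR 1 * expR (- k%:R ^+ 2))%:E * ((expR (k%:R ^+ 2 / 2))%:E + (expR (k%:R ^+ 2 / 2))%:E))%E).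
  apply: lee_wpmul2l; first by rewrite lee_fin mulr_ge0 ?expR_ge0.
  by apply: leeD; [exact: Hc | have := Hc (- k%:R); rewrite sqrrN].
rewrite -EFinD -EFinM lee_fin.
have -> : expR 1 * expR (- k%:R ^+ 2) * (expR (k%:R ^+ 2 / 2) + expR (k%:R ^+ 2 / 2))
   = 2 * expR 1 * (expR (- k%:R ^+ 2) * expR (k%:R ^+ 2 / 2)) :> R by ring.
rewrite ler_wpM2l ?mulr_ge0 ?expR_ge0// -expRD.
have -> : (2 / 3 : R) = (3 / 2)^-1 by field.
have k2 : (k%:R : R) <= k%:R ^+ 2 by rewrite -natrX ler_nat; case: (k) => // k'; lia.
apply: (@le_trans _ _ (expR (- (k%:R * (1 / 2))))); first by rewrite ler_expR; lra.
have h32 : (0 : R) < 3 / 2 by lra.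
rewrite exprVn expRN expRM_natl lef_pV2 ?posrE ?exprn_gt0 ?expR_gt0//.
by apply: lerXn2r; rewrite ?nnegrE ?expR_ge0// ?expR_half_ge// ltW.
Qed.

End subgaussian_variable.

(** * Sub-Gaussian linear forms *)

Lemma eq_ler {R : realType} (x y : R) : x = y -> x <= y.
Proof. by move->. Qed.

Lemma sqnorm2_ge0 {R : realType} {n} (v : 'cV[R]_n) : 0 <= sqnorm2 v.
Proof. by apply: sumr_ge0 => i _; exact: sqr_ge0. Qed.

Lemma sqnorm2_eq0 {R : realType} {n} (v : 'cV[R]_n) : sqnorm2 v = 0 -> v = 0.
Proof.
move=> /eqP; rewrite /sqnorm2 psumr_eq0; last by move=> i _; exact: sqr_ge0.
move=> /allP h; apply/matrixP => i j; rewrite ord1 mxE; apply/eqP.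
by rewrite -sqrf_eq0; apply: h; rewrite mem_index_enum.
Qed.

Lemma sqnorm2Z {R : realType} {n} (a : R) (v : 'cV[R]_n) :
  sqnorm2 (a *: v) = a ^+ 2 * sqnorm2 v.
Proof. by rewrite /sqnorm2 mulr_sumr; apply: eq_bigr => i _; rewrite mxE exprMn. Qed.

Lemma lee_prod_fin {R : realType} (I : Type) (s : seq I) (f : I -> \bar R) (c : I -> R) :
  (forall i, 0 <= f i)%E -> (forall i, f i <= (c i)%:E)%E ->
  (\prod_(i <- s) f i <= (\prod_(i <- s) c i)%:E)%E.
Proof.
move=> f0 fc; elim: s => [|i s IH]; first by rewrite !big_nil.
rewrite !big_cons EFinM; apply: lee_pmul => //.
by apply: prode_ge0 => j _.
Qed.

Lemma row_mulmx_entry {R : realType} {m n} (A : 'M[R]_(m, n)) (v : 'cV[R]_n) i :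
  (row i A *m v) 0 0 = (A *m v) i 0.
Proof. by rewrite -row_mul [LHS]mxE. Qed.

Section design.
Context {d : measure_display} {T : measurableType d} {R : realType}.
Variable P : probability T R.

Lemma measurable_mulmx_entry {n p : nat} (X : T -> 'M[R]_(n, p)) (v : 'cV[R]_p) i :
  random_matrix X -> measurable_fun setT (fun w => (X w *m v) i 0).
Proof.
move=> mX; under eq_fun do rewrite mxE.
by apply: measurable_sum => k; apply: measurable_funM => //; exact: mX.
Qed.

Lemma subgaussian_linear {p : nat} (Z : T -> 'rV[R]_p) (L : R) :
  sub_gaussian P L Z -> forall (v : 'cV[R]_p) t,
  (\int[P]_w (expR (t * (Z w *m v) 0 0))%:E <=
     (expR (t ^+ 2 * L ^+ 2 * sqnorm2 v / 2))%:E)%E.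
Proof.
move=> sg v t; have [v0|v0] := eqVneq (sqnorm2 v) 0.
  rewrite v0 mulr0 mul0r expR0 -[leRHS](integral_cst_EFin P).
  apply: ge0_le_integral_nm => w; first by rewrite lee_fin expR_ge0.
  by rewrite (sqnorm2_eq0 _ v0) mulmx0 mxE mulr0 expR0.
have q0 : 0 < sqnorm2 v by rewrite lt_neqAle eq_sym v0 sqnorm2_ge0.
pose r := Num.sqrt (sqnorm2 v); have r0 : 0 < r by rewrite sqrtr_gt0.
have r2 : r ^+ 2 = sqnorm2 v by rewrite sqr_sqrtr// ltW.
have := sg (t * r) (r^-1 *: v); rewrite sqnorm2Z -r2 -exprMn mulVf ?gt_eqF// expr1n.
move=> /(_ erefl); rewrite unlock => h.
have -> : t ^+ 2 * L ^+ 2 * r ^+ 2 / 2 = (t * r) ^+ 2 * L ^+ 2 / 2 by ring.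
apply: le_trans h; apply: ge0_le_integral_nm => w; first by rewrite lee_fin expR_ge0.
have -> : t * r * (Z w *m (r^-1 *: v)) 0 0 = t * (Z w *m v) 0 0.
  by rewrite -scalemxAr [X in _ * X = _]mxE; field; rewrite gt_eqF.
by [].
Qed.

Lemma second_moment_linear {p : nat} (Z : T -> 'rV[R]_p) (Sigma : 'M[R]_p)
    (v : 'cV[R]_p) :
  random_matrix Z -> has_second_moment P Z Sigma ->
  (\int[P]_w (((Z w *m v) 0 0) ^+ 2)%:E = ((v^T *m Sigma *m v) 0 0)%:E)%E.
Proof.
move=> mZ hS.
have hE j k : (\int[P]_w (Z w 0 j * Z w 0 k)%:E = (Sigma j k)%:E)%E.
  rewrite -hS unlock; apply: eq_integral => w _; congr EFin.
  by rewrite mxE big_ord1 mxE.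
have mZZ j k : measurable_fun setT (fun w => Z w 0 j * Z w 0 k).
  by apply: measurable_funM; exact: mZ.
(* Expanding a signed integrand requires integrability of every product: the finite diagonal of
   Sigma gives it for the squares, and |Z_j Z_k| <= Z_j^2 + Z_k^2 for the rest. *)
have iZ2 j : P.-integrable setT (fun w => (Z w 0 j * Z w 0 j)%:E).
  apply/integrableP; split; first exact/measurable_EFinP.
  apply: (@le_lt_trans _ _ (\int[P]_w (Z w 0 j * Z w 0 j)%:E)%E); last by rewrite hE ltry.
  by apply: ge0_le_integral_nm => w //; rewrite gee0_abs// lee_fin -expr2 sqr_ge0.
have iZ j k : P.-integrable setT (fun w => (Z w 0 j * Z w 0 k)%:E).
  apply: (le_integrable measurableT _ _ (integrableD measurableT (iZ2 j) (iZ2 k))).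
    exact/measurable_EFinP.
  move=> w _ /=; rewrite lee_fin.
  rewrite [leRHS]ger0_norm ?addr_ge0// -?expr2 ?sqr_ge0// normrM.
  rewrite -(real_normK (num_real (Z w 0 j))) -(real_normK (num_real (Z w 0 k))).
  by set a := `|Z w 0 j|; set b := `|Z w 0 k|; nra.
transitivity (\int[P]_w (\sum_j \sum_k (v j 0 * v k 0)%:E * (Z w 0 j * Z w 0 k)%:E))%E.
  apply: eq_integral => w _; rewrite mxE expr2 mulr_suml -sumEFin; apply: eq_bigr => j _.
  rewrite mulr_sumr -sumEFin; apply: eq_bigr => k _; rewrite -EFinM; congr EFin; ring.
rewrite integral_sum//; last first.
  by move=> j; apply: integrable_sum => // k _; exact: integrableZl.
rewrite -mulmxA mxE -sumEFin; apply: eq_bigr => j _.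
rewrite integral_sum//; last by move=> k; exact: integrableZl.
rewrite mxE mxE mulr_sumr -sumEFin; apply: eq_bigr => k _.
by rewrite integralZl// hE -EFinM; congr EFin; ring.
Qed.

Context {N p : nat} (X : T -> 'M[R]_(N, p)) (L : R).
Hypothesis mX : random_matrix X.
Hypothesis indX : mutually_independent P (fun i : 'I_N => sigma_matrix (fun w => row i (X w))).
Hypothesis L0 : 0 < L.
Hypothesis sgX : forall i, sub_gaussian P L (fun w => row i (X w)).

Lemma integral_prod_rows (v : 'cV[R]_p) (g : 'I_N -> R -> R) (c : 'I_N -> R) :
  (forall i, measurable_fun setT (g i)) -> (forall i x, 0 <= g i x) ->
  (forall i, (\int[P]_w (g i ((X w *m v) i 0))%:E <= (c i)%:E)%E) ->
  (\int[P]_w (\prod_i g i ((X w *m v) i 0))%:E <= (\prod_i c i)%:E)%E.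
Proof.
move=> mg g0 hc.
rewrite (integral_prod_indep _ _ _ (fun i w => g i ((X w *m v) i 0)) indX).
- apply: lee_prod_fin => // i.
  by apply: integral_ge0 => w _; rewrite lee_fin.
- by move=> i; exact: sigma_matrixT.
- move=> i A; apply: sigma_matrix_measurable => j k.
  by under eq_fun do rewrite mxE; exact: mX.
- by [].
- move=> i B mB; apply: sigma_matrix_preimage => //.
  apply: (measurableT_comp (mg i)).
  rewrite (_ : (fun w => _) = (fun w => \sum_k row i (X w) 0 k * v k 0)).
    by apply: measurable_sum => k; apply: measurable_funM => //; exact: measurable_entry_sigma.
  by apply/funext => w; rewrite mxE; apply: eq_bigr => k _; rewrite mxE.
- by move=> i; apply: le_lt_trans (hc i) _; rewrite ltry.
Qed.

Lemma subgaussian_linear_sq (i : 'I_N) (v : 'cV[R]_p) : 0 < sqnorm2 v ->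
  (\int[P]_w (expR (((X w *m v) i 0) ^+ 2 / (4 * (L ^+ 2 * sqnorm2 v))))%:E
     <= (6 * expR 1)%:E)%E.
Proof.
move=> q0; set q := sqnorm2 v in q0 *.
have -> : L ^+ 2 * q = (L * Num.sqrt q) ^+ 2 by rewrite exprMn sqr_sqrtr// ltW.
apply: subgaussian_sq; first exact: measurable_mulmx_entry.
  by rewrite mulr_gt0// sqrtr_gt0.
move=> t; rewrite exprMn (sqr_sqrtr (ltW q0)).
have -> : t ^+ 2 * (L ^+ 2 * q) / 2 = t ^+ 2 * L ^+ 2 * q / 2 by ring.
have h := subgaussian_linear _ _ (sgX i) v t.
apply: (le_trans _ h).
by apply: ge0_le_integral_nm => w; rewrite ?lee_fin ?expR_ge0// row_mulmx_entry.
Qed.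

(** Apply y^2 / 2 <= exp y to y = Z^2 / (4 L^2 q), where q = |v|_2^2: this gives Z^4 <= 32 L^4 q^2
    exp y, and 32 * 6e = 192e. *)
Lemma fourth_moment_linear (i : 'I_N) (v : 'cV[R]_p) : 0 < sqnorm2 v ->
  (\int[P]_w (((X w *m v) i 0) ^+ 4)%:E
     <= (192 * expR 1 * L ^+ 4 * sqnorm2 v ^+ 2)%:E)%E.
Proof.
move=> q0; have := subgaussian_linear_sq i v q0; set q := sqnorm2 v in q0 * => h.
pose c := 32 * L ^+ 4 * q ^+ 2.
have c0 : 0 <= c by rewrite mulr_ge0 ?sqr_ge0// mulr_ge0 ?exprn_ge0 ?(ltW L0).
have mZ := measurable_mulmx_entry X v i mX.
apply: (@le_trans _ _ (\int[P]_w (c * expR (((X w *m v) i 0) ^+ 2 / (4 * (L ^+ 2 * q))))%:E)%E).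
  apply: ge0_le_integral_nm => w; first by rewrite lee_fin (exprM _ 2 2) sqr_ge0.
  set z := (X w *m v) i 0.
  have y0 : 0 <= z ^+ 2 / (4 * (L ^+ 2 * q)).
    by apply: divr_ge0 (sqr_ge0 _) (mulr_ge0 _ (mulr_ge0 (sqr_ge0 _) (ltW q0))).
  rewrite lee_fin; have := expR_ge_sq2 _ y0; move/(ler_wpM2l c0); apply: le_trans.
  by rewrite /c; apply: eq_ler; field; rewrite !gt_eqF.
rewrite ge0_integralZ_EFin//; last first.
  apply: measurableT_comp => //; apply: measurable_funM => //.
  exact: measurable_funX.
apply: (@le_trans _ _ (c%:E * (6 * expR 1)%:E)%E); first exact: lee_wpmul2l.
by rewrite -EFinM lee_fin /c; apply: eq_ler; ring.
Qed.

(* Chernoff's bound with exp(-y) <= 1 - y + y^2, y = th * Z^2, and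
   E Z^4 <= 192 e L^4 |v|_2^4. *)
Lemma quadratic_lower_tail (Sigma : 'M[R]_p) (lamm : R) (v : 'cV[R]_p) :
  0 < lamm ->
  (forall i, has_second_moment P (fun w => row i (X w)) Sigma) ->
  loewner_le lamm%:M Sigma ->
  (P [set w | (sqnorm2 (X w *m v) < lamm / 4 * N%:R * sqnorm2 v)%R] <=
    (expR (- (lamm ^+ 2 / (1536 * expR 1 * L ^+ 4)) * N%:R))%:E)%E.
Proof.
move=> lm0 hS hl.
have := sqnorm2_ge0 v; rewrite le_eqVlt => /orP[/eqP/esym q0|q0].
  rewrite (_ : [set w | _] = set0) ?measure0 ?lee_fin ?expR_ge0//.
  by apply/seteqP; split => w //=; rewrite q0 mulr0 ltNge sqnorm2_ge0.
set q := sqnorm2 v in q0 *.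
pose m4 := 192 * expR 1 * L ^+ 4.
have m40 : 0 < m4 by rewrite !mulr_gt0 ?expR_gt0 ?exprn_gt0.
(* This choice minimizes the exponent - tau lamm + tau^2 m4, leaving - lamm^2 / (4 m4) per row. The
   threshold lamm / 4 gives back half of it, whence 1536 = 8 * 192. *)
pose tau := lamm / (2 * m4).
have tau0 : 0 < tau by rewrite divr_gt0// mulr_gt0.
pose th := tau / q; have th0 : 0 < th by rewrite divr_gt0.
pose a := expR (- tau * lamm + tau ^+ 2 * m4).
have mZ i := measurable_mulmx_entry X v i mX.
have mg : measurable_fun setT (fun x : R => expR (- (th * x ^+ 2))).
  apply: measurableT_comp => //; apply: measurable_funN => //.
  by apply: measurable_funM => //; exact: measurable_funX.
have one i : (\int[P]_w (expR (- (th * ((X w *m v) i 0) ^+ 2)))%:E <= a%:E)%E.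
  have mZ2 : measurable_fun setT (fun w => th * ((X w *m v) i 0) ^+ 2).
    by apply: measurable_funM => //; exact: measurable_funX.
  have mZ4 : measurable_fun setT (fun w => th ^+ 2 * ((X w *m v) i 0) ^+ 4).
    by apply: measurable_funM => //; exact: measurable_funX.
  have Z20 w : 0 <= th * ((X w *m v) i 0) ^+ 2 by rewrite mulr_ge0 ?sqr_ge0// ltW.
  have Z40 w : 0 <= th ^+ 2 * ((X w *m v) i 0) ^+ 4.
    by rewrite mulr_ge0 ?sqr_ge0// (exprM _ 2 2) sqr_ge0.
  have E2 : (\int[P]_w (th * ((X w *m v) i 0) ^+ 2)%:E =
       (th * (v^T *m Sigma *m v) 0 0)%:E)%E.
    rewrite ge0_integralZ_EFin//; last 3 first.
    - exact: measurable_funX.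
    - by move=> w; exact: sqr_ge0.
    - exact: ltW.
    have mr : random_matrix (fun w => row i (X w)).
      by move=> j k; under eq_fun do rewrite mxE; exact: mX.
    rewrite [RHS]EFinM -(second_moment_linear _ _ v mr (hS i)).
    by congr (_ * _)%E; apply: eq_integral => w _; rewrite row_mulmx_entry.
  have lo : lamm * q <= (v^T *m Sigma *m v) 0 0.
    have := hl v; rewrite mulmxBr mulmxBl mxE [X in _ + X]mxE subr_ge0.
    rewrite mul_mx_scalar -scalemxAl mxE; congr (lamm * _ <= _).
    by rewrite mxE; apply: eq_bigr => j _; rewrite mxE expr2.
  have E4 := fourth_moment_linear i v q0.
  have me : measurable_fun setT (fun w => expR (- (th * ((X w *m v) i 0) ^+ 2))).
    exact: (measurableT_comp mg (mZ i)).
  have : (\int[P]_w (expR (- (th * ((X w *m v) i 0) ^+ 2)))%:E + (th * (lamm * q))%:E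
     <= (1 + tau ^+ 2 * m4)%:E)%E.
    apply: (@le_trans _ _ (\int[P]_w (expR (- (th * ((X w *m v) i 0) ^+ 2)))%:E +
        \int[P]_w (th * ((X w *m v) i 0) ^+ 2)%:E)%E).
      by rewrite leeD2l// E2 lee_fin ler_wpM2l// ltW.
    rewrite -ge0_integralD_EFin//.
    apply: (@le_trans _ _ (\int[P]_w (1 + th ^+ 2 * ((X w *m v) i 0) ^+ 4)%:E)%E).
      apply: ge0_le_integral_nm => w; first by rewrite lee_fin addr_ge0 ?expR_ge0.
      rewrite lee_fin; have := expRN_le _ (Z20 w).
      by set x := expR _; rewrite exprMn -exprM => ?; lra.
    rewrite (ge0_integralD_EFin P (cst 1))// (integral_cst_EFin P 1) EFinD leeD2l//.
    rewrite ge0_integralZ_EFin ?sqr_ge0//; last 2 first.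
    - exact: measurable_funX.
    - by move=> w; rewrite (exprM _ 2 2) sqr_ge0.
    apply: (@le_trans _ _ ((th ^+ 2)%:E * (192 * expR 1 * L ^+ 4 * q ^+ 2)%:E)%E).
      by apply: lee_wpmul2l => //; rewrite lee_fin sqr_ge0.
    by rewrite -EFinM lee_fin /th /m4; apply: eq_ler; field; rewrite gt_eqF.
  have -> : th * (lamm * q) = tau * lamm by rewrite /th; field; rewrite gt_eqF.
  rewrite -leeBrDr// -EFinB => /le_trans; apply; rewrite lee_fin.
  have := expR_ge1Dx (- tau * lamm + tau ^+ 2 * m4); rewrite -/a; lra.
have all := integral_prod_rows v (fun _ x => expR (- (th * x ^+ 2))) (fun=> a)
  (fun=> mg) (fun _ x => expR_ge0 _) one.
have prodE w : \prod_i expR (- (th * ((X w *m v) i 0) ^+ 2)) = expR (- (th * sqnorm2 (X w *m v))).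
  by rewrite /sqnorm2 mulr_sumr -sumrN expR_sum.
have {}all : (\int[P]_w (expR (- (th * sqnorm2 (X w *m v))))%:E <= (a ^+ N)%:E)%E.
  rewrite -[N in a ^+ N](card_ord N) -prodr_const; apply: le_trans all.
  by apply: ge0_le_integral_nm => w; rewrite lee_fin ?expR_ge0// prodE.
have msq : measurable_fun setT (fun w => expR (- (th * sqnorm2 (X w *m v)))).
  under eq_fun do rewrite -prodE.
  by apply: measurable_prod => i _; exact: (measurableT_comp mg (mZ i)).
pose b := expR (- (th * (lamm / 4 * N%:R * q))).
have := ge0_markov P _ b msq (fun w => expR_ge0 _).
move=> /le_trans => /(_ _ all) mk.
have sub : [set w | (sqnorm2 (X w *m v) < lamm / 4 * N%:R * q)%R] `<=`
    [set w | b <= expR (- (th * sqnorm2 (X w *m v)))].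
  by move=> w /= /ltW h; rewrite ler_expR lerN2 ler_wpM2l// ltW.
have msq0 : measurable_fun setT (fun w => sqnorm2 (X w *m v)).
  by apply: measurable_sum => i; exact: measurable_funX.
have mA : measurable [set w | b <= expR (- (th * sqnorm2 (X w *m v)))].
  rewrite -[X in measurable X]setTI.
  have -> : [set w | b <= expR (- (th * sqnorm2 (X w *m v)))] =
     (fun w => expR (- (th * sqnorm2 (X w *m v)))) @^-1` `[b, +oo[%classic.
    by apply/seteqP; split => w /=; rewrite in_itv/= andbT.
  exact: msq.
have mB : measurable [set w | (sqnorm2 (X w *m v) < lamm / 4 * N%:R * q)%R].
  rewrite -[X in measurable X]setTI.
  have -> : [set w | (sqnorm2 (X w *m v) < lamm / 4 * N%:R * q)%R] =
     (fun w => sqnorm2 (X w *m v)) @^-1` `]-oo, (lamm / 4 * N%:R * q)[%classic.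
    by apply/seteqP; split => w /=; rewrite in_itv/=.
  exact: msq0.
apply: le_trans (le_measure P _ _ sub) _; rewrite ?inE//.
have b0 : 0 < b by exact: expR_gt0.
rewrite -(@lee_pmul2r _ b%:E)// ?lte_fin//; apply: le_trans mk _.
rewrite -EFinM lee_fin /a /b -expRM_natl -expRD ler_expR.
have -> : th * (lamm / 4 * N%:R * q) = tau * lamm / 4 * N%:R by rewrite /th; field; rewrite gt_eqF.
have e1 : 0 < expR 1 :> R by exact: expR_gt0.
by rewrite /tau /m4; apply: eq_ler; field; rewrite !gt_eqF.
Qed.

(** Chernoff's bound at the exponent 1 / (4 L^2): the threshold corresponds to exp(6N), while the
    moment (6e)^N is at most exp(5N) because 6 <= 4^2 / 2 <= exp 4. *)
Lemma quadratic_upper_tail (v : 'cV[R]_p) : sqnorm2 v = 1 ->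
  (P [set w | (24 * L ^+ 2 * N%:R < sqnorm2 (X w *m v))%R] <= (expR (- N%:R))%:E)%E.
Proof.
move=> v1.
pose g (x : R) := expR (x ^+ 2 / (4 * (L ^+ 2 * 1))).
have mg : measurable_fun setT g.
  by apply: measurableT_comp => //; apply: measurable_funM => //; exact: measurable_funX.
have q1 : 0 < sqnorm2 v by rewrite v1.
have one i := subgaussian_linear_sq i v q1.
rewrite v1 in one.
have all := integral_prod_rows v (fun=> g) (fun=> 6 * expR 1) (fun=> mg) (fun _ x => expR_ge0 _) one.
have prodE w : \prod_i g ((X w *m v) i 0) = expR (sqnorm2 (X w *m v) / (4 * (L ^+ 2 * 1))).
  by rewrite /sqnorm2 mulr_suml expR_sum.
have {}all : (\int[P]_w (expR (sqnorm2 (X w *m v) / (4 * (L ^+ 2 * 1))))%:E <= ((6 * expR 1) ^+ N)%:E)%E.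
  rewrite -[N in (6 * expR 1) ^+ N](card_ord N) -prodr_const; apply: le_trans all.
  by apply: ge0_le_integral_nm => w; rewrite lee_fin ?expR_ge0// prodE.
have msq0 : measurable_fun setT (fun w => sqnorm2 (X w *m v)).
  by apply: measurable_sum => i; apply: measurable_funX; exact: measurable_mulmx_entry.
have msq : measurable_fun setT (fun w => expR (sqnorm2 (X w *m v) / (4 * (L ^+ 2 * 1)))).
  by apply: measurableT_comp => //; apply: measurable_funM.
pose b := expR (6 * N%:R) : R.
have := ge0_markov P _ b msq (fun w => expR_ge0 _).
move=> /le_trans => /(_ _ all) mk.
have sub : [set w | (24 * L ^+ 2 * N%:R < sqnorm2 (X w *m v))%R] `<=`
    [set w | b <= expR (sqnorm2 (X w *m v) / (4 * (L ^+ 2 * 1)))].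
  move=> w /= /ltW h; rewrite ler_expR ler_pdivlMr ?mulr_gt0 ?exprn_gt0//.
  by apply: le_trans h; apply: eq_ler; ring.
have mA : measurable [set w | b <= expR (sqnorm2 (X w *m v) / (4 * (L ^+ 2 * 1)))].
  rewrite -[X in measurable X]setTI.
  have -> : [set w | b <= expR (sqnorm2 (X w *m v) / (4 * (L ^+ 2 * 1)))] =
     (fun w => expR (sqnorm2 (X w *m v) / (4 * (L ^+ 2 * 1)))) @^-1` `[b, +oo[%classic.
    by apply/seteqP; split => w /=; rewrite in_itv/= andbT.
  exact: msq.
have mB : measurable [set w | (24 * L ^+ 2 * N%:R < sqnorm2 (X w *m v))%R].
  rewrite -[X in measurable X]setTI.
  have -> : [set w | (24 * L ^+ 2 * N%:R < sqnorm2 (X w *m v))%R] =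
     (fun w => sqnorm2 (X w *m v)) @^-1` `](24 * L ^+ 2 * N%:R), +oo[%classic.
    by apply/seteqP; split => w /=; rewrite in_itv/= andbT.
  exact: msq0.
apply: le_trans (le_measure P _ _ sub) _; rewrite ?inE//.
have b0 : 0 < b by exact: expR_gt0.
rewrite -(@lee_pmul2r _ b%:E)// ?lte_fin//; apply: le_trans mk _.
rewrite -EFinM lee_fin /b -expRD.
have -> : - N%:R + 6 * N%:R = N%:R * (4 + 1) :> R by ring.
rewrite expRM_natl lerXn2r ?nnegrE ?mulr_ge0 ?expR_ge0// expRD ler_wpM2r ?expR_ge0//.
have h4 : (0 : R) <= 4 by [].
have := expR_ge_sq2 _ h4; lra.
Qed.

End design.

(** * The design quadratic form *)

Lemma sqnorm20 {R : realType} {n} : sqnorm2 (0 : 'cV[R]_n) = 0.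
Proof. by rewrite /sqnorm2 big1// => i _; rewrite mxE expr0n. Qed.

Section l1norm.
Context {R : realType} {p : nat}.
Implicit Types v u : 'cV[R]_p.

Definition l1norm v : R := \sum_j `|v j 0|.

Lemma l1norm_ge0 v : 0 <= l1norm v.
Proof. exact: sumr_ge0. Qed.

Lemma le_l1norm v j : `|v j 0| <= l1norm v.
Proof. by rewrite /l1norm (bigD1 j)//= lerDl sumr_ge0. Qed.

Lemma l1norm_eq0 v : l1norm v = 0 -> v = 0.
Proof.
move=> h; apply/matrixP => i j; rewrite ord1 mxE; apply/eqP; rewrite -normr_le0.
by rewrite -h le_l1norm.
Qed.

Lemma sqnorm2_le_sup_l1 v (a : R) : (forall j, `|v j 0| <= a) ->
  sqnorm2 v <= a * l1norm v.
Proof.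
move=> h; rewrite /sqnorm2 /l1norm mulr_sumr; apply: ler_sum => j _.
by rewrite -real_normK ?num_real// expr2 ler_wpM2r.
Qed.

Lemma sqnorm2_le_l1norm_sq v : sqnorm2 v <= l1norm v ^+ 2.
Proof. by rewrite expr2; apply: sqnorm2_le_sup_l1; exact: le_l1norm. Qed.

Lemma ler_l1normD v u : l1norm (v + u) <= l1norm v + l1norm u.
Proof.
by rewrite /l1norm -big_split; apply: ler_sum => j _; rewrite mxE ler_normD.
Qed.

Lemma l1normN v : l1norm (- v) = l1norm v.
Proof. by apply: eq_bigr => j _; rewrite mxE normrN. Qed.

Lemma l1normZ (a : R) v : l1norm (a *: v) = `|a| * l1norm v.
Proof. by rewrite /l1norm mulr_sumr; apply: eq_bigr => j _; rewrite mxE normrM. Qed.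

End l1norm.

(** * Maurey's empirical method *)

Section maurey.
Context {R : realType}.

(* Bias-variance: averaging [sqnorm2 (z + y_j)] over the weights [q] only sees
   the mean [v] of the [y_j], up to the variance of the [y_j]. *)
Lemma sqnorm2_average {n} (I : finType) (q : I -> R) (y : I -> 'cV[R]_n)
    (z : 'cV[R]_n) : \sum_j q j = 1 ->
  \sum_j q j * sqnorm2 (z + y j) - \sum_j q j * sqnorm2 (y j) =
  sqnorm2 (z + \sum_j q j *: y j) - sqnorm2 (\sum_j q j *: y j).
Proof.
move=> q1; rewrite /sqnorm2 -!sumrB.
transitivity (\sum_j \sum_i q j * (z i 0 ^+ 2 + 2 * z i 0 * y j i 0)).
  apply: eq_bigr => j _; rewrite -mulrBr -sumrB mulr_sumr; apply: eq_bigr => i _.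
  by rewrite mxE; congr (_ * _); ring.
rewrite exchange_big /=; apply: eq_bigr => i _.
rewrite [in RHS]mxE.
have -> : (\sum_j q j *: y j) i 0 = \sum_j q j * y j i 0.
  by rewrite summxE; apply: eq_bigr => j _; rewrite mxE.
set s := \sum_j q j * y j i 0.
transitivity ((\sum_j q j) * z i 0 ^+ 2 + 2 * z i 0 * s).
  rewrite mulr_suml /s mulr_sumr -big_split; apply: eq_bigr => j _ /=; ring.
rewrite q1; ring.
Qed.

Lemma exists_le_average (I : finType) (q f : I -> R) (c : R) :
  (forall j, 0 <= q j) -> \sum_j q j = 1 -> \sum_j q j * f j = c ->
  exists j, f j <= c.
Proof.
move=> q0 q1 qf; apply: contrapT => /forallNP h.
have fc j : 0 < f j - c by rewrite subr_gt0 ltNge; apply/negP/h.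
have s0 : \sum_j q j * (f j - c) = 0.
  under eq_bigr do rewrite mulrBr.
  by rewrite sumrB -mulr_suml q1 qf mul1r subrr.
have/allP hq : all (fun j => true ==> (q j * (f j - c) == 0)) (index_enum I).
  by rewrite -psumr_eq0 ?s0// => j _; rewrite mulr_ge0// ltW.
have : \sum_j q j = 0.
  apply: big1 => j _; have := hq j (mem_index_enum _).
  by rewrite /= mulf_eq0 (gt_eqF (fc j)) orbF => /eqP.
by rewrite q1 => /eqP; rewrite oner_eq0.
Qed.

Context {N p : nat}.

Definition signed_basis (k : 'I_p * bool) : 'cV[R]_p :=
  (-1) ^+ k.2 *: delta_mx k.1 0.

Lemma sqnorm2_delta (j : 'I_p) : sqnorm2 (delta_mx j 0 : 'cV[R]_p) = 1.
Proof.
rewrite /sqnorm2 (bigD1 j)//= big1 ?addr0; last first.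
  by move=> i /negbTE ij; rewrite mxE ij /= expr0n.
by rewrite mxE !eqxx expr1n.
Qed.

Lemma sqnorm2_signed_basis k : sqnorm2 (signed_basis k) = 1.
Proof. by rewrite sqnorm2Z sqnorm2_delta -exprM mulnC exprM sqrrN !expr1n mulr1. Qed.

(** With r = |v|_1, v is the mean of a random vector taking the value r times a signed basis vector.
    For the form B u = |A u|_2^2 - c |u|_2^2, the sum of m independent copies has mean value m^2 B v
    + m tau of B, where tau is the variance of one copy under B. Since B >= 0 on all such sums, B v
    >= - tau / m, and tau <= r^2 M. *)
Lemma maurey (A : 'M[R]_(N, p)) (c M : R) (m : nat) (v : 'cV[R]_p) :
  (0 < m)%N -> 0 <= c ->
  (forall J : seq ('I_p * bool), size J = m ->
    c * sqnorm2 (\sum_(k <- J) signed_basis k) <=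
      sqnorm2 (A *m \sum_(k <- J) signed_basis k)) ->
  (forall k, sqnorm2 (A *m signed_basis k) <= M) ->
  c * sqnorm2 v <= sqnorm2 (A *m v) + l1norm v ^+ 2 * (M / m%:R).
Proof.
move=> m0 c0 hJ hM; have := l1norm_ge0 v; rewrite le_eqVlt => /orP[/eqP/esym r0|r0].
  by rewrite r0 (l1norm_eq0 _ r0) mulmx0 !sqnorm20 expr0n mul0r mulr0 addr0.
set r := l1norm v in r0 *.
pose q j := `|v j 0| / r.
pose e j := signed_basis (j, v j 0 < 0).
pose y j := r *: e j.
have q0 j : 0 <= q j by rewrite divr_ge0// ltW.
have q1 : \sum_j q j = 1 by rewrite -mulr_suml mulfV// gt_eqF.
have vE : \sum_j q j *: y j = v.
  apply/matrixP => i k; rewrite ord1 summxE (bigD1 i)//= big1 => [|j ji]; last first.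
    by rewrite !mxE eq_sym (negbTE ji) /= !mulr0.
  rewrite !mxE !eqxx /= mulr1 addr0 /q.
  have [vi|vi] := ltP (v i 0) 0; rewrite ?expr1 ?expr0.
    by rewrite ltr0_norm//; field; rewrite gt_eqF.
  by rewrite ger0_norm//; field; rewrite gt_eqF.
pose B u := sqnorm2 (A *m u) - c * sqnorm2 u.
pose tau := \sum_j q j * B (y j) - B v.
(* B is quadratic, so the excess over B at the mean does not depend on the base point z. It may be
   negative, since B need not be positive semidefinite. *)
have avg z : \sum_j q j * B (z + y j) = B (z + v) + tau.
  have h1 := sqnorm2_average _ q y z q1.
  have h2 := sqnorm2_average _ q (fun j => A *m y j) (A *m z) q1.
  have e1 : \sum_j q j *: (A *m y j) = A *m v.
    by rewrite -vE mulmx_sumr; apply: eq_bigr => j _; rewrite scalemxAr.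
  rewrite e1 -mulmxDr in h2; rewrite vE in h1.
  have BE (z' : 'cV[R]_p) : \sum_j q j * B (z' + y j) =
      \sum_j q j * sqnorm2 (A *m z' + A *m y j) - c * \sum_j q j * sqnorm2 (z' + y j).
    by rewrite mulr_sumr -sumrB; apply: eq_bigr => j _; rewrite /B mulmxDr; ring.
  have BE0 : \sum_j q j * B (y j) =
      \sum_j q j * sqnorm2 (A *m y j) - c * \sum_j q j * sqnorm2 (y j).
    by rewrite mulr_sumr -sumrB; apply: eq_bigr => j _; rewrite /B; ring.
  move/eqP: h1; rewrite subr_eq => /eqP h1; move/eqP: h2; rewrite subr_eq => /eqP h2.
  by rewrite /tau BE BE0 h1 h2 /B; ring.
(* Maurey's random walk, derandomized: some choice of the next step does not
   exceed the average. *)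
have walk k z : exists J : seq ('I_p * bool), size J = k /\
    B (z + r *: \sum_(i <- J) signed_basis i) <= B (z + k%:R *: v) + k%:R * tau.
  elim: k z => [|k IH] z.
    by exists [::]; split => //; rewrite big_nil scaler0 scale0r mul0r !addr0.
  have [j hj] := exists_le_average _ q (fun j => B (z + k%:R *: v + y j)) _ q0 q1 (avg (z + k%:R *: v)).
  have [J [sJ hJ']] := IH (z + y j).
  exists ((j, v j 0 < 0) :: J); split; first by rewrite /= sJ.
  rewrite big_cons scalerDr addrA; apply: le_trans hJ' _.
  have -> : z + y j + k%:R *: v = z + k%:R *: v + y j by rewrite addrAC.
  have -> : z + k.+1%:R *: v = z + k%:R *: v + v by rewrite -natr1 scalerDl scale1r addrA.
  by rewrite -natr1 mulrDl mul1r; move: hj; lra.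
have [J [sJ]] := walk m 0; rewrite !add0r.
have m0' : (0 : R) < m%:R by rewrite ltr0n.
have -> : B (r *: \sum_(i <- J) signed_basis i) = r ^+ 2 * B (\sum_(i <- J) signed_basis i).
  by rewrite /B -scalemxAr !sqnorm2Z; ring.
have -> : B (m%:R *: v) = m%:R ^+ 2 * B v by rewrite /B -scalemxAr !sqnorm2Z; ring.
have BJ : 0 <= r ^+ 2 * B (\sum_(i <- J) signed_basis i).
  by rewrite mulr_ge0 ?sqr_ge0// subr_ge0 hJ.
move=> /(le_trans BJ) h.
(* The mean of B over one step is at most r^2 M - c r^2, and - B v <= c |v|_2^2 <= c r^2, so the
   terms in c cancel. *)
have tauM : tau <= r ^+ 2 * M.
  have : \sum_j q j * B (y j) <= r ^+ 2 * M - c * r ^+ 2.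
    have -> : r ^+ 2 * M - c * r ^+ 2 = \sum_j q j * (r ^+ 2 * M - c * r ^+ 2).
      by rewrite -mulr_suml q1 mul1r.
    apply: ler_sum => j _; apply: ler_wpM2l => //.
    rewrite /B /y /e -scalemxAr [sqnorm2 (r *: (A *m _))]sqnorm2Z [sqnorm2 (r *: signed_basis _)]sqnorm2Z.
    rewrite sqnorm2_signed_basis mulr1 lerD2r.
    by rewrite ler_wpM2l ?sqr_ge0.
  have := sqnorm2_le_l1norm_sq v; rewrite -/r => /(ler_wpM2l c0).
  have BvE : B v = sqnorm2 (A *m v) - c * sqnorm2 v by [].
  have := sqnorm2_ge0 (A *m v); rewrite /tau BvE; lra.
have h2 : 0 <= m%:R * B v + tau.
  by rewrite -(pmulr_rge0 _ m0') mulrDr mulrA -expr2.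
have h3 : 0 <= B v + tau / m%:R.
  by rewrite -(pmulr_rge0 _ m0') mulrDr (mulrC m%:R (_ / _)) divfK ?gt_eqF.
have h4 : tau / m%:R <= r ^+ 2 * (M / m%:R).
  by rewrite mulrA ler_pM2r// invr_gt0.
by move: h3; rewrite /B; lra.
Qed.

End maurey.

Lemma measure_bigcup_fin_le {d} {T : measurableType d} {R : realType}
    (P : probability T R) (I : finType) (A : I -> set T) (c : R) :
  (forall i, measurable (A i)) -> (forall i, P (A i) <= c%:E)%E ->
  (P (\bigcup_i A i) <= (#|I|%:R * c)%:E)%E.
Proof.
move=> mA hA; have mU : measurable (\bigcup_i A i).
  by apply: fin_bigcup_measurable.
rewrite -[X in P X]setIT -integral_indic//.
apply: (@le_trans _ _ (\int[P]_w (\sum_(i <- index_enum I) \1_(A i) w)%:E)%E).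
  apply: ge0_le_integral_nm => w; rewrite lee_fin//.
  rewrite indicE; case: (boolP (w \in _)) => [|_]; last by apply: sumr_ge0 => j _; rewrite indicE.
  rewrite inE => -[i _ Ai]; rewrite (bigD1_seq i) ?mem_index_enum ?index_enum_uniq//=.
  by rewrite indicE mem_set// lerDl; apply: sumr_ge0 => j _; rewrite indicE.
rewrite ge0_integral_sum_EFin//; last by move=> i; exact: measurable_indic.
apply: (@le_trans _ _ (\sum_(i <- index_enum I) c%:E)%E).
  by apply: lee_sum => i _; rewrite integral_indic// setIT; exact: hA.
by rewrite sumEFin lee_fin sumr_const mulr_natl.
Qed.

(** * Uniform lower bound for the design quadratic form *)

Section quadratic.
Context {d : measure_display} {T : measurableType d} {R : realType}.
Variable P : probability T R.
Context {N p : nat} (X : T -> 'M[R]_(N, p)) (L lamm : R) (Sigma : 'M[R]_p).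
Hypothesis mX : random_matrix X.
Hypothesis indX : mutually_independent P (fun i : 'I_N => sigma_matrix (fun w => row i (X w))).
Hypothesis L0 : 0 < L.
Hypothesis sgX : forall i, sub_gaussian P L (fun w => row i (X w)).
Hypothesis lm0 : 0 < lamm.
Hypothesis hS : forall i, has_second_moment P (fun w => row i (X w)) Sigma.
Hypothesis hl : loewner_le lamm%:M Sigma.
Hypothesis N0 : (0 < N)%N.
Hypothesis p0 : (0 < p)%N.

Lemma quadratic_form_lower (kap : R) :
  0 < kap -> kap <= 1 -> kap <= lamm ^+ 2 / (1536 * expR 1 * L ^+ 4) ->
  exists Omega : set T, [/\ measurable Omega,
    (P (~` Omega) <= (16 / (kap ^+ 2 * N%:R ^+ 2))%:E)%E &
    forall w, Omega w -> forall v,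
      lamm / 4 * sqnorm2 v <= sqnorm2 (X w *m v) / N%:R +
        (96 * L ^+ 2 + lamm) / kap * (l1norm v ^+ 2 * (1 + ln p%:R) / N%:R)].
Proof.
move=> k0 k1 kle; have N0' : (0 : R) < N%:R by rewrite ltr0n.
have p0' : (0 : R) < p%:R by rewrite ltr0n.
set Lam := 1 + ln p%:R.
have Lam1 : 1 <= Lam by rewrite lerDl ln_ge0// ler1n.
have Lam0 : 0 < Lam by exact: lt_le_trans Lam1.
(* If N is small, the l1 term alone dominates. *)
have [big|small] := leP (2 * Lam) (kap * N%:R); last first.
  exists setT; split => //; first by rewrite setCT measure0 lee_fin divr_ge0// mulr_ge0// sqr_ge0.
  move=> w _ v; have S1 := sqnorm2_le_l1norm_sq v; have S0 := sqnorm2_ge0 v.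
  have A0 := sqnorm2_ge0 (X w *m v).
  apply: (@le_trans _ _ (lamm * (l1norm v ^+ 2 * Lam / (kap * N%:R)))).
    rewrite -mulrA ler_wpM2l ?(ltW lm0)//.
    rewrite ler_pdivlMr ?mulr_gt0//.
    apply: (@le_trans _ _ (4^-1 * sqnorm2 v * (2 * Lam))).
      by rewrite ler_wpM2l ?mulr_ge0// ltW.
    have h := ler_wpM2r (ltW Lam0) S1.
    have h0 : 0 <= sqnorm2 v * Lam by rewrite mulr_ge0// ltW.
    lra.
  have -> : (96 * L ^+ 2 + lamm) / kap * (l1norm v ^+ 2 * Lam / N%:R) =
     96 * L ^+ 2 * (l1norm v ^+ 2 * Lam / (kap * N%:R)) + lamm * (l1norm v ^+ 2 * Lam / (kap * N%:R)).
    by field; rewrite !gt_eqF.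
  have Q0 : 0 <= l1norm v ^+ 2 * Lam / (kap * N%:R).
    exact: divr_ge0 (mulr_ge0 (sqr_ge0 _) (ltW Lam0)) (mulr_ge0 (ltW k0) (ltW N0')).
  rewrite addrA lerDr; apply: addr_ge0; first exact: divr_ge0 A0 (ltW N0').
  by apply: mulr_ge0 => //; apply: mulr_ge0 => //; exact: sqr_ge0.
(* The length m of the sums is the integer part of x: the (2p)^m <= exp(m Lam) <= exp(kap N / 2)
   sums then use up only half of the exponent kap N of each tail bound. *)
pose x := kap * N%:R / (2 * Lam).
have x1 : 1 <= x by rewrite ler_pdivlMr ?mul1r// mulr_gt0.
pose m := Num.truncn x.
have /andP[mx xm] : m%:R <= x < m.+1%:R by apply: Num.Theory.truncn_itv; lra.
have m0 : (0 < m)%N by rewrite /m Num.Theory.truncn_ge_nat//; lra.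
have m1 : (1 : R) <= m%:R by rewrite ler1n.
have x2m : x <= 2 * m%:R by rewrite -natr1 in xm; lra.
pose u (J : m.-tuple ('I_p * bool)) : 'cV[R]_p := \sum_(k <- J) signed_basis k.
pose A1 J := [set w | sqnorm2 (X w *m u J) < lamm / 4 * N%:R * sqnorm2 (u J)].
pose A2 (k : 'I_p * bool) := [set w | 24 * L ^+ 2 * N%:R < sqnorm2 (X w *m signed_basis k)].
have msq v : measurable_fun setT (fun w => sqnorm2 (X w *m v)).
  by apply: measurable_sum => i; apply: measurable_funX; exact: measurable_mulmx_entry.
have mA1 J : measurable (A1 J).
  rewrite -[X in measurable X]setTI.
  have -> : A1 J = (fun w => sqnorm2 (X w *m u J)) @^-1` `]-oo, (lamm / 4 * N%:R * sqnorm2 (u J))[%classic.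
    by apply/seteqP; split => w /=; rewrite in_itv/=.
  exact: msq.
have mA2 k : measurable (A2 k).
  rewrite -[X in measurable X]setTI.
  have -> : A2 k = (fun w => sqnorm2 (X w *m signed_basis k)) @^-1` `](24 * L ^+ 2 * N%:R), +oo[%classic.
    by apply/seteqP; split => w /=; rewrite in_itv/= andbT.
  exact: msq.
have mU1 : measurable (\bigcup_J A1 J) by exact: fin_bigcup_measurable.
have mU2 : measurable (\bigcup_k A2 k) by exact: fin_bigcup_measurable.
exists (~` (\bigcup_J A1 J `|` \bigcup_k A2 k)); split.
- by apply: measurableC; exact: measurableU.
- rewrite setCK; apply: le_trans (measureU2 _ mU1 mU2) _.
  have pexp : p%:R = expR (Lam - 1) by rewrite /Lam addrC addKr lnK// posrE.
  have two_e : 2 <= expR 1 :> R by have := expR_ge1Dx (1 : R); lra.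
  have p2 : (#|{: 'I_p * bool}|%:R : R) <= expR Lam.
    have -> : expR Lam = expR (Lam - 1) * expR 1 by rewrite -expRD subrK.
    rewrite card_prod card_ord card_bool natrM pexp.
    by rewrite ler_wpM2l ?expR_ge0.
  have b1 : (P (\bigcup_J A1 J) <= (expR (- (kap * N%:R / 2)))%:E)%E.
    apply: le_trans (measure_bigcup_fin_le P _ _ (expR (- kap * N%:R)) mA1 _) _.
      move=> J; apply: le_trans (quadratic_lower_tail P X L mX indX L0 sgX Sigma lamm (u J) lm0 hS hl) _.
      by rewrite lee_fin ler_expR ler_wpM2r// lerN2.
    rewrite lee_fin card_tuple natrX.
    apply: (@le_trans _ _ (expR Lam ^+ m * expR (- kap * N%:R))).
      by rewrite ler_wpM2r ?expR_ge0// lerXn2r ?nnegrE ?expR_ge0.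
    rewrite -expRM_natl -expRD ler_expR.
    have : m%:R * Lam <= kap * N%:R / 2.
      have := ler_wpM2r (ltW Lam0) mx; rewrite /x.
      by have -> : kap * N%:R / (2 * Lam) * Lam = kap * N%:R / 2 by field; rewrite gt_eqF.
    lra.
  have b2 : (P (\bigcup_k A2 k) <= (expR (- (kap * N%:R / 2)))%:E)%E.
    apply: le_trans (measure_bigcup_fin_le P _ _ (expR (- N%:R)) mA2 _) _.
      by move=> k; apply: (quadratic_upper_tail P X L) => //; exact: sqnorm2_signed_basis.
    rewrite lee_fin; apply: le_trans (ler_wpM2r _ p2) _; first exact: expR_ge0.
    rewrite -expRD ler_expR.
    have : kap * N%:R <= N%:R by rewrite ler_piMl// ltW.
    lra.
  apply: le_trans (leeD b1 b2) _; rewrite -EFinD lee_fin.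
  (* The exponential bound is weakened to a rate 1 / N^2 by y^2 / 2 <= exp y; the two events
     contribute 8 / (kap N)^2 each. *)
  have y1 : 0 < kap * N%:R / 2 by rewrite divr_gt0// mulr_gt0.
  have y0 := ltW y1.
  have := expR_ge_sq2 _ y0 => h.
  have : expR (- (kap * N%:R / 2)) <= ((kap * N%:R / 2) ^+ 2 / 2)^-1.
    by rewrite expRN lef_pV2// posrE ?expR_gt0// divr_gt0 ?exprn_gt0.
  have -> : ((kap * N%:R / 2) ^+ 2 / 2)^-1 = (16 / (kap ^+ 2 * N%:R ^+ 2)) / 2.
    by field; rewrite !gt_eqF.
  lra.
move=> w; rewrite setCU => -[h1 h2] v.
have key := maurey (X w) (lamm / 4 * N%:R) (24 * L ^+ 2 * N%:R) m v m0 _ _ _.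
have {}key : lamm / 4 * N%:R * sqnorm2 v <= sqnorm2 (X w *m v) + l1norm v ^+ 2 * (24 * L ^+ 2 * N%:R / m%:R).
  apply: key.
  - by rewrite mulr_ge0 ?divr_ge0 ?(ltW lm0).
  - move=> J sJ; rewrite leNgt; apply/negP => bad; apply: h1.
    have sJ' : size J == m by rewrite sJ.
    by exists (Tuple sJ').
  - by move=> k; rewrite leNgt; apply/negP => bad; apply: h2; exists k.
rewrite -(ler_pM2r N0').
have -> : lamm / 4 * sqnorm2 v * N%:R = lamm / 4 * N%:R * sqnorm2 v by ring.
apply: le_trans key _.
rewrite [leRHS]mulrDl divfK ?gt_eqF// lerD2l.
have -> : (96 * L ^+ 2 + lamm) / kap * (l1norm v ^+ 2 * Lam / N%:R) * N%:R =
   l1norm v ^+ 2 * ((96 * L ^+ 2 + lamm) * Lam / kap) by field; rewrite !gt_eqF.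
rewrite ler_wpM2l ?sqr_ge0// ler_pdivrMr ?ltr0n//.
apply: (@le_trans _ _ (96 * L ^+ 2 * Lam / kap * m%:R)); last first.
  rewrite ler_wpM2r// ler_wpM2r ?invr_ge0 ?(ltW k0)// ler_wpM2r ?(ltW Lam0)//.
  by rewrite lerDl ltW.
(* Rounding costs a factor 2, as x <= 2m. Together with the upper bound 24 L^2 N on basis vectors
   this gives 96 L^2; the summand lamm of the constant serves the case of small N. *)
have : N%:R <= 4 * Lam / kap * m%:R.
  have -> : N%:R = 2 * Lam / kap * x by rewrite /x; field; rewrite !gt_eqF.
  have -> : 4 * Lam / kap * m%:R = 2 * Lam / kap * (2 * m%:R) by ring.
  by apply: ler_wpM2l => //; apply: divr_ge0 (ltW k0); exact: mulr_ge0 (ltW Lam0).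
have L20 : 0 <= 24 * L ^+ 2 by rewrite mulr_ge0 ?sqr_ge0.
move=> /(ler_wpM2l L20) /le_trans; apply; apply: eq_ler; ring.
Qed.

End quadratic.

(** * The multiplier process *)

Lemma measurable_sqrt {R : realType} : measurable_fun [set: R] (@Num.sqrt R).
Proof. by apply: continuous_measurable_fun; exact: sqrt_continuous. Qed.

(** Inversion is extended by 0^-1 = 0 and is not continuous there; on nonnegative reals it agrees
    with the power of exponent -1, which is measurable. *)
Lemma measurable_inv_sqrt {R : realType} :
  measurable_fun [set: R] (fun x : R => (Num.sqrt x)^-1).
Proof.
have -> : (fun x : R => (Num.sqrt x)^-1) = (fun x => powR (Num.sqrt x) (-1)).
  by apply/funext => x; rewrite powR_inv1// sqrtr_ge0.
by apply: (@measurableT_comp _ _ _ _ _ _ (fun x => powR x (-1))); [exact: measurable_powR|exact: measurable_sqrt].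
Qed.

Section multiplier.
Context {d : measure_display} {T : measurableType d} {R : realType}.
Variable P : probability T R.
Context {N p : nat} (X : T -> 'M[R]_(N, p)) (xi : T -> 'cV[R]_N) (L sg : R).
Hypothesis mX : random_matrix X.
Hypothesis mxi : random_matrix xi.
Hypothesis indX : mutually_independent P (fun i : 'I_N => sigma_matrix (fun w => row i (X w))).
Hypothesis indxi : mutually_independent P (fun i : 'I_N => sigma_matrix (fun w => row i (xi w))).
Hypothesis indXxi : independent_systems P (sigma_matrix X) (sigma_matrix xi).
Hypothesis L0 : 0 < L.
Hypothesis sgX : forall i, sub_gaussian P L (fun w => row i (X w)).
Hypothesis sg0 : 0 < sg.
Hypothesis psi2 : forall i, (\int[P]_w (expR (xi w i 0 ^+ 2 / sg ^+ 2))%:E <= (expR 1)%:E)%E.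
Hypothesis N0 : (0 < N)%N.
Hypothesis p0 : (0 < p)%N.

Let N0' : (0 : R) < N%:R. Proof. by rewrite ltr0n. Qed.

Let msq : measurable_fun setT (fun w => sqnorm2 (xi w)).
Proof. by apply: measurable_sum => i; apply: measurable_funX; exact: mxi. Qed.

Lemma noise_exp : (\int[P]_w (expR (sqnorm2 (xi w) / sg ^+ 2))%:E <= (expR N%:R)%:E)%E.
Proof.
pose g (x : R) := expR (x ^+ 2 / sg ^+ 2).
have mg : measurable_fun setT g.
  by apply: measurableT_comp => //; apply: measurable_funM => //; exact: measurable_funX.
(* The noise is a random matrix with a single column, so the product formula for rows applies with
   the 1 x 1 identity as the vector. *)
have e w i : (xi w *m 1%:M) i 0 = xi w i 0 by rewrite mulmx1.
have one i : (\int[P]_w (g ((xi w *m 1%:M) i 0))%:E <= (expR 1)%:E)%E.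
  by under eq_integral do rewrite e; exact: psi2.
have := integral_prod_rows P xi mxi indxi 1%:M (fun=> g) (fun=> expR 1) (fun=> mg) (fun _ x => expR_ge0 _) one.
rewrite prodr_const card_ord -expRM_natl mulr1; apply: le_trans.
apply: ge0_le_integral_nm => w; rewrite lee_fin ?expR_ge0//.
rewrite /sqnorm2 mulr_suml expR_sum; apply: eq_ler; apply: eq_bigr => i _.
by rewrite e.
Qed.

Lemma noise_sq : (\int[P]_w (sqnorm2 (xi w) / sg ^+ 2)%:E <= (expR 1 * N%:R)%:E)%E.
Proof.
have -> : (\int[P]_w (sqnorm2 (xi w) / sg ^+ 2)%:E =
    \int[P]_w (\sum_i xi w i 0 ^+ 2 / sg ^+ 2)%:E)%E.
  by apply: eq_integral => w _; rewrite /sqnorm2 mulr_suml.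
rewrite ge0_integral_sum_EFin; last 2 first.
- by move=> i; apply: measurable_funM => //; apply: measurable_funX; exact: mxi.
- by move=> i w; rewrite divr_ge0 ?sqr_ge0.
apply: (@le_trans _ _ (\sum_(i <- index_enum 'I_N) (expR 1)%:E)%E).
  apply: lee_sum => i _; apply: le_trans (psi2 i).
  apply: ge0_le_integral_nm => w; rewrite lee_fin ?divr_ge0 ?sqr_ge0//.
  by have := expR_ge1Dx (xi w i 0 ^+ 2 / sg ^+ 2); lra.
by rewrite sumEFin lee_fin sumr_const card_ord mulr_natr.
Qed.

(** The inequality V <= 1 + V^2 for V = |xi|_2 / (sg sqrt N) takes the place of Jensen's inequality,
    at the price of a constant. *)
Lemma noise_norm : (\int[P]_w (Num.sqrt (sqnorm2 (xi w)))%:E <=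
  (sg * Num.sqrt N%:R * (1 + expR 1))%:E)%E.
Proof.
have r0 : 0 < Num.sqrt N%:R :> R by rewrite sqrtr_gt0.
apply: (@le_trans _ _ (\int[P]_w ((sg * Num.sqrt N%:R) * (1 + N%:R^-1 * (sqnorm2 (xi w) / sg ^+ 2)))%:E)%E).
  apply: ge0_le_integral_nm => w; rewrite lee_fin ?sqrtr_ge0//.
  set y := Num.sqrt (sqnorm2 (xi w)).
  have -> : sqnorm2 (xi w) = y ^+ 2 by rewrite sqr_sqrtr// sqnorm2_ge0.
  have -> : N%:R^-1 = (Num.sqrt N%:R ^+ 2)^-1 :> R by rewrite sqr_sqrtr// ltW.
  set r := Num.sqrt N%:R in r0 *.
  pose V := y / (sg * r).
  have -> : y = sg * r * V by rewrite /V; field; rewrite !gt_eqF.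
  rewrite ler_wpM2l ?mulr_ge0 ?(ltW sg0) ?(ltW r0)//.
  have -> : (r ^+ 2)^-1 * ((sg * r * V) ^+ 2 / sg ^+ 2) = V ^+ 2 by field; rewrite !gt_eqF.
  nra.
have mU : measurable_fun setT (fun w => N%:R^-1 * (sqnorm2 (xi w) / sg ^+ 2)).
  by apply: measurable_funM => //; apply: measurable_funM.
have U0 w : 0 <= sqnorm2 (xi w) / sg ^+ 2 by rewrite divr_ge0 ?sqnorm2_ge0 ?sqr_ge0.
have mU' : measurable_fun setT (fun w => sqnorm2 (xi w) / sg ^+ 2).
  exact: measurable_funM.
rewrite ge0_integralZ_EFin; last 3 first.
- exact: measurable_funD.
- by move=> w; rewrite addr_ge0// mulr_ge0 ?invr_ge0.
- by rewrite mulr_ge0 ?(ltW sg0) ?(ltW r0).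
rewrite (ge0_integralD_EFin P (cst 1))//; last first.
  by move=> w; rewrite mulr_ge0 ?invr_ge0.
rewrite (integral_cst_EFin P 1) ge0_integralZ_EFin// ?invr_ge0//.
rewrite [leRHS]EFinM; apply: lee_wpmul2l.
  by rewrite lee_fin mulr_ge0 ?(ltW sg0) ?(ltW r0).
rewrite EFinD leeD2l//.
apply: (@le_trans _ _ ((N%:R^-1)%:E * (expR 1 * N%:R)%:E)%E).
  by apply: lee_wpmul2l; rewrite ?lee_fin ?invr_ge0//; exact: noise_sq.
by rewrite -EFinM lee_fin; apply: eq_ler; field; rewrite gt_eqF.
Qed.

Lemma column_combination_exp (j : 'I_p) (y : 'I_N -> R) (t : R) :
  (\int[P]_w (expR (t * \sum_i X w i j * y i))%:E <=
    (expR (t ^+ 2 * L ^+ 2 * (\sum_i y i ^+ 2) / 2))%:E)%E.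
Proof.
pose v : 'cV[R]_p := delta_mx j 0.
have e w i : (X w *m v) i 0 = X w i j by rewrite /v -colE mxE.
pose g i (x : R) := expR (t * y i * x).
have mg i : measurable_fun setT (g i).
  by apply: measurableT_comp => //; apply: measurable_funM.
have one i : (\int[P]_w (g i ((X w *m v) i 0))%:E <= (expR ((t * y i) ^+ 2 * L ^+ 2 / 2))%:E)%E.
  have h := subgaussian_linear P _ L (sgX i) v (t * y i).
  rewrite sqnorm2_delta mulr1 in h; apply: le_trans h.
  by apply: ge0_le_integral_nm => w; rewrite /g ?lee_fin ?expR_ge0// row_mulmx_entry.
have := integral_prod_rows P X mX indX v g _ mg (fun _ x => expR_ge0 _) one.
rewrite -expR_sum.
have -> : \sum_i (t * y i) ^+ 2 * L ^+ 2 / 2 = t ^+ 2 * L ^+ 2 * (\sum_i y i ^+ 2) / 2.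
  by rewrite mulr_sumr mulr_suml; apply: eq_bigr => i _; ring.
apply: le_trans; apply: ge0_le_integral_nm => w; rewrite lee_fin ?expR_ge0//.
rewrite mulr_sumr expR_sum; apply: eq_ler; apply: eq_bigr => i _.
by rewrite e /g; congr expR; ring.
Qed.

Lemma column_combination_exp_abs (j : 'I_p) (y : 'I_N -> R) (t : R) : 0 <= t ->
  (\int[P]_w (expR (t * `|\sum_i X w i j * y i|))%:E <=
    (2 * expR (t ^+ 2 * L ^+ 2 * (\sum_i y i ^+ 2) / 2))%:E)%E.
Proof.
move=> t0; have mS : measurable_fun setT (fun w => \sum_i X w i j * y i).
  by apply: measurable_sum => i; apply: measurable_funM => //; exact: mX.
have me (s : R) : measurable_fun setT (fun w => expR (s * \sum_i X w i j * y i)).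
  by apply: measurableT_comp => //; apply: measurable_funM.
apply: (@le_trans _ _ (\int[P]_w (expR (t * \sum_i X w i j * y i) + expR (- t * \sum_i X w i j * y i))%:E)%E).
  apply: ge0_le_integral_nm => w; rewrite lee_fin ?expR_ge0//.
  set z := \sum_i _; have [z0|z0] := leP 0 z.
    by rewrite ger0_norm// lerDl expR_ge0.
  by rewrite ltr0_norm// mulrN mulNr lerDr expR_ge0.
rewrite ge0_integralD_EFin// mulr2n mulrDl mul1r EFinD; apply: leeD.
  exact: column_combination_exp.
by rewrite -[t in leRHS]opprK sqrrN; exact: column_combination_exp.
Qed.

(** Given xi, the j-th entry of X^T xi divided by |xi|_2 is sub-Gaussian with a parameter free of
    xi, so its exponential moment can be pulled out. The factor |xi|_2 in front undoes the
    normalization when the excess of that entry is estimated. *)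
Lemma noise_norm_exp (j : 'I_p) (a : R) : 0 <= a ->
  (\int[P]_w (Num.sqrt (sqnorm2 (xi w)) * expR (a * (Num.sqrt (sqnorm2 (xi w)))^-1 *
      `|\sum_i X w i j * xi w i 0|))%:E <=
    (2 * expR (a ^+ 2 * L ^+ 2 / 2))%:E * \int[P]_w (Num.sqrt (sqnorm2 (xi w)))%:E)%E.
Proof.
move=> a0.
pose S := (N.-tuple R)%type.
pose phi (w : T) : S := [tuple X w i j | i < N].
pose psi (w : T) : S := [tuple xi w i 0 | i < N].
pose nm (y : S) : R := \sum_i tnth y i ^+ 2.
pose f (z : S * S) : \bar R := (Num.sqrt (nm z.2) * expR (a * (Num.sqrt (nm z.2))^-1 *
      `|\sum_i tnth z.1 i * tnth z.2 i|))%:E.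
have mt i : measurable_fun setT (fun y : S => tnth y i) by exact: measurable_tnth.
have mnm : measurable_fun setT nm by apply: measurable_sum => i; exact: measurable_funX.
have mf : measurable_fun setT f.
  have m2 : measurable_fun setT (fun z : S * S => nm z.2).
    exact: (measurableT_comp mnm measurable_snd).
  have m2s : measurable_fun setT (fun z : S * S => Num.sqrt (nm z.2)).
    by apply: measurableT_comp m2; exact: measurable_sqrt.
  have m2i : measurable_fun setT (fun z : S * S => (Num.sqrt (nm z.2))^-1).
    by apply: (measurableT_comp measurable_inv_sqrt m2).
  have ms : measurable_fun setT (fun z : S * S => `|\sum_i tnth z.1 i * tnth z.2 i|).
    apply: measurableT_comp => //; apply: measurable_sum => i.
    apply: measurable_funM; first exact: (measurableT_comp (mt i) measurable_fst).
    exact: (measurableT_comp (mt i) measurable_snd).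
  apply/measurable_EFinP; apply: measurable_funM => //.
  apply: measurableT_comp => //; apply: measurable_funM => //.
  exact: measurable_funM.
have f0 z : (0 <= f z)%E by rewrite lee_fin mulr_ge0 ?sqrtr_ge0 ?expR_ge0.
have mphi' : measurable_fun setT (phi : sigma_matrix_type X -> S).
  apply/measurable_fun_tnthP => i; rewrite (_ : _ \o _ = (fun w : sigma_matrix_type X => X w i j)).
    exact: measurable_entry_sigma.
  by apply/funext => w /=; rewrite tnth_mktuple.
have mpsi' : measurable_fun setT (psi : sigma_matrix_type xi -> S).
  apply/measurable_fun_tnthP => i; rewrite (_ : _ \o _ = (fun w : sigma_matrix_type xi => xi w i 0)).
    exact: measurable_entry_sigma.
  by apply/funext => w /=; rewrite tnth_mktuple.
have mphi : measurable_fun setT phi.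
  by move=> _ B mB; rewrite setTI; apply: (sigma_matrix_measurable X) => //; exact: sigma_matrix_preimage.
have mpsi : measurable_fun setT psi.
  by move=> _ B mB; rewrite setTI; apply: (sigma_matrix_measurable xi) => //; exact: sigma_matrix_preimage.
have nmE w : nm (psi w) = sqnorm2 (xi w).
  by apply: eq_bigr => i _; rewrite tnth_mktuple.
have phiE w y : \sum_i tnth (phi w) i * tnth y i = \sum_i X w i j * tnth y i.
  by apply: eq_bigr => i _; rewrite tnth_mktuple.
have fE w : f (phi w, psi w) = (Num.sqrt (sqnorm2 (xi w)) * expR (a * (Num.sqrt (sqnorm2 (xi w)))^-1 *
      `|\sum_i X w i j * xi w i 0|))%:E.
  rewrite /f /= nmE phiE; congr (_ * expR (_ * `|_|))%:E.
  by apply: eq_bigr => i _; rewrite tnth_mktuple.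
under eq_integral do rewrite -fE.
rewrite (integral_pair_indep P phi psi f mphi mpsi _ mf f0); last first.
  by move=> A B mA mB; apply: indXxi; exact: sigma_matrix_preimage.
have mnx : measurable_fun setT (fun w => Num.sqrt (sqnorm2 (xi w))).
  by apply: measurableT_comp => //; exact: measurable_sqrt.
rewrite -ge0_integralZ_EFin//.
apply: ge0_le_integral_nm => w'; first by exact: integral_ge0.
rewrite /f /= nmE; set y := Num.sqrt (sqnorm2 (xi w')).
have y0 : 0 <= y by exact: sqrtr_ge0.
rewrite ge0_integralZ_EFin//; last first.
  apply: measurableT_comp => //; apply: measurable_funM => //.
  apply: measurableT_comp => //; apply: measurable_sum => i.
  by apply: measurable_funM => //; exact: (measurableT_comp (mt i) mphi).
rewrite [in leRHS]mulrC [leRHS]EFinM; apply: lee_wpmul2l; first by rewrite lee_fin.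
have t0 : 0 <= a * y^-1 by rewrite mulr_ge0 ?invr_ge0.
have := column_combination_exp_abs j (fun i => xi w' i 0) _ t0.
have -> : (\int[P]_w (expR (a * y^-1 * `|\sum_i X w i j * xi w' i 0|))%:E =
   \int[P]_w (expR (a * y^-1 * `|\sum_i tnth (phi w) i * tnth (psi w') i|))%:E)%E.
  apply: eq_integral => w _; congr (expR (_ * `|_|))%:E; rewrite phiE.
  by apply: eq_bigr => i _; rewrite tnth_mktuple.
move=> /le_trans; apply; rewrite lee_fin ler_wpM2l// ler_expR.
have -> : \sum_i xi w' i 0 ^+ 2 = y ^+ 2 by rewrite sqr_sqrtr// sqnorm2_ge0.
(* For vanishing noise the convention 0^-1 = 0 makes the left-hand exponent 0. *)
have [->|yn0] := eqVneq y 0.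
  by rewrite [0 ^+ 2]expr0n /= mulr0 mul0r; apply: divr_ge0 => //; apply: mulr_ge0; exact: sqr_ge0.
by apply: eq_ler; field.
Qed.

(** Delta collects two excesses. The part of (X^T xi)_j above 4 L q |xi|_2, with q = sqrt(1 + ln p),
    is paid by the bound on the entries of v. The rest is at most 4 L |xi|_2 q |v|_1: the l1 bound
    by b is used as long as |xi|_2 is moderate relative to l, and the crude one by s b1 otherwise.
    Neither excess depends on v, b, s or l, so a single Delta serves all sparsity levels, including
    a random one. *)
Lemma multiplier_bound (CA b1 : R) : 0 <= CA -> 0 <= b1 ->
  exists Delta : T -> R, [/\ measurable_fun setT Delta,
    (forall w, 0 <= Delta w),
    (\int[P]_w (Delta w)%:E <=
      ((10 + 2 * expR 1) * CA * L * (sg * (b1 / Num.sqrt N%:R)))%:E)%E &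
    forall w (v : 'cV[R]_p) (b s l : R), 0 <= b -> 0 <= l -> s <= expR l ->
      Num.sqrt (1 + ln p%:R) * l1norm v <= CA * b ->
      Num.sqrt (1 + ln p%:R) * l1norm v <= CA * (s * b1) ->
      (forall j, Num.sqrt (1 + ln p%:R) * `|v j 0| <= CA * b1) ->
      2 / N%:R * `|\sum_i xi w i 0 * (X w *m v) i 0| <=
        16 * CA * L * (sg * (b / Num.sqrt N%:R * (1 + Num.sqrt (l / N%:R)))) + Delta w].
Proof.
move=> CA0 b10; set Lam := 1 + ln p%:R; set q := Num.sqrt Lam; set r := Num.sqrt N%:R.
have Lam1 : 1 <= Lam by rewrite lerDl ln_ge0// ler1n.
have Lam0 : 0 < Lam by exact: lt_le_trans Lam1.
have q0 : 0 < q by rewrite sqrtr_gt0.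
have q2 : q ^+ 2 = Lam by rewrite sqr_sqrtr// ltW.
have q1 : 1 <= q by rewrite -(@ler_pXn2r _ 2)// ?nnegrE ?expr1n ?q2// ltW.
have r0 : 0 < r by rewrite sqrtr_gt0.
have r2 : r ^+ 2 = N%:R by rewrite sqr_sqrtr// ltW.
pose y w := Num.sqrt (sqnorm2 (xi w)).
have y0 w : 0 <= y w by exact: sqrtr_ge0.
pose Z j w := \sum_i X w i j * xi w i 0.
(* Then a^2 L^2 / 2 = 2 Lam. Against the factor exp(- 4 Lam) of E this leaves exp(- 2 Lam), enough
   for the sum over p = exp(Lam - 1) coordinates. *)
pose a := 2 * q / L.
have a0 : 0 <= a by rewrite divr_ge0 ?mulr_ge0 ?(ltW q0) ?(ltW L0).
(* [E j w] bounds the part of |Z_j| / (L q) above [4 * y w]; the inverse is 0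
   when y w = 0, in which case Z_j = 0. *)
pose E j w := expR (- (4 * Lam)) * (y w * expR (a * (y w)^-1 * `|Z j w|)).
have E0 j w : 0 <= E j w by rewrite !mulr_ge0 ?expR_ge0.
pose D1 := 8 * CA * L * (sg * (b1 / r)).
pose D2 := 2 * CA * L * b1 / N%:R.
have D10 : 0 <= D1.
  apply: mulr_ge0; first by rewrite !mulr_ge0// ltW.
  by apply: mulr_ge0 (ltW sg0) (divr_ge0 b10 (ltW r0)).
have D20 : 0 <= D2.
  by apply: divr_ge0 (ltW N0'); rewrite !mulr_ge0// ltW.
pose e1 w := expR (sqnorm2 (xi w) / sg ^+ 2).
pose e2 w := expR (- N%:R) * e1 w.
have my : measurable_fun setT y.
  by apply: (measurableT_comp measurable_sqrt msq).
have me1 : measurable_fun setT e1.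
  by apply: measurableT_comp => //; apply: measurable_funM.
have me2 : measurable_fun setT e2 by exact: measurable_funM.
have mZ j : measurable_fun setT (Z j).
  by apply: measurable_sum => i; apply: measurable_funM; [exact: mX|exact: mxi].
have mE' j : measurable_fun setT (fun w => y w * expR (a * (y w)^-1 * `|Z j w|)).
  apply: measurable_funM => //; apply: measurableT_comp => //; apply: measurable_funM.
    by apply: measurable_funM => //; exact: (measurableT_comp measurable_inv_sqrt msq).
  exact: measurableT_comp.
have mE j : measurable_fun setT (E j) by exact: measurable_funM.
have mSE : measurable_fun setT (fun w => \sum_j E j w) by exact: measurable_sum.
exists (fun w => D1 * e2 w + D2 * \sum_j E j w); split.
- by apply: measurable_funD; apply: measurable_funM.
- by move=> w; apply: addr_ge0; apply: mulr_ge0; rewrite ?sumr_ge0// mulr_ge0 ?expR_ge0.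
- have SE0 w : 0 <= \sum_j E j w by exact: sumr_ge0.
  have e20 w : 0 <= e2 w by rewrite mulr_ge0 ?expR_ge0.
  rewrite ge0_integralD_EFin//; [|exact: measurable_funM|exact: measurable_funM|by move=> w; exact: mulr_ge0|by move=> w; exact: mulr_ge0].
  rewrite (ge0_integralZ_EFin P D1 e2)// (ge0_integralZ_EFin P D2 (fun w => \sum_j E j w))//.
  have h1 : (\int[P]_w (e2 w)%:E <= 1%:E)%E.
    rewrite ge0_integralZ_EFin ?expR_ge0//; last by move=> w; exact: expR_ge0.
    apply: (@le_trans _ _ ((expR (- N%:R))%:E * (expR N%:R)%:E)%E).
      by apply: lee_wpmul2l; [rewrite lee_fin expR_ge0|exact: noise_exp].
    by rewrite -EFinM lee_fin mulrC expRxMexpNx_1.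
  have h2 : (\int[P]_w (\sum_j E j w)%:E <= (sg * r * (1 + expR 1))%:E)%E.
    rewrite (ge0_integral_sum_EFin P _ _ E)//.
    pose K := 2 * expR (- (2 * Lam)) * (sg * r * (1 + expR 1)).
    apply: (@le_trans _ _ (\sum_(j <- index_enum 'I_p) K%:E)%E).
      apply: lee_sum => j _; rewrite ge0_integralZ_EFin ?expR_ge0//; last first.
        by move=> w; rewrite mulr_ge0 ?expR_ge0.
      apply: (@le_trans _ _ ((expR (- (4 * Lam)))%:E * ((2 * expR (a ^+ 2 * L ^+ 2 / 2))%:E * (sg * r * (1 + expR 1))%:E))%E).
        apply: lee_wpmul2l; first by rewrite lee_fin expR_ge0.
        apply: le_trans (noise_norm_exp j a a0) _.
        apply: lee_wpmul2l; first by rewrite lee_fin mulr_ge0 ?expR_ge0.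
        exact: noise_norm.
      rewrite -!EFinM lee_fin /K.
      have -> : a ^+ 2 * L ^+ 2 / 2 = 2 * Lam by rewrite -q2 /a; field; rewrite gt_eqF.
      have -> : - (2 * Lam) = - (4 * Lam) + 2 * Lam by ring.
      by rewrite expRD; apply: eq_ler; ring.
    rewrite sumEFin lee_fin sumr_const card_ord -mulr_natl /K (mulrA p%:R) ler_piMl//.
      by rewrite !mulr_ge0 ?addr_ge0 ?expR_ge0 ?(ltW sg0) ?(ltW r0).
    have pexp : p%:R = expR (Lam - 1) by rewrite /Lam addrC addKr lnK// posrE ltr0n.
    rewrite pexp mulrCA -expRD.
    apply: (@le_trans _ _ (2 * expR (- 1))).
      by rewrite ler_wpM2l// ler_expR; move: Lam0; lra.
    have two_e : 2 <= expR 1 :> R by have := expR_ge1Dx (1 : R); lra.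
    by rewrite expRN ler_pdivrMr ?expR_gt0// mul1r.
  apply: (@le_trans _ _ (D1%:E * 1%:E + D2%:E * (sg * r * (1 + expR 1))%:E)%E).
    by apply: leeD; apply: lee_wpmul2l; rewrite ?lee_fin.
  (* D1 contributes 8 and D2 contributes 2 (1 + e), which add up to 10 + 2e. *)
  rewrite -!EFinM -EFinD lee_fin /D1 /D2 -r2.
  by apply: eq_ler; field; rewrite gt_eqF.
move=> w v b s l b0 l0 sl hb hs hj.
set n1 := l1norm v in hb hs *.
have n10 : 0 <= n1 by exact: l1norm_ge0.
have -> : \sum_i xi w i 0 * (X w *m v) i 0 = \sum_j Z j w * v j 0.
  rewrite /Z; under eq_bigr do rewrite mxE mulr_sumr.
  rewrite exchange_big; apply: eq_bigr => j _; rewrite mulr_suml.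
  by apply: eq_bigr => i _; ring.
have Zle j : `|Z j w| <= L * q * (4 * y w + E j w).
  have [yz|yn0] := eqVneq (y w) 0.
    have xi0 : xi w = 0.
      apply: sqnorm2_eq0; apply/eqP; rewrite eq_le sqnorm2_ge0 andbT.
      by rewrite -sqrtr_eq0; exact/eqP.
    rewrite /Z big1; last by move=> i _; rewrite xi0 mxE mulr0.
    by rewrite normr0 !mulr_ge0 ?addr_ge0 ?mulr_ge0 ?(ltW L0) ?(ltW q0).
  have yp : 0 < y w by rewrite lt_neqAle eq_sym yn0 y0.
  pose G := `|Z j w| / (L * q * y w).
  have G0 : 0 <= G by rewrite divr_ge0 ?mulr_ge0 ?(ltW L0) ?(ltW q0).
  have ZG : `|Z j w| = L * q * y w * G by rewrite /G; field; rewrite !gt_eqF.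
  have EG : E j w = y w * expR (2 * Lam * G - 4 * Lam).
    rewrite /E mulrCA -expRD ZG -q2 /a; congr (_ * expR _); field.
    by rewrite !gt_eqF.
  suff h : G <= 4 + expR (2 * Lam * G - 4 * Lam).
    rewrite ZG EG.
    have := ler_wpM2l (mulr_ge0 (mulr_ge0 (ltW L0) (ltW q0)) (y0 w)) h.
    by move=> /le_trans; apply; apply: eq_ler; ring.
  have [G4|G4] := leP G 4.
    by apply: le_trans G4 _; rewrite lerDl expR_ge0.
  have := expR_ge1Dx (2 * Lam * G - 4 * Lam).
  have : Lam * G <= 2 * Lam * G - 4 * Lam by nra.
  have : G <= Lam * G by rewrite ler_peMl.
  lra.
have SZ : `|\sum_j Z j w * v j 0| <= 4 * L * y w * (q * n1) + L * (CA * b1) * \sum_j E j w.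
  apply: le_trans (ler_norm_sum _ _ _) _.
  apply: (@le_trans _ _ (\sum_j (4 * L * y w * (q * `|v j 0|) + L * (CA * b1) * E j w))).
    apply: ler_sum => j _; rewrite normrM.
    apply: le_trans (ler_wpM2r (normr_ge0 _) (Zle j)) _.
    have -> : L * q * (4 * y w + E j w) * `|v j 0| =
       4 * L * y w * (q * `|v j 0|) + L * E j w * (q * `|v j 0|) by ring.
    rewrite lerD2l [leRHS]mulrAC; apply: ler_wpM2l (hj j).
    by rewrite mulr_ge0// ltW.
  by rewrite big_split /= -!mulr_sumr.
have S2 := ler_wpM2l (divr_ge0 (ler0n _ 2) (ltW N0')) SZ.
apply: le_trans S2 _; rewrite mulrDr addrA; apply: lerD; last first.
  by apply: eq_ler; rewrite /D2; field; rewrite gt_eqF.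
pose V := y w / (r * sg).
have V0 : 0 <= V by rewrite divr_ge0 ?mulr_ge0 ?(ltW r0) ?(ltW sg0).
have yV : y w = r * sg * V by rewrite /V; field; rewrite !gt_eqF.
have -> : 2 / N%:R * (4 * L * y w * (q * n1)) = 8 * L * (sg / r) * (V * (q * n1)).
  by rewrite -r2 yV; field; rewrite gt_eqF.
have c0 : 0 <= 8 * L * (sg / r).
  by apply: mulr_ge0; [rewrite mulr_ge0// ltW|exact: divr_ge0 (ltW sg0) (ltW r0)].
set u := Num.sqrt (l / N%:R).
have u0 : 0 <= u by exact: sqrtr_ge0.
(* V is |xi|_2 in units of its typical size sg sqrt N. In the second case l <= N V^2 / 4, so s <=
   exp l is dominated by an exponential of |xi|_2^2. *)
have [small|big] := leP V (2 * (1 + u)).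
  apply: (@le_trans _ _ (8 * L * (sg / r) * (2 * (1 + u) * (CA * b)))).
    apply: ler_wpM2l => //; apply: ler_pM => //; exact: mulr_ge0 (ltW q0) n10.
  rewrite -[leLHS]addr0; apply: lerD; last by rewrite mulr_ge0// mulr_ge0 ?expR_ge0.
  by apply: eq_ler; field; rewrite gt_eqF.
have V2 : 2 <= V by lra.
have lV : l <= N%:R * V ^+ 2 / 4.
  have uV : u <= V / 2 by lra.
  have : u ^+ 2 <= (V / 2) ^+ 2 by rewrite ler_pXn2r ?nnegrE// divr_ge0.
  rewrite sqr_sqrtr ?divr_ge0// ler_pdivrMr// => /le_trans; apply.
  by apply: eq_ler; field.
apply: (@le_trans _ _ (8 * L * (sg / r) * (V * (CA * (expR (N%:R * V ^+ 2 / 4) * b1))))).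
  apply: ler_wpM2l => //; apply: ler_wpM2l => //; apply: le_trans hs _.
  apply: ler_wpM2l => //; apply: ler_wpM2r => //; apply: le_trans sl _.
  by rewrite ler_expR.
rewrite -[leLHS]add0r; apply: lerD.
  apply: mulr_ge0; first by rewrite !mulr_ge0// ltW.
  apply: mulr_ge0 (ltW sg0) _; apply: mulr_ge0; first exact: divr_ge0 b0 (ltW r0).
  by rewrite addr_ge0.
have e2E : e2 w = expR (N%:R * V ^+ 2 - N%:R).
  rewrite /e2 /e1 -expRD; congr expR.
  have -> : sqnorm2 (xi w) = y w ^+ 2 by rewrite sqr_sqrtr// sqnorm2_ge0.
  by rewrite yV -r2; field; rewrite gt_eqF.
have -> : 8 * L * (sg / r) * (V * (CA * (expR (N%:R * V ^+ 2 / 4) * b1))) =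
  D1 * (V * expR (N%:R * V ^+ 2 / 4)) by rewrite /D1; field; rewrite gt_eqF.
apply: ler_wpM2l => //; rewrite e2E.
apply: (@le_trans _ _ (expR V * expR (N%:R * V ^+ 2 / 4))).
  by rewrite ler_wpM2r ?expR_ge0//; have := expR_ge1Dx V; lra.
rewrite -expRD ler_expR.
have N1 : (1 : R) <= N%:R by rewrite ler1n.
(* This holds from V = 2 on, which is why the cases are separated at 2 (1 + u) and not at 1 + u.
   Multiplied by N >= 1 it gives V + N V^2 / 4 <= N V^2 - N. *)
have h1 : V <= 3 / 4 * V ^+ 2 - 1 by nra.
have h2 : 3 / 4 * V ^+ 2 - 1 <= N%:R * (3 / 4 * V ^+ 2 - 1).
  by rewrite ler_peMl//; lra.
lra.
Qed.

End multiplier.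

(** * Gaussian width of sparse hulls *)

Section normal_tail.
Context {R : realType}.
Local Notation RT := (measurableTypeR R).

Lemma normal_pdf_expR (m s x : R) : s != 0 ->
  normal_pdf m s x = normal_peak s * expR (- (x - m) ^+ 2 / (s ^+ 2 *+ 2)).
Proof. by move=> s0; rewrite normal_pdfE. Qed.

Lemma normal_upper_tail_ge (t : R) : 0 <= t ->
  ((normal_peak 1 * expR (- (t + 1) ^+ 2 / 2))%:E <= normal_prob (0 : R) 1 `[t, +oo[%classic)%E.
Proof.
move=> t0; rewrite /normal_prob; pose I : set R := `[t, (t + 1)]%classic.
apply: (@le_trans _ _ (\int[lebesgue_measure]_(x in I) (normal_pdf (0 : R) 1 x)%:E)%E); last first.
  apply: ge0_subset_integral => //=.
  - exact: measurable_itv.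
  - by apply/measurable_EFinP; apply: measurable_funTS; exact: measurable_normal_pdf.
  - by move=> x _; rewrite lee_fin normal_pdf_ge0.
  - by move=> x; rewrite /I /= !in_itv/= => /andP[-> _].
apply: (@le_trans _ _ (\int[lebesgue_measure]_(x in I) (normal_peak 1 * expR (- (t + 1) ^+ 2 / 2))%:E)%E).
  rewrite (integral_cst _ _ (normal_peak 1 * expR (- (t + 1) ^+ 2 / 2))%:E); last exact: measurable_itv.
  have lI : lebesgue_measure I = 1%E :> \bar R.
    rewrite /I lebesgue_measure_itv/= lte_fin ltrDl ltr01 -EFinD.
    by rewrite addrAC subrr add0r.
  by rewrite [X in (_ * X)%E]lI mule1.
apply: ge0_le_integral => //=.
- exact: measurable_itv.
- by move=> x _; rewrite lee_fin mulr_ge0 ?normal_peak_ge0 ?expR_ge0.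
- by apply/measurable_EFinP; apply: measurable_funTS; exact: measurable_normal_pdf.
- move=> x; rewrite /I /= in_itv/= => /andP[tx xt]; rewrite lee_fin normal_pdf_expR//.
  rewrite ler_wpM2l ?normal_peak_ge0// ler_expR subr0 expr1n -mulr_natr mul1r.
  by rewrite ler_pM2r ?invr_gt0// lerN2 ler_pXn2r ?nnegrE//; lra.
Qed.

(** Compare with the centered normal density of standard deviation 2: the quotient of the densities
    is a constant times exp(- 3 x^2 / 8), at most its value at k, and the wider law has total mass
    1. *)
Lemma normal_two_sided_tail_le (k : R) : 0 <= k ->
  (normal_prob (0 : R) 1 [set x : R | (k <= `|x|)%R] <=
     (normal_peak 1 / normal_peak 2 * expR (- (3 / 8) * k ^+ 2))%:E)%E.
Proof.
move=> k0; set C := normal_peak 1 / normal_peak 2 * _.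
have C0 : 0 <= C by rewrite !mulr_ge0 ?invr_ge0 ?normal_peak_ge0 ?expR_ge0.
have mA : measurable [set x : R | k <= `|x|].
  rewrite -[X in measurable X]setTI.
  have -> : [set x : R | k <= `|x|] = (fun x : R => `|x|) @^-1` `[k, +oo[%classic.
    by apply/seteqP; split => w /=; rewrite in_itv/= andbT.
  exact: normr_measurable.
rewrite /normal_prob.
apply: (@le_trans _ _ (\int[lebesgue_measure]_(x in [set x : R | (k <= `|x|)%R]) (C%:E * (normal_pdf (0 : R) 2 x)%:E))%E).
  apply: ge0_le_integral => //=.
  - by move=> x _; rewrite lee_fin normal_pdf_ge0.
  - by apply/measurable_EFinP; apply: measurable_funTS; exact: measurable_normal_pdf.
  - apply/measurable_EFinP; apply: measurable_funM => //.
    by apply: measurable_funTS; exact: measurable_normal_pdf.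
  move=> x /= kx; rewrite -EFinM lee_fin !normal_pdf_expR//.
  have -> : C * (normal_peak 2 * expR (- (x - 0) ^+ 2 / (2 ^+ 2 *+ 2))) =
    normal_peak 1 * (expR (- (3 / 8) * k ^+ 2) * expR (- (x - 0) ^+ 2 / (2 ^+ 2 *+ 2))) :> R.
    rewrite /C; field; rewrite gt_eqF//; exact: normal_peak_gt0.
  rewrite ler_wpM2l ?normal_peak_ge0// -expRD ler_expR subr0.
  have : k ^+ 2 <= x ^+ 2.
    by rewrite -(real_normK (num_real x)) ler_pXn2r ?nnegrE.
  rewrite expr1n -[2 ^+ 2 *+ 2]mulr_natr -[1 *+ 2]mulr_natr; lra.
have mp : measurable_fun setT (fun x : R => (normal_pdf 0 2 x)%:E).
  by apply/measurable_EFinP; exact: measurable_normal_pdf.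
rewrite ge0_integralZl_EFin//; last 2 first.
- by move=> x _; rewrite lee_fin normal_pdf_ge0.
- exact: measurable_funTS.
rewrite -[leRHS]mule1; apply: lee_wpmul2l; first by rewrite lee_fin.
rewrite -(integral_normal_pdf 0 2); apply: ge0_subset_integral => //=.
by move=> x _; rewrite lee_fin normal_pdf_ge0.
Qed.

(** |x| is at most the number of integers k >= 0 with k <= |x|, and the tail probabilities are
    summable because 3 k^2 / 8 >= k - 1. Finiteness is all that finite Gaussian widths require. *)
Lemma normal_first_moment :
  (\int[normal_prob (0 : R) 1]_x (`|x|)%:E < +oo)%E.
Proof.
pose A (k : nat) := [set x : R | k%:R <= `|x|].
have mA k : measurable (A k).
  rewrite -[X in measurable X]setTI.
  have -> : A k = (fun x : R => `|x|) @^-1` `[k%:R, +oo[%classic.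
    by apply/seteqP; split => w /=; rewrite in_itv/= andbT.
  exact: normr_measurable.
apply: (@le_lt_trans _ _ (\int[normal_prob (0 : R) 1]_x \sum_(0 <= k <oo) (\1_(A k) x)%:E)%E).
  apply: ge0_le_integral_nm => x; first by rewrite lee_fin.
  pose n := Num.truncn `|x|.
  have /andP[n1 n2] : n%:R <= `|x| < n.+1%:R by exact: Num.Theory.truncn_itv.
  apply: (@le_trans _ _ (\sum_(0 <= k < n.+1) (\1_(A k) x)%:E)%E); last first.
    by apply: nneseries_lim_ge => *; rewrite lee_fin.
  rewrite sumEFin lee_fin big_nat.
  rewrite (eq_bigr (fun=> 1)); last first.
    move=> i /andP[_ iN]; rewrite indicE mem_set//= /A/=.
    by apply: le_trans n1; rewrite ler_nat -ltnS.
  by rewrite -big_nat sumr_const_nat subn0 ltW.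
rewrite integral_nneseries//; last first.
  move=> k; apply/measurable_EFinP; apply: measurable_indic; exact: mA.
pose c := normal_peak 1 / normal_peak 2 * expR 1 : R.
have c0 : 0 <= c by rewrite !mulr_ge0 ?invr_ge0 ?normal_peak_ge0 ?expR_ge0.
apply: (@le_lt_trans _ _ (\sum_(0 <= k <oo) (c * (2 / 3) ^+ k)%:E)%E); last first.
  by apply: (le_lt_trans (nneseries_geometric_le c c0)); rewrite ltry.
apply: lee_nneseries => k; first by move=> *; apply: integral_ge0 => x _; rewrite lee_fin.
move=> _; rewrite integral_indic ?setIT; [|exact: measurableT|exact: mA].
apply: le_trans (normal_two_sided_tail_le k%:R (ler0n _ _)) _.
rewrite lee_fin /c -[leRHS]mulrA ler_wpM2l ?mulr_ge0 ?invr_ge0 ?normal_peak_ge0//.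
apply: (@le_trans _ _ (expR 1 * expR (- k%:R))).
  rewrite -expRD ler_expR; set x : R := k%:R; have := sqr_ge0 (x - 4 / 3); nra.
rewrite ler_wpM2l ?expR_ge0//.
have h32 : (0 : R) < 3 / 2 by lra.
have -> : (2 / 3 : R) = (3 / 2)^-1 by field.
rewrite exprVn expRN -[k%:R]mulr1 expRM_natl lef_pV2 ?posrE ?exprn_gt0 ?expR_gt0//.
apply: lerXn2r; rewrite ?nnegrE ?expR_ge0// ?(ltW h32)//.
have := expR_ge1Dx (1 : R); lra.
Qed.

End normal_tail.

(** By induction on S, one transposition corrects the value at [f j0] and leaves the earlier ones
    alone. The permutation goes from places to sources because [sign_perm_invariant] reads x at
    [pi j]. *)
Lemma perm_extend (I : finType) (S : seq I) (f : I -> I) : uniq S ->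
  {in S &, injective f} -> exists pi : {perm I}, {in S, forall j, pi (f j) = j}.
Proof.
elim: S => [|j0 S IH] /=; first by move=> _ _; exists 1%g.
move=> /andP[j0S uS] finj.
have [|pi hpi] := IH uS.
  by move=> i j iS jS; apply: finj; rewrite inE ?iS ?jS orbT.
exists (pi * tperm (pi (f j0)) j0)%g => j; rewrite inE permM => /orP[/eqP ->|jS].
  by rewrite tpermL.
rewrite (hpi j jS) tpermD//.
  rewrite -[X in _ != X](hpi j jS) (inj_eq perm_inj); apply/eqP => /finj.
  by rewrite !inE eqxx jS orbT => /(_ erefl erefl) e; rewrite e jS in j0S.
by apply/eqP => e; rewrite e jS in j0S.
Qed.

(** * Convexity of the body and of its sparse hulls *)

Section convexity.
Context {R : realType} {p : nat}.
Implicit Types C K : set 'cV[R]_p.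

Lemma convex_setE C : convex_set C <-> forall x y (a : R), 0 <= a -> a <= 1 ->
  C x -> C y -> C (a *: x + (1 - a) *: y).
Proof.
split=> [cC x y a a0 a1 Cx Cy|h x y l].
  have := cC x y (Itv01 a0 a1); rewrite !inE; exact.
rewrite !inE => Cx Cy; apply: h => //; exact: le1.
Qed.

Lemma sparse_hull_sub K C s : convex_set C ->
  (forall v, K v -> (norm0 v <= s)%N -> C v) -> sparse_hull K s `<=` C.
Proof. by move=> cC h; apply: smallest_sub => // v [Kv vs]; exact: h. Qed.

Lemma sparse_hull_sparse K s v : K v -> (norm0 v <= s)%N -> sparse_hull K s v.
Proof. by move=> Kv vs C [_]; apply; split. Qed.

Lemma sparse_hull_le K s t : (s <= t)%N -> sparse_hull K s `<=` sparse_hull K t.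
Proof.
move=> st v h C [cC hC]; apply: h; split => // u [Ku us]; apply: hC.
by split => //=; exact: leq_trans st.
Qed.

Lemma sparse_hull_subset K s : convex_set K -> sparse_hull K s `<=` K.
Proof. by move=> cK; apply: sparse_hull_sub. Qed.

Lemma convex_l1norm_le (c k : R) : 0 <= k ->
  convex_set [set v : 'cV[R]_p | k * l1norm v <= c].
Proof.
move=> k0; apply/convex_setE => x y a a0 a1 /= hx hy.
have b0 : 0 <= 1 - a by lra.
apply: (@le_trans _ _ (k * (a * l1norm x + (1 - a) * l1norm y))).
  apply: ler_wpM2l => //; apply: le_trans (ler_l1normD _ _) _.
  by rewrite !l1normZ !ger0_norm.
have -> : k * (a * l1norm x + (1 - a) * l1norm y) =
  a * (k * l1norm x) + (1 - a) * (k * l1norm y) by ring.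
have := ler_wpM2l a0 hx; have := ler_wpM2l b0 hy; lra.
Qed.

(** It is the midpoint of v and of v with every sign but the j-th flipped. *)
Lemma sign_perm_coordinate K v j : convex_set K -> sign_perm_invariant K ->
  K v -> K (v j 0 *: delta_mx j 0).
Proof.
move=> cK sK Kv.
have := sK v (fun i => i != j) 1%g Kv; set v' := \col_i _ => Kv'.
have h0 : 0 <= 1 / 2 :> R by lra.
have h1 : 1 / 2 <= 1 :> R by lra.
have := (convex_setE K).1 cK v v' _ h0 h1 Kv Kv'; congr K.
apply/matrixP => i k; rewrite ord1 !mxE perm1; case: eqVneq => [->|ij] /=.
  by rewrite ?eqxx ?expr0 /= ?mulr1; lra.
by rewrite ?(negbTE ij) /= ?expr1 ?mulr0; lra.
Qed.

End convexity.

Section gaussian.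
Context {R : realType}.
Local Notation RT := (measurableTypeR R).

(** A box constrained in the j-th coordinate only shows that this coordinate is standard normal. *)
Lemma gaussian_marginal_moment (p : nat) (j : 'I_p) :
  (\int[@std_gaussian R p]_g (`|tnth g j : R|)%:E < +oo)%E.
Proof.
have mt := @measurable_tnth _ RT p j.
pose Y : {mfun (p.-tuple RT) >-> RT} := mfun_Sub (mem_set mt).
have mabs : measurable_fun [set: RT] (fun x : RT => (`|x : R|)%:E).
  by apply/measurable_EFinP; exact: normr_measurable.
apply: (le_lt_trans _ (@normal_first_moment R)).
rewrite le_eqVlt; apply/orP; left; apply/eqP.
transitivity (\int[distribution (@std_gaussian R p) Y]_x (`|x : R|)%:E)%E.
  by rewrite (ge0_integral_distribution Y mabs).
apply: eq_measure_integral => A mA _.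
pose B (k : 'I_p) : set RT := if k == j then A else setT.
have mB k : measurable (B k) by rewrite /B; case: eqP.
have [_ h] := std_gaussian_box mB.
transitivity (std_gaussian p [set g : p.-tuple RT | forall k, B k (tnth g k)]).
  congr (std_gaussian p _); apply/seteqP; split => g /=; rewrite /B.
    by move=> Ag k; case: eqP => // ->.
  by move=> /(_ j); rewrite eqxx.
rewrite h (bigD1 j)//= big1 ?mule1; first by rewrite /B eqxx.
by move=> k /negbTE kj; rewrite /B kj probability_setT.
Qed.

Lemma gaussian_width_ge0 (p : nat) (T : set 'cV[R]_p) : T 0 ->
  (0 <= gaussian_width T)%E.
Proof.
move=> T0; apply: integral_ge0 => g _; apply: ereal_sup_ubound; exists 0 => //.
by rewrite big1// => j _; rewrite mxE mulr0.
Qed.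

Lemma gaussian_width_sup_ge0 (p : nat) (T : set 'cV[R]_p) (g : p.-tuple RT) : T 0 ->
  (0 <= ereal_sup [set (\sum_(j < p) (tnth g j : R) * v j 0)%R%:E | v in T])%E.
Proof.
move=> T0; apply: ereal_sup_ubound; exists 0 => //.
by rewrite big1// => j _; rewrite mxE mulr0.
Qed.

Lemma gaussian_width_le (p : nat) (T T' : set 'cV[R]_p) : T 0 -> T `<=` T' ->
  (gaussian_width T <= gaussian_width T')%E.
Proof.
move=> T0 TT'; apply: ge0_le_integral_nm => g; first exact: gaussian_width_sup_ge0.
by apply: ereal_sup_le => _ [v Tv <-]; exists v => //; exact: TT'.
Qed.

Lemma gaussian_width_fin (p : nat) (T : set 'cV[R]_p) (B : R) : (0 < p)%N -> T 0 ->
  (forall v j, T v -> `|v j 0| <= B) -> (gaussian_width T < +oo)%E.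
Proof.
move=> p0 T0 hB.
have B0 : 0 <= B by apply: le_trans (hB 0 (Ordinal p0) T0).
apply: (@le_lt_trans _ _ (\int[@std_gaussian R p]_g (\sum_(j <- index_enum 'I_p) B * `|tnth g j : R|)%:E)%E).
  apply: ge0_le_integral_nm => g; first exact: gaussian_width_sup_ge0.
  apply: ge_ereal_sup => _ [v Tv <-]; rewrite lee_fin; apply: ler_sum => j _.
  by apply: le_trans (ler_norm _) _; rewrite normrM mulrC ler_wpM2r// hB.
have mt (j : 'I_p) : measurable_fun setT (fun g : p.-tuple RT => `|tnth g j : R|).
  by apply: measurableT_comp; [exact: normr_measurable|exact: measurable_tnth].
rewrite ge0_integral_sum_EFin//; last 2 first.
- by move=> j; exact: measurable_funM.
- by move=> j w; rewrite mulr_ge0.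
apply: lte_sum_pinfty => j _; rewrite ge0_integralZ_EFin//.
by apply: lte_mul_pinfty => //; exact: gaussian_marginal_moment.
Qed.

(** The complement is a box: all b coordinates of block k stay below t. By independence its
    probability is at most (1 - q)^b <= exp(- q b); the bound on k ensures that the block is
    complete. *)
Lemma gaussian_hit_prob (p b k : nat) (t q : R) : (0 < b)%N -> ((k.+1 * b) <= p)%N ->
  (q%:E <= normal_prob (0 : R) 1 `[t, +oo[%classic)%E -> 0 <= q ->
  let H := [set g : p.-tuple RT | exists i : 'I_p, (i %/ b)%N = k /\ t <= tnth g i] in
  measurable H /\ ((1 - expR (- (q * b%:R)))%:E <= @std_gaussian R p H)%E.
Proof.
move=> b0 kb hq q0 H.
pose A (i : 'I_p) : set RT := if (i %/ b)%N == k then `]-oo, t[%classic else setT.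
have mA i : measurable (A i) by rewrite /A; case: eqP => // _; exact: measurable_itv.
have [mbox Pbox] := std_gaussian_box mA.
have HC : H = ~` [set g : p.-tuple RT | forall i, A i (tnth g i)].
  apply/seteqP; split=> [g [i [ik tg]] h|g /existsNP [i nA]].
    by have := h i; rewrite /A ik eqxx /= in_itv/= ltNge tg.
  exists i; move: nA; rewrite /A; case: eqP => [ik|_ []//].
  by rewrite /= in_itv/= => /negP; rewrite -leNgt.
split; first by rewrite HC; exact: measurableC.
rewrite HC probability_setC// Pbox.
pose Q := 1 - q.
have mt : measurable (`[t, +oo[%classic : set RT) by exact: measurable_itv.
have hQ : (normal_prob (0 : R) 1 `]-oo, t[%classic <= Q%:E)%E.
  have -> : `]-oo, t[%classic = ~` `[t, +oo[%classic :> set RT by rewrite setCitvr.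
  rewrite probability_setC// /Q EFinB; exact: leeB.
have Q0 : 0 <= Q.
  rewrite -lee_fin; apply: le_trans hQ; exact: measure_ge0.
have hp : (\prod_(i < p) normal_prob (0 : R) 1 (A i) <= (expR (- (q * b%:R)))%:E)%E.
  apply: (@le_trans _ _ (\prod_(i < p) (if (i %/ b)%N == k then Q else 1)%:E)%E).
    apply: (@proj2 (0 <= \prod_(i < p) normal_prob (0 : R) 1 (A i))%E).
    elim/big_ind2 : _ => //; first by move=> ? ? ? ? [? ?] [? ?]; split; [exact: mule_ge0|exact: lee_pmul].
    move=> i _; split; first exact: measure_ge0.
    by rewrite /A; case: eqP => // _; exact: probability_le1.
  have -> : (\prod_(i < p) (if (i %/ b)%N == k then Q else 1)%:E = (\prod_(i < p) (if (i %/ b)%N == k then Q else 1))%:E)%E.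
    by elim/big_ind2 : _ => // x1 x2 y1 y2 -> ->; rewrite EFinM.
  rewrite lee_fin -big_mkcond /= prodr_const.
  have Qe : Q <= expR (- q) by exact: expR_ge1Dx.
  have Q1 : Q <= 1 by rewrite /Q; lra.
  have card : (b <= #|[pred i : 'I_p | (i %/ b)%N == k]|)%N.
    have pf (r : 'I_b) : (k * b + r < p)%N.
      by apply: leq_trans kb; rewrite mulSn addnC -addSn leq_add2r.
    have inj : injective (fun r : 'I_b => Ordinal (pf r)).
      by move=> r r' [] /eqP; rewrite eqn_add2l => /eqP; exact: val_inj.
    rewrite -[X in (X <= _)%N]card_ord -(fintype.card_image inj); apply: subset_leq_card.
    apply/fintype.subsetP => i /fintype.imageP[r _ ->]; rewrite inE /=.
    by rewrite divnMDl// divn_small// addn0.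
  apply: (@le_trans _ _ (Q ^+ b)); first exact: ler_wiXn2l.
  apply: (@le_trans _ _ (expR (- q) ^+ b)); first by rewrite lerXn2r ?nnegrE ?expR_ge0.
  by rewrite -expRM_natr mulNr.
by rewrite EFinB; exact: leeB.
Qed.

End gaussian.

(** * Lower bound on the Gaussian width by spreading entries over blocks *)

Section width_lower.
Context {R : realType}.
Local Notation RT := (measurableTypeR R).

Definition block_hit (p b : nat) (t : R) (k : nat) : set (p.-tuple RT) :=
  [set g | exists i : 'I_p, (i %/ b)%N = k /\ t <= tnth g i].

(* The entries of [u] are moved, one per block of [b] consecutive indices, to a
   place of the block where [g] is at least [t] if there is one, and given the
   sign of [g] there. *)
Lemma spread_entries (p : nat) (K : set 'cV[R]_p) (u : 'cV[R]_p) (s b : nat) (t : R)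
    (g : p.-tuple RT) :
  sign_perm_invariant K -> K u -> (norm0 u <= s)%N -> (0 < b)%N -> (s * b <= p)%N ->
  0 <= t ->
  exists v : 'cV[R]_p, [/\ K v, (norm0 v <= s)%N &
    \sum_j `|u j 0| * t * \1_(block_hit p b t (index j (enum [pred j | u j 0 != 0]))) g
      <= \sum_j (tnth g j : R) * v j 0].
Proof.
move=> sK Ku us b0 sb t0.
set S := enum [pred j | u j 0 != 0].
have sS : (size S <= s)%N by rewrite -cardE.
pose rk j := index j S.
have rks j : j \in S -> (rk j < s)%N.
  by move=> jS; apply: leq_trans sS; rewrite index_mem.
(* If no coordinate of the block reaches t, the first index of the block is taken. It is below p
   since rk j < s, and staying in the block keeps f injective on the support. *)
pose f (j : 'I_p) : 'I_p :=
  if [pick i : 'I_p | ((i %/ b)%N == rk j) && (t <= tnth g i)] is Some i then i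
  else insubd j (rk j * b)%N.
have fdiv j : j \in S -> (f j %/ b)%N = rk j.
  move=> jS; rewrite /f; case: pickP => [i /andP[/eqP //]|_].
  rewrite val_insubd.
  have -> : (rk j * b < p)%N.
    apply: leq_trans sb; apply: (@leq_trans ((rk j).+1 * b)); last by rewrite leq_mul2r rks ?orbT.
    by rewrite mulSn -[X in (X < _)%N]add0n ltn_add2r.
  by rewrite mulnK.
have finj : {in S &, injective f}.
  move=> i j iS jS e; have : rk i = rk j by rewrite -!fdiv// e.
  by rewrite /rk => /index_inj; apply.
have [pi hpi] := perm_extend _ _ _ (enum_uniq _) finj.
pose eps i := (tnth g i : R) * u (pi i) 0 < 0.
exists (\col_i ((-1) ^+ eps i * u (pi i) 0)); split; first exact: sK.
  apply: leq_trans us; rewrite /norm0 -(fintype.card_image (@perm_inj _ pi)).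
  apply: subset_leq_card; apply/fintype.subsetP => j /fintype.imageP[i + ->].
  by rewrite !inE mxE; apply: contra => /eqP ->; rewrite mulr0.
have -> : \sum_j (tnth g j : R) * (\col_i ((-1) ^+ eps i * u (pi i) 0)) j 0 =
    \sum_j `|tnth g j : R| * `|u (pi j) 0|.
  apply: eq_bigr => i _; rewrite mxE -normrM /eps mulrCA.
  case: ltP => h; first by rewrite expr1 mulN1r ltr0_norm.
  by rewrite expr0 mul1r ger0_norm.
rewrite [leRHS](reindex_inj (@perm_inj _ (pi^-1)%g)) /=.
apply: ler_sum => j _; rewrite permKV.
have [->|uj] := eqVneq (u j 0) 0; first by rewrite normr0 !mul0r mulr0.
have jS : j \in S by rewrite mem_enum inE.
have -> : (pi^-1)%g j = f j by rewrite -[X in (pi^-1)%g X](hpi j jS) permK.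
rewrite -mulrA mulrC ler_wpM2r// indicE.
case: (boolP (g \in _)) => [|_]; last by rewrite mulr0.
rewrite inE mulr1 => -[i [ik ti]]; rewrite /f; case: pickP => [i' /andP[_ h]|/(_ i)].
  by apply: le_trans h _; exact: ler_norm.
by rewrite /rk -ik eqxx ti.
Qed.

(** The value of 1 - exp(- q b) for q = normal_peak 1 * exp(-2) / b: a lower bound, free of b, for
    the probability that a block of b coordinates reaches sqrt(1 + ln b). *)
Definition hit_bound : R := 1 - expR (- (normal_peak 1 * expR (-2))).

Lemma hit_bound_gt0 : 0 < hit_bound.
Proof.
have h : 0 < normal_peak 1 * expR (-2) :> R.
  by rewrite mulr_gt0 ?expR_gt0// normal_peak_gt0// oner_neq0.
by rewrite subr_gt0 expR_lt1 oppr_lt0.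
Qed.

(** This is the expectation of [spread_entries]: each |u_j| counts t times the probability that its
    own block is hit. By linearity the blocks need not be hit simultaneously. *)
Lemma gaussian_width_lower (p : nat) (K : set 'cV[R]_p) (u : 'cV[R]_p) (s b : nat) :
  sign_perm_invariant K -> K u -> sparse_hull K s 0 -> (norm0 u <= s)%N ->
  (0 < b)%N -> (s * b <= p)%N ->
  ((hit_bound * (Num.sqrt (1 + ln b%:R) * l1norm u))%:E <=
     gaussian_width (sparse_hull K s))%E.
Proof.
move=> sK Ku h0 us b0 sb.
have b1 : (1 : R) <= b%:R by rewrite ler1n.
have b0' : (0 : R) < b%:R by rewrite ltr0n.
set t := Num.sqrt (1 + ln b%:R).
have L1 : 1 <= 1 + ln b%:R :> R by rewrite lerDl ln_ge0.
have t2 : t ^+ 2 = 1 + ln b%:R by rewrite sqr_sqrtr//; lra.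
have t0 : 0 <= t by exact: sqrtr_ge0.
pose q : R := normal_peak 1 * expR (-2) / b%:R.
have pk : 0 < normal_peak 1 :> R by rewrite normal_peak_gt0// oner_neq0.
have q0 : 0 <= q by rewrite divr_ge0// mulr_ge0 ?expR_ge0// ltW.
have hq : (q%:E <= normal_prob (0 : R) 1 `[t, +oo[%classic)%E.
  apply: le_trans (normal_upper_tail_ge t t0); rewrite lee_fin /q -mulrA ler_wpM2l ?(ltW pk)//.
  have -> : b%:R^-1 = expR (- ln b%:R) :> R by rewrite expRN lnK.
  (* The Gaussian tail at t loses only the constant exp(-2), since (t + 1)^2 / 2 <= t^2 + 1 = 2 + ln
     b. *)
  rewrite -expRD ler_expR; have := sqr_ge0 (t - 1); nra.
set S := enum [pred j | u j 0 != 0].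
have sS : (size S <= s)%N by rewrite -cardE.
have hH j : u j 0 != 0 -> measurable (block_hit p b t (index j S)) /\
    (hit_bound%:E <= @std_gaussian R p (block_hit p b t (index j S)))%E.
  move=> uj; have jS : j \in S by rewrite mem_enum inE.
  have kb : ((index j S).+1 * b <= p)%N.
    by apply: leq_trans sb; rewrite leq_mul2r (leq_trans _ sS) ?orbT ?index_mem.
  have [mH hP] := gaussian_hit_prob p b (index j S) t q b0 kb hq q0.
  split => //; suff <- : 1 - expR (- (q * b%:R)) = hit_bound by [].
  by rewrite /hit_bound /q divfK// gt_eqF.
pose F (j : 'I_p) (g : p.-tuple RT) : R := `|u j 0| * t * \1_(block_hit p b t (index j S)) g.
have mF j : measurable_fun setT (F j).
  have [uj|uj] := eqVneq (u j 0) 0.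
    rewrite (_ : F j = cst 0)//; apply/funext => g; by rewrite /F uj normr0 !mul0r.
  by apply: measurable_funM => //; apply: measurable_indic; exact: (hH j uj).1.
have F0 j g : 0 <= F j g by rewrite !mulr_ge0.
apply: (@le_trans _ _ (\int[@std_gaussian R p]_g (\sum_(j <- index_enum 'I_p) F j g)%:E)%E); last first.
  apply: ge0_le_integral_nm => g; first by rewrite lee_fin sumr_ge0.
  have [v [Kv vs hv]] := spread_entries p K u s b t g sK Ku us b0 sb t0.
  apply: (@le_trans _ _ (\sum_j (tnth g j : R) * v j 0)%:E); first by rewrite lee_fin.
  by apply: ereal_sup_ubound; exists v => //; exact: sparse_hull_sparse.
rewrite ge0_integral_sum_EFin//.
have -> : hit_bound * (t * l1norm u) = \sum_(j <- index_enum 'I_p) `|u j 0| * t * hit_bound.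
  by rewrite /l1norm !mulr_sumr; apply: eq_bigr => j _; ring.
rewrite -sumEFin; apply: lee_sum => j _.
have [uj|uj] := eqVneq (u j 0) 0.
  by rewrite uj normr0 !mul0r; apply: integral_ge0 => g _; rewrite lee_fin.
have [mH hP] := hH j uj.
rewrite ge0_integralZ_EFin//; last by rewrite mulr_ge0.
rewrite integral_indic// setIT EFinM; apply: lee_wpmul2l => //.
by rewrite lee_fin mulr_ge0.
Qed.

End width_lower.

Section log_factor.
Context {R : realType}.

Lemma ln_expR1D_ge1 (s : nat) : 1 <= ln (expR 1 + s%:R) :> R.
Proof.
rewrite -ler_expR lnK ?posrE ?ltr_wpDr ?expR_gt0//.
by rewrite lerDl.
Qed.

Lemma log_factor_ge1 (s : nat) : 1 <= log_factor (7 : R) s.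
Proof. by rewrite /log_factor; have := ln_expR1D_ge1 s; lra. Qed.

Lemma le_log_factor (s t : nat) : (s <= t)%N -> log_factor (7 : R) s <= log_factor 7 t.
Proof.
move=> st; rewrite /log_factor ler_wpM2l// ler_ln ?posrE ?ltr_wpDr ?expR_gt0//.
by rewrite lerD2l ler_nat.
Qed.

(** Supplies the hypothesis [s <= expR l] of [multiplier_bound]. *)
Lemma nat_le_exp_log_factor (s : nat) : (s%:R : R) <= expR (log_factor 7 s).
Proof.
apply: (@le_trans _ _ (expR (ln (expR 1 + s%:R)))).
  by rewrite lnK ?posrE ?ltr_wpDr ?expR_gt0// lerDr expR_ge0.
by rewrite ler_expR /log_factor; have := ln_expR1D_ge1 s; lra.
Qed.

(* Here the factor [log_factor] of the penalty pays for replacing [ln (p / s)]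
   by [ln p]. *)
Lemma log_dim_le (p s : nat) : (0 < s)%N -> (s <= p)%N ->
  1 + ln p%:R <= (1 + ln (p %/ s)%:R) * log_factor 7 s :> R.
Proof.
move=> s0 sp; set b := (p %/ s)%N.
have b0 : (0 < b)%N by rewrite divn_gt0.
have b0' : (0 : R) < b%:R by rewrite ltr0n.
have s0' : (0 : R) < s%:R by rewrite ltr0n.
have e0 := expR_gt0 (1 : R).
(* Rounding p / s down to b costs a factor 2: p < (b + 1) s <= 2 b s. *)
have pb : (p%:R : R) <= expR 1 * (b%:R * (expR 1 + s%:R)).
  apply: (@le_trans _ _ (2 * (b%:R * s%:R))).
    rewrite -!natrM ler_nat; have := ltn_ceil p s0; rewrite -/b => h.
    apply: leq_trans (ltnW h) _; rewrite mulnA leq_mul2r; apply/orP; right; lia.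
  apply: ler_pM => //.
  - by have := expR_ge1Dx (1 : R); lra.
  - by rewrite ler_wpM2l ?(ltW b0')// lerDr ltW.
have lnp : ln p%:R <= 1 + (ln b%:R + ln (expR 1 + s%:R)) :> R.
  have es : 0 < expR 1 + s%:R :> R by rewrite addr_gt0.
  rewrite -[X in X + _](@expRK R) -!lnM ?posrE ?mulr_gt0//.
  by rewrite ler_ln ?posrE ?mulr_gt0// ltr0n (leq_trans s0 sp).
rewrite /log_factor; have A1 := ln_expR1D_ge1 s.
have B0 : 0 <= ln b%:R :> R by rewrite ln_ge0// ler1n.
set A := ln (expR 1 + s%:R) in lnp A1 *; set B := ln b%:R in lnp B0 *.
have : 0 <= B * (A - 1) by rewrite mulr_ge0// subr_ge0.
nra.
Qed.

End log_factor.

Lemma compact_coord_bounded {R : realType} {p : nat} (K : set 'cV[R]_p) :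
  compact K -> exists B, forall v j, K v -> `|v j 0| <= B.
Proof.
move=> cK.
have bnd j : exists M : R, forall v, K v -> `|v j 0| <= M.
  have cont : continuous (fun v : 'cV[R]_p => v j 0) by exact: coord_continuous.
  have := continuous_compact (continuous_subspaceT cont) cK.
  move=> /compact_bounded[M [_ hM]].
  exists (M + 1) => v Kv; apply: (hM (M + 1)); first by rewrite ltrDl.
  by exists v.
have [M hM] := choice bnd.
exists (\sum_j `|M j|) => v j Kv; apply: le_trans (hM j v Kv) _.
by rewrite (bigD1 j)//= (le_trans (ler_norm _))// lerDl sumr_ge0.
Qed.

(** * The l1 geometry of K^(s) in terms of its width *)

Section hull_bounds.
Context {R : realType} {p : nat} (K : set 'cV[R]_p).
Hypothesis p0 : (0 < p)%N.
Hypothesis cK : convex_set K.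
Hypothesis sK : sign_perm_invariant K.
Hypothesis K0 : K 0.
Variable B : R.
Hypothesis KB : forall v j, K v -> `|v j 0| <= B.

Definition hull_width (s : nat) : R := fine (gaussian_width (sparse_hull K s)).

(** The scale w_s sqrt(l_s), in which both the l1 radius of K^(s) and the penalty are expressed. *)
Definition scaled_width (s : nat) : R := hull_width s * Num.sqrt (log_factor 7 s).

Lemma sparse_hull0 s : sparse_hull K s 0.
Proof.
apply: sparse_hull_sparse => //; rewrite /norm0 eq_card0// => j.
by rewrite !inE mxE eqxx.
Qed.

Lemma hull_widthE s : gaussian_width (sparse_hull K s) = (hull_width s)%:E.
Proof.
rewrite /hull_width fineK// ge0_fin_numE; last exact: gaussian_width_ge0 (sparse_hull0 s).
apply: (gaussian_width_fin p _ B p0 (sparse_hull0 s)) => v j /(sparse_hull_subset K s cK).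
exact: KB.
Qed.

Lemma hull_width_ge0 s : 0 <= hull_width s.
Proof. by rewrite -lee_fin -hull_widthE; exact: gaussian_width_ge0 (sparse_hull0 s). Qed.

Lemma le_hull_width s t : (s <= t)%N -> hull_width s <= hull_width t.
Proof.
move=> st; rewrite -lee_fin -!hull_widthE; apply: gaussian_width_le (sparse_hull0 s) _.
exact: sparse_hull_le.
Qed.

Lemma scaled_width_ge0 s : 0 <= scaled_width s.
Proof. by rewrite mulr_ge0 ?hull_width_ge0 ?sqrtr_ge0. Qed.

Lemma le_scaled_width s t : (s <= t)%N -> scaled_width s <= scaled_width t.
Proof.
move=> st; apply: ler_pM; rewrite ?hull_width_ge0 ?sqrtr_ge0 ?le_hull_width//.
by rewrite ler_wsqrtr// le_log_factor.
Qed.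

Lemma sparse_l1_bound s v : (0 < s)%N -> (s <= p)%N -> K v -> (norm0 v <= s)%N ->
  Num.sqrt (1 + ln p%:R) * l1norm v <= hit_bound^-1 * scaled_width s.
Proof.
move=> s0 sp Kv vs.
have b0 : (0 < p %/ s)%N by rewrite divn_gt0.
have := gaussian_width_lower p K v s (p %/ s) sK Kv (sparse_hull0 s) vs b0.
rewrite mulnC leq_divM => /(_ isT); rewrite hull_widthE lee_fin => h.
have eta0 := @hit_bound_gt0 R.
rewrite ler_pdivlMl// /scaled_width.
have l0 : 0 <= log_factor 7 s :> R by have := @log_factor_ge1 R s; lra.
have L0 : 0 <= 1 + ln (p %/ s)%:R :> R.
  have : 0 <= ln (p %/ s)%:R :> R by rewrite ln_ge0// ler1n.
  lra.
have sq : Num.sqrt (1 + ln p%:R) <= Num.sqrt (1 + ln (p %/ s)%:R) * Num.sqrt (log_factor 7 s) :> R.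
  by rewrite -sqrtrM// ler_wsqrtr// log_dim_le.
have := ler_wpM2r (sqrtr_ge0 (log_factor 7 s)) h; apply: le_trans.
have := ler_wpM2l (mulr_ge0 (ltW eta0) (l1norm_ge0 v)) sq.
set x := Num.sqrt (1 + ln p%:R); set y := Num.sqrt _; set z := Num.sqrt _ => hh.
have -> : hit_bound * (x * l1norm v) = hit_bound * l1norm v * x by ring.
by apply: le_trans hh _; apply: eq_ler; ring.
Qed.

Lemma hull_l1_bound s v : (0 < s)%N -> (s <= p)%N -> sparse_hull K s v ->
  Num.sqrt (1 + ln p%:R) * l1norm v <= hit_bound^-1 * scaled_width s.
Proof.
move=> s0 sp; apply: (sparse_hull_sub K [set v | _ <= _]) v.
  exact: convex_l1norm_le (sqrtr_ge0 _).
by move=> v Kv vs; exact: sparse_l1_bound.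
Qed.

(** The vector with the single entry v_j lies in K and is 1-sparse, so [sparse_l1_bound] applies
    with s = 1, whatever the sparsity of v. *)
Lemma body_coord_bound v j : K v ->
  Num.sqrt (1 + ln p%:R) * `|v j 0| <= hit_bound^-1 * scaled_width 1.
Proof.
move=> Kv; have Ke := sign_perm_coordinate K v j cK sK Kv.
have n1 : (norm0 (v j 0 *: delta_mx j 0 : 'cV[R]_p)%R <= 1)%N.
  rewrite /norm0 -[X in (_ <= X)%N](card1 j); apply: subset_leq_card; apply/fintype.subsetP => i.
  rewrite !inE !mxE; apply: contraNT => /negbTE ->; by rewrite mulr0.
have := sparse_l1_bound 1 _ isT p0 Ke n1; rewrite l1normZ.
have -> : l1norm (delta_mx j 0 : 'cV[R]_p) = 1; last by rewrite mulr1.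
rewrite /l1norm (bigD1 j)//= big1 ?addr0; first by rewrite mxE !eqxx normr1.
by move=> i /negbTE ij; rewrite mxE ij normr0.
Qed.

(** The crude bound, linear in s, for the regime of large noise in [multiplier_bound]: at most s
    entries, each bounded by [body_coord_bound]. *)
Lemma hull_l1_bound_card s v : sparse_hull K s v ->
  Num.sqrt (1 + ln p%:R) * l1norm v <= hit_bound^-1 * (s%:R * scaled_width 1).
Proof.
apply: (sparse_hull_sub K [set v | _ <= _]) v.
  exact: convex_l1norm_le (sqrtr_ge0 _).
move=> v Kv vs /=.
have eta0 : 0 <= hit_bound^-1 :> R by rewrite invr_ge0 ltW// hit_bound_gt0.
apply: (@le_trans _ _ ((norm0 v)%:R * (hit_bound^-1 * scaled_width 1))).
  rewrite /l1norm mulr_sumr /norm0 -sum1_card natr_sum mulr_suml.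
  rewrite [leRHS]big_mkcond /=; apply: ler_sum => j _; rewrite inE.
  have [->|vj] := eqVneq (v j 0) 0; first by rewrite normr0 mulr0.
  by rewrite /= mul1r body_coord_bound.
by rewrite mulrCA ler_wpM2l// ler_wpM2r ?scaled_width_ge0// ler_nat.
Qed.

(** In this form the first summand is the noise term of [multiplier_bound] and the second is the l1
    remainder of [quadratic_form_lower]. *)
Lemma penE (sg : R) (N s : nat) : (0 < N)%N ->
  pen 7 sg N K s =
    sg * (scaled_width s / Num.sqrt N%:R * (1 + Num.sqrt (log_factor 7 s / N%:R))) +
    scaled_width s ^+ 2 / N%:R.
Proof.
move=> N0; have N0' : (0 : R) < N%:R by rewrite ltr0n.
have l0 : 0 <= log_factor 7 s :> R by have := @log_factor_ge1 R s; lra.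
have -> : Num.sqrt (log_factor 7 s / N%:R) = Num.sqrt (log_factor 7 s) / Num.sqrt N%:R :> R.
  by rewrite (sqrtrM _ l0) sqrtrV// ltW.
rewrite /pen -/(hull_width s) /scaled_width.
set l := log_factor 7 s in l0 *.
have r0 : 0 < Num.sqrt N%:R :> R by rewrite sqrtr_gt0.
have lE : l = Num.sqrt l ^+ 2 by rewrite sqr_sqrtr.
have NE : N%:R = Num.sqrt N%:R ^+ 2 :> R by rewrite sqr_sqrtr// ltW.
move: lE NE r0; generalize (Num.sqrt l), (Num.sqrt N%:R : R) => a r lE NE r0.
by rewrite lE NE; field; rewrite gt_eqF.
Qed.

End hull_bounds.

(** * The oracle inequality *)

Lemma sqnorm2D {R : realType} {n} (u v : 'cV[R]_n) :
  sqnorm2 (u + v) = sqnorm2 u + 2 * \sum_i v i 0 * u i 0 + sqnorm2 v.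
Proof.
rewrite /sqnorm2 mulr_sumr -!big_split; apply: eq_bigr => i _ /=.
by rewrite mxE; ring.
Qed.

Lemma sqnorm2N {R : realType} {n} (u : 'cV[R]_n) : sqnorm2 (- u) = sqnorm2 u.
Proof. by apply: eq_bigr => i _; rewrite mxE sqrrN. Qed.

Lemma sqnorm2D_le {R : realType} {n} (u v : 'cV[R]_n) :
  sqnorm2 (u + v) <= 2 * sqnorm2 u + 2 * sqnorm2 v.
Proof.
rewrite /sqnorm2 !mulr_sumr -big_split; apply: ler_sum => i _ /=.
by rewrite mxE; have := sqr_ge0 (u i 0 - v i 0); lra.
Qed.

(** A bound on an infimum provides an admissible scale only strictly above the bound; enlarging the
    scale further decreases the exponential moment. *)
Lemma psi2_norm_le_exp {d} {T : measurableType d} {R : realType}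
    (P : probability T R) (Z : T -> R) (sg sg' : R) :
  (psi2_norm P Z <= sg%:E)%E -> sg < sg' ->
  0 < sg' /\ (\int[P]_w (expR (Z w ^+ 2 / sg' ^+ 2))%:E <= (expR 1)%:E)%E.
Proof.
move=> h ss; have : (psi2_norm P Z < sg'%:E)%E by apply: le_lt_trans h _; rewrite lte_fin.
move=> /ereal_inf_lt[_ [a /= [a0 ha] <-]]; rewrite lte_fin => asg.
have s0 : 0 < sg' by exact: lt_trans asg.
split => //; rewrite unlock in ha; apply: le_trans ha.
apply: ge0_le_integral_nm => w; first by rewrite lee_fin expR_ge0.
rewrite lee_fin ler_expR ler_wpM2l ?sqr_ge0// lef_pV2 ?posrE ?exprn_gt0//.
by rewrite ler_pXn2r ?nnegrE ?ltW.
Qed.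

Section oracle.
Context {R : realType}.
Variables (L lamm lamp : R).
Hypothesis L0 : 0 < L.
Hypothesis lamm0 : 0 < lamm.
Hypothesis lamp0 : 0 < lamp.

(** The rate of [quadratic_lower_tail], capped at 1 as [quadratic_form_lower] requires. *)
Definition tail_rate : R := Num.min (lamm ^+ 2 / (1536 * expR 1 * L ^+ 4)) 1.
Definition l1_rate : R := (@hit_bound R)^-1.
Definition noise_const : R := 16 * l1_rate * L.
Definition noise_mean_const : R := (10 + 2 * expR 1) * l1_rate * L.
Definition quad_const : R := (96 * L ^+ 2 + lamm) / tail_rate.
Definition bad_const : R := 16 / tail_rate ^+ 2.
(** The first summand serves the event where the quadratic form is bounded below, the second its
    complement. *)
Definition dist_const : R :=
  4 / lamm * (2 + 2 * quad_const * l1_rate ^+ 2) + 2 * l1_rate ^+ 2.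
(** Apart from lambda, the coefficient of pen(t) in the bound on the mean of the dominating function
    F. *)
Definition pen_const : R := noise_const + 1 + 2 * noise_mean_const + bad_const.
(** The energy of x - beta occurs twice in F, which gives 4 dist_const lamp. The last summand comes
    from lambda + pen_const <= (pen_const + 1)(lambda + 1), and the initial 2 from passing from x
    back to beta. *)
Definition oracle_const : R :=
  2 + 4 * dist_const * lamp + 2 * dist_const * (pen_const + 1).

Lemma tail_rate_gt0 : 0 < tail_rate.
Proof.
rewrite /tail_rate lt_min ltr01 andbT; apply: divr_gt0; first exact: exprn_gt0.
apply: mulr_gt0; last exact: exprn_gt0.
by apply: mulr_gt0 (expR_gt0 1); rewrite ltr0n.
Qed.

Lemma l1_rate_gt0 : 0 < l1_rate.
Proof. by rewrite invr_gt0 hit_bound_gt0. Qed.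

Lemma noise_const_gt0 : 0 < noise_const.
Proof. by apply: mulr_gt0 => //; apply: mulr_gt0 l1_rate_gt0. Qed.

Lemma noise_mean_const_gt0 : 0 < noise_mean_const.
Proof.
by apply: mulr_gt0 => //; apply: mulr_gt0 l1_rate_gt0; exact: addr_gt0.
Qed.

Lemma quad_const_gt0 : 0 < quad_const.
Proof.
apply: divr_gt0 tail_rate_gt0; apply: addr_gt0 => //; apply: mulr_gt0 => //.
exact: exprn_gt0.
Qed.

Lemma bad_const_gt0 : 0 < bad_const.
Proof. by apply: divr_gt0 => //; exact: exprn_gt0 tail_rate_gt0. Qed.

Lemma dist_const_gt0 : 0 < dist_const.
Proof.
have l2 : 0 < l1_rate ^+ 2 by exact: exprn_gt0 l1_rate_gt0.
apply: addr_gt0; last exact: mulr_gt0.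
apply: mulr_gt0; first exact: divr_gt0.
by apply: addr_gt0 => //; apply: mulr_gt0 => //; exact: mulr_gt0 quad_const_gt0.
Qed.

Lemma pen_const_gt0 : 0 < pen_const.
Proof.
have h1 := noise_const_gt0; have h2 := noise_mean_const_gt0; have h3 := bad_const_gt0.
by rewrite /pen_const; lra.
Qed.

Lemma oracle_const_gt0 : 0 < oracle_const.
Proof.
have h1 := dist_const_gt0; have h2 := pen_const_gt0.
have h3 : 0 < dist_const * lamp by exact: mulr_gt0.
have h4 : 0 < dist_const * (pen_const + 1) by apply: mulr_gt0 => //; lra.
by rewrite /oracle_const; lra.
Qed.

Context {d : measure_display} {T : measurableType d} (P : probability T R).
Context {N p : nat} (K : set 'cV[R]_p) (beta : 'cV[R]_p)
    (X : T -> 'M[R]_(N, p)) (xi Y : T -> 'cV[R]_N)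
    (Sigma : 'M[R]_p) (sigma lambda : R)
    (shat : T -> nat) (betahat : T -> 'cV[R]_p).
Hypothesis N0 : (0 < N)%N.
Hypothesis p0 : (0 < p)%N.
Hypothesis cptK : compact K.
Hypothesis cK : convex_set K.
Hypothesis sK : sign_perm_invariant K.
Hypothesis K0 : K 0.
Hypothesis mX : random_matrix X.
Hypothesis mxi : random_matrix xi.
Hypothesis indX : mutually_independent P (fun i : 'I_N => sigma_matrix (fun w => row i (X w))).
Hypothesis sgX : forall i, sub_gaussian P L (fun w => row i (X w)).
Hypothesis hS : forall i, has_second_moment P (fun w => row i (X w)) Sigma.
Hypothesis hl : loewner_le lamm%:M Sigma.
Hypothesis hu : loewner_le Sigma lamp%:M.
Hypothesis indxi : mutually_independent P (fun i : 'I_N => sigma_matrix (fun w => row i (xi w))).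
Hypothesis psi2 : forall i, (psi2_norm P (fun w => xi w i ord0) <= sigma%:E)%E.
Hypothesis indXxi : independent_systems P (sigma_matrix X) (sigma_matrix xi).
Hypothesis YE : forall w, Y w = X w *m beta + xi w.
Hypothesis opt : forall w, argmin
     [set sv : nat * 'cV[R]_p | (1 <= sv.1 <= p)%N /\ sparse_hull K sv.1 sv.2]
     (fun sv => N%:R^-1 * sqnorm2 (Y w - X w *m sv.2)
                + lambda * pen 7 sigma N K sv.1)
     (shat w, betahat w).
Hypothesis lambda_ge : noise_const + 1 <= lambda.

Let N0' : (0 : R) < N%:R. Proof. by rewrite ltr0n. Qed.

(** Admissible scales in the psi_2 norm are positive, and N > 0 provides a noise entry. A negative
    sigma would make the larger number sigma / 2 positive as well. *)
Lemma noise_level_ge0 : 0 <= sigma.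
Proof.
rewrite leNgt; apply/negP => s0.
have h : sigma < sigma / 2 by lra.
have [h2 _] := psi2_norm_le_exp P _ _ _ (psi2 (Ordinal N0)) h; lra.
Qed.

Let w_ := scaled_width K.
Let A_ (s : nat) : R := w_ s / Num.sqrt N%:R * (1 + Num.sqrt (log_factor 7 s / N%:R)).
Let pen_ := pen 7 sigma N K.

(** This is how the upper bound on Sigma enters: the approximation error x - beta is seen through X,
    and only on average. *)
Lemma design_energy (u : 'cV[R]_p) :
  (\int[P]_w (sqnorm2 (X w *m u) / N%:R)%:E <= (lamp * sqnorm2 u)%:E)%E.
Proof.
have mr i : random_matrix (fun w => row i (X w)).
  by move=> j k; under eq_fun do rewrite mxE; exact: mX.
have mZ i : measurable_fun setT (fun w => (X w *m u) i 0) by exact: measurable_mulmx_entry.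
have -> : (\int[P]_w (sqnorm2 (X w *m u) / N%:R)%:E =
   \int[P]_w (N%:R^-1 * \sum_(i <- index_enum 'I_N) ((X w *m u) i 0) ^+ 2)%:E)%E.
  by apply: eq_integral => w _; rewrite mulrC.
rewrite ge0_integralZ_EFin ?invr_ge0//; last 2 first.
- by apply: measurable_sum => i; exact: measurable_funX.
- by move=> w; apply: sumr_ge0 => i _; exact: sqr_ge0.
rewrite ge0_integral_sum_EFin; last 2 first.
- by move=> i; exact: measurable_funX.
- by move=> i w; exact: sqr_ge0.
rewrite (eq_bigr (fun=> ((u^T *m Sigma *m u) 0 0)%:E)); last first.
  move=> i _; rewrite -(second_moment_linear P _ _ u (mr i) (hS i)).
  by apply: eq_integral => w _; rewrite row_mulmx_entry.
have avg (z : R) : N%:R^-1 * (z *+ N) = z.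
  by rewrite -(mulr_natr z) mulrCA mulVf ?mulr1// gt_eqF.
rewrite sumEFin -EFinM lee_fin sumr_const card_ord avg.
have := hu u; rewrite mulmxBr mulmxBl mxE [X in _ + X]mxE subr_ge0 => /le_trans; apply.
rewrite mul_mx_scalar -scalemxAl mxE; apply: eq_ler; congr (lamp * _).
by rewrite mxE; apply: eq_bigr => j _; rewrite mxE expr2.
Qed.

(* The slack [eta] allows dividing by the noise level [sigma + eta], also when
   [sigma] is 0. *)
Lemma oracle_inequality_slack (t : nat) (x : 'cV[R]_p) (eta : R) : (1 <= t <= p)%N ->
  sparse_hull K t x -> 0 < eta ->
  (\int[P]_w (sqnorm2 (betahat w - beta))%:E <=
   (oracle_const * (sqnorm2 (x - beta) + (lambda + 1) * pen_ t) +
    eta * (2 * dist_const * (2 * noise_mean_const + 2 * noise_const) * A_ p))%:E)%E.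
Proof.
move=> /andP[t1 tp] xt eta0.
have s0 := noise_level_ge0.
pose sg := sigma + eta.
have sgs : sigma < sg by rewrite ltrDl.
have sg0 : 0 < sg by apply: le_lt_trans sgs.
have psi2' i := (psi2_norm_le_exp P _ _ _ (psi2 i) sgs).2.
have [B KB] := compact_coord_bounded K cptK.
have CA0 := l1_rate_gt0.
have w0 s : 0 <= w_ s := scaled_width_ge0 K p0 cK K0 B KB s.
have wle s s' : (s <= s')%N -> w_ s <= w_ s' := le_scaled_width K p0 cK K0 B KB s s'.
have r0 : 0 < Num.sqrt N%:R :> R by rewrite sqrtr_gt0.
have A0 s : 0 <= A_ s.
  by rewrite mulr_ge0 ?addr_ge0 ?sqrtr_ge0// divr_ge0 ?w0 ?sqrtr_ge0.
have Ale s s' : (s <= s')%N -> A_ s <= A_ s'.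
  move=> ss; rewrite /A_; apply: ler_pM.
  - by rewrite divr_ge0 ?w0 ?sqrtr_ge0.
  - by rewrite addr_ge0 ?sqrtr_ge0.
  - by rewrite ler_pM2r ?invr_gt0// wle.
  - by rewrite lerD2l ler_wsqrtr// ler_pM2r ?invr_gt0// le_log_factor.
have penE s : pen_ s = sigma * A_ s + w_ s ^+ 2 / N%:R by exact: penE.
have sA0 s : 0 <= sigma * A_ s by exact: mulr_ge0.
have w20 s : 0 <= w_ s ^+ 2 / N%:R by rewrite divr_ge0 ?sqr_ge0 ?(ltW N0').
have pen0 s : 0 <= pen_ s by rewrite penE addr_ge0.
have w2pen s : w_ s ^+ 2 / N%:R <= pen_ s by rewrite penE lerDr.
have sApen s : sigma * A_ s <= pen_ s by rewrite penE lerDl.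
have [Delta [mD D0 ED hD]] := multiplier_bound P X xi L sg mX mxi indX indxi indXxi L0 sgX sg0 psi2'
  N0 p0 l1_rate (w_ 1) (ltW CA0) (w0 1%N).
have kap1 : tail_rate <= 1 by rewrite ge_min lexx orbT.
have kap2 : tail_rate <= lamm ^+ 2 / (1536 * expR 1 * L ^+ 4) by rewrite ge_min lexx.
have [Om [mOm POm hOm]] := quadratic_form_lower P X L lamm Sigma mX indX L0 sgX lamm0 hS hl N0 p0
  tail_rate tail_rate_gt0 kap1 kap2.
rewrite -/quad_const in hOm.
set Lam := 1 + ln p%:R in hD hOm.
have Lam1 : 1 <= Lam by rewrite lerDl ln_ge0// ler1n.
have q1 : 1 <= Num.sqrt Lam by rewrite -[X in X <= _]sqrtr1 ler_wsqrtr.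
have q2 : Num.sqrt Lam ^+ 2 = Lam by rewrite sqr_sqrtr//; lra.
have hull1 s v (h1 : (1 <= s)%N) (h2 : (s <= p)%N) (h : sparse_hull K s v) :
    Num.sqrt Lam * l1norm v <= l1_rate * w_ s.
  exact: (hull_l1_bound K p0 cK sK K0 B KB s v h1 h2 h).
have hulls s v (h : sparse_hull K s v) :
    Num.sqrt Lam * l1norm v <= l1_rate * (s%:R * w_ 1).
  exact: (hull_l1_bound_card K p0 cK sK K0 B KB s v h).
have coord v j (h : K v) : Num.sqrt Lam * `|v j 0| <= l1_rate * w_ 1.
  exact: (body_coord_bound K p0 cK sK K0 B KB v j h).
(* The noise level is sigma + eta. The part due to eta is bounded through A_s <= A_p, so that the
   slack is the same for all s. *)
have noise w s v : (1 <= s)%N -> (s <= p)%N -> sparse_hull K s v ->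
    2 / N%:R * `|\sum_i xi w i 0 * (X w *m v) i 0| <=
      noise_const * pen_ s + noise_const * eta * A_ p + Delta w.
  move=> h1 h2 h; have l0 : 0 <= log_factor 7 s :> R by have := @log_factor_ge1 R s; lra.
  have hv := hD w v (w_ s) s%:R (log_factor 7 s) (w0 s) l0 (nat_le_exp_log_factor s)
    (hull1 s v h1 h2 h) (hulls s v h) (fun j => coord v j (sparse_hull_subset K s cK v h)).
  apply: le_trans hv _; rewrite lerD2r -/(A_ s) -/noise_const /sg mulrDl mulrDr.
  apply: lerD; first by rewrite ler_wpM2l ?(ltW noise_const_gt0).
  by rewrite -mulrA ler_wpM2l ?(ltW noise_const_gt0)// ler_wpM2l ?(ltW eta0)// Ale.
pose E := 2 * noise_const * eta * A_ p.
have E0 : 0 <= E by exact: mulr_ge0 (mulr_ge0 (mulr_ge0 (ler0n _ 2) (ltW noise_const_gt0)) (ltW eta0)) (A0 p).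
pose Q w := sqnorm2 (X w *m (x - beta)) / N%:R.
have Q0 w : 0 <= Q w by rewrite divr_ge0 ?sqnorm2_ge0 ?(ltW N0').
have lam0 : 0 <= lambda by apply: le_trans lambda_ge; have := noise_const_gt0; lra.
pose c1 := (lambda + noise_const) * pen_ t + E.
have c10 : 0 <= c1.
  by rewrite addr_ge0// mulr_ge0// addr_ge0// ltW// noise_const_gt0.
pose Rhs w := Q w + (c1 + 2 * Delta w).
have basic w : sqnorm2 (X w *m (betahat w - beta)) / N%:R +
    (lambda - noise_const) * pen_ (shat w) <= Rhs w.
  have [[/= /andP[sh1 shp] bh] /(_ (t, x)) /=] := opt w.
  rewrite t1 tp => /(_ (conj isT xt)); rewrite -/pen_.
  (* The noise is paired with v and with beta separately. The pairing with beta cancels between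
     betahat and x, so the noise bound is needed only on sparse hulls. *)
  have YX (v : 'cV[R]_p) : sqnorm2 (Y w - X w *m v) =
     sqnorm2 (X w *m (v - beta)) + 2 * \sum_i xi w i 0 * (X w *m beta) i 0
       - 2 * \sum_i xi w i 0 * (X w *m v) i 0 + sqnorm2 (xi w).
    have -> : Y w - X w *m v = - (X w *m (v - beta)) + xi w.
      by rewrite YE mulmxBr opprB addrAC.
    rewrite sqnorm2D sqnorm2N -addrA -[in RHS]addrA -[in RHS]addrA; congr (_ + _).
    rewrite [in RHS]addrA; congr (_ + _); rewrite -mulrBr -sumrB; congr (_ * _).
    by apply: eq_bigr => i _; rewrite mulmxBr !mxE; ring.
  rewrite !YX.
  have n1 := noise w _ _ sh1 shp bh; have n2 := noise w _ _ t1 tp xt.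
  have i2 : 0 <= 2 / N%:R :> R by rewrite divr_ge0// ltW.
  have m1 := ler_wpM2l i2 (ler_norm (\sum_i xi w i 0 * (X w *m betahat w) i 0)).
  have m2 := ler_wpM2l i2 (ler_norm (- \sum_i xi w i 0 * (X w *m x) i 0)).
  rewrite normrN in m2.
  rewrite /Rhs /Q /c1 /E.
  move: n1 n2 m1 m2; set a1 := sqnorm2 (X w *m (betahat w - beta)); set a2 := sqnorm2 (X w *m (x - beta)).
  set z0 := \sum_i _; set z1 := \sum_i _; set z2 := \sum_i _.
  rewrite !mulrDr; lra.
have penhat w : pen_ (shat w) <= Rhs w.
  apply: le_trans (basic w); rewrite -[leLHS]add0r; apply: lerD.
    by rewrite divr_ge0 ?sqnorm2_ge0 ?(ltW N0').
  by rewrite ler_peMl//; move: lambda_ge; lra.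
have fithat w : sqnorm2 (X w *m (betahat w - beta)) / N%:R <= Rhs w.
  apply: le_trans (basic w); rewrite lerDl mulr_ge0//; move: lambda_ge; lra.
(* F depends on the sample only through X, xi and the exceptional event, no longer on the
   estimator. *)
pose F w := Rhs w + Q w + pen_ t + N%:R * w_ 1 ^+ 2 * \1_(~` Om) w.
have Rhs0 w : 0 <= Rhs w by rewrite addr_ge0// addr_ge0// mulr_ge0.
have Nw0 : 0 <= N%:R * w_ 1 ^+ 2 by exact: mulr_ge0 (ltW N0') (sqr_ge0 _).
have iw0 w : 0 <= N%:R * w_ 1 ^+ 2 * \1_(~` Om) w.
  by apply: mulr_ge0 Nw0 _; rewrite indicE.
have F0 w : 0 <= F w.
  by apply: addr_ge0 (iw0 w); apply: addr_ge0 (pen0 t); exact: addr_ge0.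
have key w : sqnorm2 (betahat w - x) <= dist_const * F w.
  have [[/= /andP[sh1 shp] bh] _] := opt w.
  set h := betahat w - x.
  have l1h : Num.sqrt Lam * l1norm h <= l1_rate * (w_ (shat w) + w_ t).
    rewrite mulrDr; apply: le_trans (lerD (hull1 _ _ sh1 shp bh) (hull1 _ _ t1 tp xt)).
    rewrite -mulrDr ler_wpM2l ?sqrtr_ge0// -(l1normN x); exact: ler_l1normD.
  have S0 := sqnorm2_ge0 h.
  have i0 := iw0 w.
  have [wOm|wOm] := pselect (Om w).
    have := hOm w wOm h.
    have fit : sqnorm2 (X w *m h) / N%:R <= 2 * Rhs w + 2 * Q w.
      apply: (@le_trans _ _ ((2 * sqnorm2 (X w *m (betahat w - beta)) + 2 * sqnorm2 (X w *m (x - beta))) / N%:R)).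
        rewrite ler_pM2r ?invr_gt0//.
        have -> : h = (betahat w - beta) - (x - beta) by rewrite /h opprB addrA subrK.
        rewrite mulmxBr; apply: le_trans (sqnorm2D_le _ _) _; by rewrite sqnorm2N.
      by rewrite mulrDl -!mulrA lerD2r ler_wpM2l// fithat.
    (* The l1 remainder of the quadratic form is what the last summand of the penalty pays for, at
       shat as well as at t. *)
    have quad : l1norm h ^+ 2 * Lam / N%:R <= 2 * l1_rate ^+ 2 * (Rhs w + pen_ t).
      have : (Num.sqrt Lam * l1norm h) ^+ 2 <= (l1_rate * (w_ (shat w) + w_ t)) ^+ 2.
        rewrite ler_pXn2r ?nnegrE ?mulr_ge0 ?sqrtr_ge0 ?l1norm_ge0 ?(ltW CA0)//.
        by rewrite addr_ge0.
      rewrite exprMn q2 mulrC => hq.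
      apply: (@le_trans _ _ (2 * l1_rate ^+ 2 * (w_ (shat w) ^+ 2 / N%:R + w_ t ^+ 2 / N%:R))).
        rewrite -mulrDl mulrA ler_pM2r ?invr_gt0//; apply: le_trans hq _.
        set a := w_ (shat w); set b := w_ t.
        have -> : (l1_rate * (a + b)) ^+ 2 = l1_rate ^+ 2 * (a + b) ^+ 2 by rewrite exprMn.
        have -> : 2 * l1_rate ^+ 2 * (a ^+ 2 + b ^+ 2) = l1_rate ^+ 2 * (2 * (a ^+ 2 + b ^+ 2)) by ring.
        apply: ler_wpM2l; first exact: sqr_ge0.
        have := sqr_ge0 (a - b); lra.
      apply: ler_wpM2l; first exact: mulr_ge0 (ler0n _ 2) (sqr_ge0 _).
      apply: lerD; last exact: w2pen.
      exact: le_trans (w2pen _) (penhat w).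
    have := ler_wpM2l (ltW quad_const_gt0) quad.
    move=> hq hm.
    have hS' : sqnorm2 h <= 4 / lamm * (2 * Rhs w + 2 * Q w + quad_const * (2 * l1_rate ^+ 2 * (Rhs w + pen_ t))).
      have -> : sqnorm2 h = 4 / lamm * (lamm / 4 * sqnorm2 h) by field; rewrite gt_eqF.
      rewrite ler_wpM2l ?divr_ge0 ?(ltW lamm0)//; apply: le_trans hm _.
      exact: lerD.
    apply: le_trans hS' _.
    have k0 : 0 <= 2 * quad_const * l1_rate ^+ 2.
      exact: mulr_ge0 (mulr_ge0 (ler0n _ 2) (ltW quad_const_gt0)) (sqr_ge0 _).
    have k1 : 0 <= 2 * l1_rate ^+ 2 by exact: mulr_ge0 (ler0n _ 2) (sqr_ge0 _).
    have lp : 0 <= 4 / lamm by exact: divr_ge0 (ler0n _ 4) (ltW lamm0).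
    apply: (@le_trans _ _ (4 / lamm * ((2 + 2 * quad_const * l1_rate ^+ 2) * F w))).
      rewrite ler_wpM2l// /F.
      have := mulr_ge0 k0 (Q0 w); have := mulr_ge0 k0 i0; have := pen0 t; nra.
    rewrite mulrA /dist_const [leRHS]mulrDl lerDl; exact: mulr_ge0 k1 (F0 w).
  have ind1 : \1_(~` Om) w = 1 :> R by rewrite indicE mem_set.
  have lel1 (z : R) : 0 <= z -> z <= Num.sqrt Lam * z by move=> z0; rewrite ler_peMl.
  have hj j : `|h j 0| <= 2 * (l1_rate * w_ 1).
    rewrite mulr_natl mulr2n mxE; apply: le_trans (ler_normD _ _) _; rewrite mxE normrN.
    by apply: lerD; [apply: le_trans (lel1 _ _) (coord _ j (sparse_hull_subset K _ cK _ bh))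
                    |apply: le_trans (lel1 _ _) (coord _ j (sparse_hull_subset K _ cK _ xt))].
  have l1h' := le_trans (lel1 _ (l1norm_ge0 h)) l1h.
  have : sqnorm2 h <= 2 * (l1_rate * w_ 1) * (l1_rate * (w_ (shat w) + w_ t)).
    apply: le_trans (sqnorm2_le_sup_l1 _ _ hj) _.
    by rewrite ler_wpM2l// mulr_ge0// mulr_ge0 ?(ltW CA0).
  move=> /le_trans; apply.
  (* Splits w_1 w_s into w_s^2 / N, which the penalty bounds, and N w_1^2. The latter is tolerable
     because an event of probability O(1 / N^2) turns it into w_1^2 / N in the mean. *)
  have amgm (a b : R) : 2 * a * b <= N%:R * a ^+ 2 + b ^+ 2 / N%:R.
    have : 0 <= (N%:R * a - b) ^+ 2 / N%:R by rewrite divr_ge0 ?sqr_ge0 ?(ltW N0').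
    have -> : (N%:R * a - b) ^+ 2 / N%:R = N%:R * a ^+ 2 - 2 * a * b + b ^+ 2 / N%:R.
      by field; rewrite gt_eqF.
    lra.
  apply: (@le_trans _ _ (l1_rate ^+ 2 * (2 * F w))).
    have -> : 2 * (l1_rate * w_ 1) * (l1_rate * (w_ (shat w) + w_ t)) =
       l1_rate ^+ 2 * (2 * w_ 1 * w_ (shat w) + 2 * w_ 1 * w_ t) by ring.
    rewrite ler_wpM2l ?sqr_ge0// /F ind1 mulr1.
    have := amgm (w_ 1%N) (w_ (shat w)); have := amgm (w_ 1%N) (w_ t).
    have := w2pen t; have := le_trans (w2pen _) (penhat w).
    have := Q0 w; have := pen0 t; have := Rhs0 w; lra.
  rewrite /dist_const [leRHS]mulrDl -[leLHS]add0r; apply: lerD.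
    apply: mulr_ge0 (F0 w).
    apply: mulr_ge0; first exact: divr_ge0 (ler0n _ 4) (ltW lamm0).
    apply: addr_ge0 => //; apply: mulr_ge0 (sqr_ge0 _).
    exact: mulr_ge0 (ler0n _ 2) (ltW quad_const_gt0).
  by apply: eq_ler; ring.
have mQ : measurable_fun setT Q.
  apply: measurable_funM => //; apply: measurable_sum => i; apply: measurable_funX.
  exact: measurable_mulmx_entry.
have mi : measurable_fun setT (fun w => N%:R * w_ 1 ^+ 2 * \1_(~` Om) w).
  by apply: measurable_funM => //; apply: measurable_indic; exact: measurableC.
have mRhs : measurable_fun setT Rhs.
  by apply: measurable_funD => //; apply: measurable_funD => //; exact: measurable_funM.
have mF : measurable_fun setT F.
  by apply: measurable_funD => //; apply: measurable_funD => //; exact: measurable_funD.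
have EQ : (\int[P]_w (Q w)%:E <= (lamp * sqnorm2 (x - beta))%:E)%E by exact: design_energy.
have w1t : w_ 1 ^+ 2 / N%:R <= pen_ t.
  apply: le_trans (w2pen t); rewrite ler_pM2r ?invr_gt0//.
  by rewrite ler_pXn2r ?nnegrE ?wle.
have ED' : (\int[P]_w (Delta w)%:E <= (noise_mean_const * (pen_ t + eta * A_ p))%:E)%E.
  apply: le_trans ED _; rewrite lee_fin -/noise_mean_const ler_wpM2l ?(ltW noise_mean_const_gt0)//.
  apply: (@le_trans _ _ (sg * A_ 1)).
    rewrite ler_wpM2l ?(ltW sg0)// /A_ ler_peMr ?divr_ge0 ?sqrtr_ge0//.
    by rewrite lerDl sqrtr_ge0.
  rewrite /sg mulrDl; apply: lerD; last by rewrite ler_wpM2l ?(ltW eta0)// Ale.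
  by apply: le_trans (sApen t); rewrite ler_wpM2l// Ale.
have EI : (\int[P]_w (N%:R * w_ 1 ^+ 2 * \1_(~` Om) w)%:E <= (bad_const * pen_ t)%:E)%E.
  have mC : measurable (~` Om) by exact: measurableC.
  rewrite ge0_integralZ_EFin; [|exact: measurable_indic|by move=> w; rewrite indicE|exact: Nw0].
  rewrite integral_indic// setIT.
  apply: (@le_trans _ _ ((N%:R * w_ 1 ^+ 2)%:E * (16 / (tail_rate ^+ 2 * N%:R ^+ 2))%:E)%E).
    by apply: lee_wpmul2l POm; rewrite lee_fin.
  rewrite -EFinM lee_fin.
  have -> : N%:R * w_ 1 ^+ 2 * (16 / (tail_rate ^+ 2 * N%:R ^+ 2)) = bad_const * (w_ 1 ^+ 2 / N%:R).
    by rewrite /bad_const; field; rewrite !gt_eqF// tail_rate_gt0.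
  by rewrite ler_wpM2l ?(ltW bad_const_gt0).
have ERhs : (\int[P]_w (Rhs w)%:E <= (lamp * sqnorm2 (x - beta) + (c1 + 2 * (noise_mean_const * (pen_ t + eta * A_ p))))%:E)%E.
  rewrite ge0_integralD_EFin//; last 2 first.
  - by apply: measurable_funD => //; exact: measurable_funM.
  - by move=> w; rewrite addr_ge0// mulr_ge0.
  rewrite [leRHS]EFinD; apply: leeD => //.
  rewrite (ge0_integralD_EFin P (cst c1))//; last 2 first.
  - exact: measurable_funM.
  - by move=> w; rewrite mulr_ge0.
  rewrite (integral_cst_EFin P c1) [leRHS]EFinD leeD2l// ge0_integralZ_EFin// [leRHS]EFinM.
  by apply: lee_wpmul2l; rewrite ?lee_fin.
have EF : (\int[P]_w (F w)%:E <= (lamp * sqnorm2 (x - beta) + (c1 + 2 * (noise_mean_const * (pen_ t + eta * A_ p)))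
     + lamp * sqnorm2 (x - beta) + pen_ t + bad_const * pen_ t)%:E)%E.
  have mRQ : measurable_fun setT (fun w => Rhs w + Q w) by exact: measurable_funD.
  have RQ0 w : 0 <= Rhs w + Q w by exact: addr_ge0.
  have mG : measurable_fun setT (fun w => Rhs w + Q w + pen_ t).
    exact: measurable_funD.
  have G0 w : 0 <= Rhs w + Q w + pen_ t by exact: addr_ge0 (RQ0 w) (pen0 t).
  rewrite (ge0_integralD_EFin P _ _ mG mi G0 iw0) [leRHS]EFinD; apply: leeD => //.
  rewrite (ge0_integralD_EFin P _ (cst (pen_ t)) mRQ (measurable_cst _) RQ0 (fun=> pen0 t)).
  rewrite [leRHS]EFinD; apply: leeD; last by rewrite (integral_cst_EFin P (pen_ t)).
  by rewrite (ge0_integralD_EFin P _ _ mRhs mQ Rhs0 Q0) [leRHS]EFinD; exact: leeD.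
apply: (@le_trans _ _ (\int[P]_w (2 * dist_const * F w + 2 * sqnorm2 (x - beta))%:E)%E).
  apply: ge0_le_integral_nm => w; first by rewrite lee_fin sqnorm2_ge0.
  rewrite lee_fin; have -> : betahat w - beta = (betahat w - x) + (x - beta) by rewrite addrA subrK.
  apply: le_trans (sqnorm2D_le _ _) _; rewrite lerD2r -mulrA ler_wpM2l//.
have dc0 : 0 <= 2 * dist_const by rewrite mulr_ge0// ltW// dist_const_gt0.
rewrite (ge0_integralD_EFin P _ (cst (2 * sqnorm2 (x - beta))))//; last 3 first.
- exact: measurable_funM.
- by move=> w; rewrite mulr_ge0.
- by move=> w; rewrite mulr_ge0 ?sqnorm2_ge0.
rewrite (integral_cst_EFin P (2 * sqnorm2 (x - beta))) ge0_integralZ_EFin//.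
apply: le_trans (leeD (lee_wpmul2l _ EF) (lexx _)) _; first by rewrite lee_fin.
rewrite -EFinM -EFinD lee_fin /c1 /E /oracle_const.
set S := sqnorm2 (x - beta); set D := dist_const in dc0 *; set pt := pen_ t.
set a := A_ p; set nc := noise_const; set nm := noise_mean_const; set bc := bad_const.
have S0 : 0 <= S by exact: sqnorm2_ge0.
have pt0 : 0 <= pt by exact: pen0.
have pc : pen_const = nc + 1 + 2 * nm + bc by [].
have D0' : 0 <= D by rewrite ltW// dist_const_gt0.
have pc0 : 0 <= pen_const by rewrite ltW// pen_const_gt0.
(* This frees the constant of lambda, at the price of the factor lambda + 1 in front of the
   penalty. *)
have e1 : (lambda + pen_const) * pt <= (pen_const + 1) * ((lambda + 1) * pt).
  rewrite mulrA ler_wpM2r//; have := mulr_ge0 pc0 lam0; lra.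
have l1 : 0 <= (lambda + 1) * pt by apply: mulr_ge0 pt0; exact: addr_ge0.
have e2 := ler_wpM2l dc0 e1.
have e3 : 0 <= 4 * D * lamp * ((lambda + 1) * pt).
  apply: mulr_ge0 l1; apply: mulr_ge0 (ltW lamp0).
  exact: mulr_ge0 (ler0n _ 4) D0'.
have e4 : 0 <= 2 * ((lambda + 1) * pt) by exact: mulr_ge0 (ler0n _ 2) l1.
have e5 : 0 <= 2 * D * (pen_const + 1) * S.
  by apply: mulr_ge0 S0; apply: mulr_ge0 dc0 _; exact: addr_ge0.
have e6 : 2 * D * ((lambda + pen_const) * pt) =
   2 * D * ((lambda + nc) * pt + 2 * nm * pt + pt + bc * pt) by rewrite pc; ring.
rewrite e6 in e2.
move: e2 e3 e4 e5; lra.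
Qed.

End oracle.

Lemma sub_gaussian_le {d} {T : measurableType d} {R : realType}
    (P : probability T R) (p : nat) (Z : T -> 'rV[R]_p) (L L' : R) :
  `|L| <= L' -> sub_gaussian P L Z -> sub_gaussian P L' Z.
Proof.
move=> LL h delta v v1; apply: le_trans (h delta v v1) _.
rewrite lee_fin ler_expR ler_pM2r ?invr_gt0// ler_wpM2l ?sqr_ge0//.
by rewrite -(real_normK (num_real L)) lerXn2r ?nnegrE// (le_trans _ LL).
Qed.

Lemma symmetric_convex_has0 {R : realType} {p : nat} (K : set 'cV[R]_p) x :
  convex_set K -> centrally_symmetric K -> K x -> K 0.
Proof.
move=> cK symK Kx; have h0 : 0 <= 1 / 2 :> R by lra.
have h1 : 1 / 2 <= 1 :> R by lra.
have := (convex_setE K).1 cK x (- x) _ h0 h1 Kx (symK x Kx); congr K.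
by apply/matrixP => i j; rewrite !mxE; lra.
Qed.

Lemma probability_inhabited {d} {T : measurableType d} {R : realType}
    (P : probability T R) : exists w : T, True.
Proof.
apply: contrapT => /forallNP h; have := probability_setT P.
have -> : [set: T] = set0 by apply/seteqP; split => w // _; case: (h w).
by rewrite measure0 => /esym/eqP; rewrite onee_eq0.
Qed.

Theorem theorem2p6 (R : realType) :
  exists c : R, 6 < c /\
  forall L lamm lamp : R, 0 < lamm -> lamm <= lamp ->
  exists lambda0 C : R, 0 < lambda0 /\ 0 < C /\
  forall (d : measure_display) (T : measurableType d) (P : probability T R)
    (N p : nat) (K : set 'cV[R]_p) (beta : 'cV[R]_p)
    (X : T -> 'M[R]_(N, p)) (xi Y : T -> 'cV[R]_N)
    (Sigma : 'M[R]_p) (sigma lambda : R)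
    (shat : T -> nat) (betahat : T -> 'cV[R]_p),
  (0 < N)%N ->
  convex_body K -> centrally_symmetric K -> sign_perm_invariant K ->
  K beta ->
  random_matrix X -> random_matrix xi ->
  mutually_independent P
    (fun i : 'I_N => sigma_matrix (fun w => row i (X w))) ->
  (forall i, mean_zero P (fun w => row i (X w))) ->
  (forall i, sub_gaussian P L (fun w => row i (X w))) ->
  (forall i, has_second_moment P (fun w => row i (X w)) Sigma) ->
  loewner_le lamm%:M Sigma -> loewner_le Sigma lamp%:M ->
  mutually_independent P
    (fun i : 'I_N => sigma_matrix (fun w => row i (xi w))) ->
  mean_zero P xi ->
  (forall i, (psi2_norm P (fun w => xi w i ord0) <= sigma%:E)%E) ->
  independent_systems P (sigma_matrix X) (sigma_matrix xi) ->
  (forall w, Y w = X w *m beta + xi w) ->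
  random_matrix betahat ->
  (forall w, argmin
     [set sv : nat * 'cV[R]_p | (1 <= sv.1 <= p)%N /\ sparse_hull K sv.1 sv.2]
     (fun sv => N%:R^-1 * sqnorm2 (Y w - X w *m sv.2)
                + lambda * pen c sigma N K sv.1)
     (shat w, betahat w)) ->
  lambda0 <= lambda ->
  ('E_P[fun w => sqnorm2 (betahat w - beta)%R]
     <= C%:E * ereal_inf
          [set ereal_inf
             [set (sqnorm2 (x - beta) + (lambda + 1) * pen c sigma N K t)%R%:E
                | x in sparse_hull K t]
             | t in [set t | (1 <= t <= p)%N]])%E.
Proof.
(* 7 is the smallest integer above 6; [log_dim_le] would already hold with 3 in its place. *)
exists 7; split; first by rewrite ltr_nat.
move=> L lamm lamp lamm0 lammp.
have lamp0 : 0 < lamp by exact: lt_le_trans lammp.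
(* The sub-Gaussian condition depends on L through its square only, so L may be zero or negative; it
   is replaced by a larger positive parameter. *)
pose L' := `|L| + 1.
have L0 : 0 < L' by rewrite ltr_pwDr.
exists (noise_const L' + 1), (oracle_const L' lamm lamp); split.
  by rewrite addr_gt0// noise_const_gt0.
split; first exact: oracle_const_gt0.
move=> d T P N p K beta X xi Y Sigma sigma lambda shat betahat.
move=> N0 [cptK cK _] symK sK Kbeta mX mxi indX _ sgX hS hl hu indxi _ psi2 indXxi YE mbeta opt lam.
(* A probability space has a point, and the estimator there selects some s between 1 and p; hence p
   > 0. *)
have [w0 _] := probability_inhabited P.
have [[/= /andP[s1 sp] _] _] := opt w0.
have p0 : (0 < p)%N by exact: leq_trans sp.
have K0 := symmetric_convex_has0 K beta cK symK Kbeta.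
have sgX' i : sub_gaussian P L' (fun w => row i (X w)).
  by apply: sub_gaussian_le (sgX i); rewrite lerDl.
have C0 : 0 < oracle_const L' lamm lamp by exact: oracle_const_gt0.
rewrite -lee_pdivrMl//; apply: le_ereal_inf_tmp => _ [t /= tp <-].
apply: le_ereal_inf_tmp => _ [x xt <-].
rewrite lee_pdivrMl// unlock -EFinM; apply/lee_addgt0Pr => e e0.
set D := 2 * dist_const L' lamm * (2 * noise_mean_const L' + 2 * noise_const L') *
  (scaled_width K p / Num.sqrt N%:R * (1 + Num.sqrt (log_factor 7 p / N%:R))).
(* The slack eta is chosen so that eta D <= e; adding 1 to |D| avoids a zero denominator. Letting e
   be arbitrary removes the slack. *)
have De : 0 < e / (`|D| + 1) by rewrite divr_gt0// ltr_pwDr.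
have := oracle_inequality_slack L' lamm lamp L0 lamm0 lamp0 P K beta X xi Y Sigma sigma lambda shat betahat
  N0 p0 cptK cK sK K0 mX mxi indX sgX' hS hl hu indxi psi2 indXxi YE opt lam t x _ tp xt De.
move=> /le_trans; apply; rewrite -EFinD lee_fin lerD2l -/D.
rewrite mulrAC ler_pdivrMr ?ltr_pwDr// ler_wpM2l ?(ltW e0)//.
by apply: le_trans (ler_norm _) _; rewrite lerDl.
Qed.
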